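(* Let $V$ be a function system. The following are equivalent: (i) $V$ is nuclear, i.e. $V\otimes_{\min}W=V\otimes_{\max}W$ for every function system $W$; (ii) $V\otimes_{\min}E=V\otimes_{\max}E$ for any finite-dimensional function system $E$; (iii) there exist nets of unital positive maps $\varphi_\lambda:V\to\ell^\infty_{n_\lambda}$ and $\psi_\lambda:\ell^\infty_{n_\lambda}\to V$ such that $\psi_\lambda\circ\varphi_\lambda$ converges to $\mathrm{id}_V$ in the point-norm topology; (iv) there exist nets of weak$^*$-continuous unital positive maps $\varphi_\lambda:V^{**}\to\ell^\infty_{n_\lambda}$ and $\psi_\lambda:\ell^\infty_{n_\lambda}\to V^{**}$ such that $\psi_\lambda\circ\varphi_\lambda$ converges to $\mathrm{id}_{V^{**}}$ in the point-weak$^*$ topology; (v) the second dual $V^{**}$ is injective; (vi) given $V\subset V^{**}\subset C(K)$ with $K$ a compact Hausdorff space (the first inclusion being the canonical one and the second a unital order embedding), there exists a unital positive map $\Phi:C(K)\to V^{**}$ such that $\Phi|_V=\mathrm{id}_V$; (vii) for any function system $W_1$ containing $V$ and any function system $W_2$, the inclusion $V\otimes_{\max}W_2\subset W_1\otimes_{\max}W_2$ is an order embedding; (viii) for any function system $W$ containing $V$ and any finite-dimensional function system $E$, the inclusion $V\otimes_{\max}E\subset W\otimes_{\max}E$ is an order embedding; (ix) for any function systems $W_1\subset W_2$, the inclusion $V\otimes_{\max}W_1\subset V\otimes_{\max}W_2$ is an order embedding; (x) the state space $S(V)$ is a Choquet simplex.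
   Context: A function system is a real vector space $V$ with a (convex) cone $V^+$, $V^+\cap -V^+=\{0\}$ ($v\ge w$ iff $v-w\in V^+$), and an Archimedean order unit $e_V$: for each $v\in V$ there is $r>0$ with $re_V\ge v$, and $\varepsilon e_V+v\in V^+$ for all $\varepsilon>0$ implies $v\in V^+$. It carries the order norm $\|v\|=\inf\{r>0:-re_V\le v\le re_V\}$. All maps are linear; positive means mapping positive elements to positive elements, unital means mapping order unit to order unit. An order embedding is a linear map $T$ with $v\ge0\iff T(v)\ge0$. Containment $W_1\subset W_2$ of function systems means that $W_1$ is a subspace of $W_2$ with $W_1^+=W_1\cap W_2^+$ and the same order unit. A state on $V$ is a positive linear functional $f:V\to\mathbb R$ with $f(e_V)=1$; $S(V)$ is the set of states with the weak$^*$ topology, a compact convex set. $\ell^\infty_n$ is $\mathbb R^n$ with coordinatewise order and order unit $(1,\dots,1)$ ($n\ge 0$, with $\ell^\infty_0=\{0\}$). $C(K)$ is the space of real continuous functions on $K$ with pointwise order and order unit $1$. $V^*$ is the dual of $V$ for the order norm, with $(V^* )^+$ the positive functionals; $V^{**}$ is the dual of $V^*$, with $(V^{**})^+$ the functionals nonnegative on $(V^* )^+$ and order unit the canonical image of $e_V$; it is a function system containing $V$ canonically. Weak$^*$ on $V^{**}$ refers to the duality with $V^*$. Tensor products: on the algebraic tensor product $V\otimes W$ with order unit $e_V\otimes e_W$, $V\otimes_{\min}W$ has positive cone $\{z: (f\otimes g)(z)\ge0\ \forall f\in S(V), g\in S(W)\}$, and $V\otimes_{\max}W$ has positive cone $\{z:\forall\varepsilon>0,\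 z+\varepsilon e_V\otimes e_W\in V^+\otimes W^+\}$, where $V^+\otimes W^+$ is the set of finite sums $\sum_i v_i\otimes w_i$ with $v_i\in V^+$, $w_i\in W^+$. Equality $V\otimes_{\min}W=V\otimes_{\max}W$ means equality of positive cones. A function system $Z$ is injective if for all function systems $W_1\subset W_2$, every unital positive map $W_1\to Z$ extends to a unital positive map $W_2\to Z$. A compact convex set $K$ is a Choquet simplex if every point of $K$ is represented by a unique positive normalized boundary measure (one maximal in the Choquet order); equivalently, if the dual $A(K)^*$ of the function system $A(K)$ of real continuous affine functions on $K$ is lattice ordered. *)

(* Defs.v *)
From HB Require Import structures.
From mathcomp Require Import all_boot all_order all_algebra.
From mathcomp Require Import generic_quotient.
From mathcomp Require Import all_classical all_reals all_analysis.
From mathcomp Require Import lra.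
Set Implicit Arguments.
Unset Strict Implicit.
Unset Printing Implicit Defensive.
Import Order.TTheory GRing.Theory Num.Theory.
Import numFieldNormedType.Exports.
Local Open Scope classical_set_scope.
Local Open Scope ring_scope.
Local Open Scope quotient_scope.

(* The zero space, with fs_unit = 0, is a function system. *)
HB.mixin Record isFunctionSystem (R : realType) V & GRing.Lmodule R V := {
  fs_pos : set V ;
  fs_unit : V ;
  fs_posD : forall v w, fs_pos v -> fs_pos w -> fs_pos (v + w) ;
  fs_posZ : forall (a : R) v, 0 <= a -> fs_pos v -> fs_pos (a *: v) ;
  fs_posN : forall v, fs_pos v /\ fs_pos (- v) <-> v = 0 ;
  fs_order_unit : forall v, exists2 r : R, 0 < r & fs_pos (r *: fs_unit - v) ;
  fs_archimedean : forall v,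
    (forall eps : R, 0 < eps -> fs_pos (eps *: fs_unit + v)) -> fs_pos v
}.

#[short(type="funSysType")]
HB.structure Definition FunctionSystem (R : realType) :=
  {V of isFunctionSystem R V & GRing.Lmodule R V}.

Arguments fs_pos {R} V _ : rename.
Arguments fs_unit {R} V : rename.

Section OrderNotions.
Variable R : realType.

Definition positive_map (V W : funSysType R) (f : V -> W) :=
  forall v, fs_pos V v -> fs_pos W (f v).

Definition unital_map (V W : funSysType R) (f : V -> W) :=
  f (fs_unit V) = fs_unit W.

Definition unital_positive (V W : funSysType R) (f : V -> W) :=
  unital_map f /\ positive_map f.

(* The cones are arguments, so that the same definition serves for tensor
   products, which carry several cones. *)
Definition order_embedding (V W : lmodType R) (P : set V) (Q : set W)
  (T : {linear V -> W}) := forall v, P v <-> Q (T v).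

(* A containment of function systems V `<=` W is presented by its inclusion map,
   a unital order embedding; an order embedding is injective by fs_posN. *)
Definition fs_inclusion (V W : funSysType R) (i : {linear V -> W}) :=
  unital_map i /\ order_embedding (fs_pos V) (fs_pos W) i.

Definition ornorm (V : funSysType R) (v : V) : R :=
  inf [set r | 0 < r /\ fs_pos V (r *: fs_unit V + v)
                     /\ fs_pos V (r *: fs_unit V - v)].

Definition is_state (V : funSysType R) (f : V -> R^o) :=
  [/\ linear f, forall v, fs_pos V v -> 0 <= f v & f (fs_unit V) = 1].

Definition injective_fs (Z : funSysType R) :=
  forall (W1 W2 : funSysType R) (i : {linear W1 -> W2}), fs_inclusion i ->
  forall f : {linear W1 -> Z}, unital_positive f ->
  exists2 g : {linear W2 -> Z}, unital_positive g & forall w, g (i w) = f w.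

Definition fin_dim (E : lmodType R) :=
  exists (n : nat) (b : 'I_n -> E),
    forall x, exists c : 'I_n -> R, x = \sum_(i < n) c i *: b i.

End OrderNotions.

Section FunctionSystemTheory.
Variables (R : realType) (V : funSysType R).
Implicit Types (v w : V) (a r : R).
Local Notation pos := (fs_pos V).
Local Notation e := (fs_unit V).

Lemma fs_pos0 : pos 0.
Proof. by have [_ /(_ erefl) []] := fs_posN (0 : V). Qed.

Lemma fs_pos_unit : pos e.
Proof.
have [r r0] := fs_order_unit (0 : V); rewrite subr0 => rp.
have := fs_posZ r^-1 _ _ rp; rewrite scalerA mulVf ?gt_eqF// scale1r.
by apply; rewrite invr_ge0 ltW.
Qed.

Lemma fs_pos_unitZ a : 0 <= a -> pos (a *: e).
Proof. by move=> a0; apply: fs_posZ => //; exact: fs_pos_unit. Qed.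

Lemma fs_abs_unit v : exists2 r, 0 < r & pos (r *: e + v) /\ pos (r *: e - v).
Proof.
have [r r0 rv] := fs_order_unit v; have [s s0] := fs_order_unit (- v).
rewrite opprK => sv; exists (r + s); first exact: addr_gt0.
rewrite scalerDl; split.
  by rewrite -addrA; apply: fs_posD => //; exact/fs_pos_unitZ/ltW.
by rewrite addrAC; apply: fs_posD => //; exact/fs_pos_unitZ/ltW.
Qed.

Lemma ornorm_le v r : 0 < r -> pos (r *: e + v) -> pos (r *: e - v) ->
  ornorm v <= r.
Proof.
by move=> r0 rp rn; apply: ge_inf; [exists 0 => x [/ltW] | split].
Qed.

Lemma ornorm_ge v a :
  (forall r, 0 < r -> pos (r *: e + v) -> pos (r *: e - v) -> a <= r) ->
  a <= ornorm v.
Proof.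
move=> h; apply: lb_le_inf; last by move=> r [r0 [rp rn]]; exact: h.
by have [r r0 [rp rn]] := fs_abs_unit v; exists r.
Qed.

Lemma ornorm_ge0 v : 0 <= ornorm v.
Proof. by apply: ornorm_ge => r /ltW. Qed.

End FunctionSystemTheory.

(* Used with N the order norm of V, giving V*, and then with N the dual norm on
   V*, giving V**. *)
Section BoundedFunctionals.
Variables (R : realType) (V : lmodType R) (N : V -> R).

Definition is_bounded_functional (f : V -> R^o) :=
  linear f /\ exists M : R, forall v, `|f v| <= M * N v.

Definition bounded_functionals : {pred (V -> R^o)} :=
  [pred f | `[< is_bounded_functional f >]].

Definition bdual : Type := {f : V -> R^o | f \in bounded_functionals}.

Lemma bounded_functionals_submod : submod_closed bounded_functionals.
Proof.
split; first apply/asboolP; first split.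
- by move=> a v w; rewrite /= scaler0 addr0.
- by exists 0 => v; rewrite mul0r normr0.
move=> a f g /asboolP[lf [M fM]] /asboolP[lg [M' gM']]; apply/asboolP.
have E v : (a *: f + g) v = a *: f v + g v by [].
split=> [b v w|].
  rewrite !E lf lg !scalerDr !scalerA [a * b]mulrC.
  by rewrite -!addrA; congr (_ + _); rewrite addrCA.
exists (`|a| * M + M') => v; rewrite E.
apply: le_trans (ler_normD _ _) _; rewrite mulrDl lerD// normrZ -mulrA.
by rewrite ler_wpM2l.
Qed.

HB.instance Definition _ :=
  GRing.isSubmodClosed.Build R (V -> R^o) bounded_functionals
    bounded_functionals_submod.

HB.instance Definition _ := [isSub for (@sval _ _ : bdual -> (V -> R^o))].
HB.instance Definition _ := [Choice of bdual by <:].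
HB.instance Definition _ := [SubChoice_isSubLmodule of bdual by <:].

Definition bfun (f : bdual) : V -> R^o := val f.

Lemma bfun_linear (f : bdual) : linear (bfun f).
Proof. by have /asboolP[] := valP f. Qed.

HB.instance Definition _ (f : bdual) :=
  GRing.isLinear.Build R V R^o _ (bfun f) (bfun_linear f).

Lemma bfun_bounded (f : bdual) : exists M : R, forall v, `|bfun f v| <= M * N v.
Proof. by have /asboolP[] := valP f. Qed.

Definition mk_bdual (f : V -> R^o) (fP : is_bounded_functional f) : bdual :=
  exist _ f (asboolT fP).

Definition dnorm (f : bdual) : R := sup [set `|bfun f v| | v in [set v | N v <= 1]].

End BoundedFunctionals.

Coercion bfun : bdual >-> Funclass.

Definition fs_dual (R : realType) (V : funSysType R) : Type := bdual (@ornorm R V).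
Identity Coercion bdual_of_fs_dual : fs_dual >-> bdual.
HB.instance Definition _ (R : realType) (V : funSysType R) :=
  GRing.Lmodule.on (fs_dual V).

Definition dual_pos (R : realType) (V : funSysType R) : set (fs_dual V) :=
  [set f : fs_dual V | forall v, fs_pos V v -> 0 <= f v].

Definition bidual (R : realType) (V : funSysType R) : Type :=
  bdual (@dnorm R V (@ornorm R V)).
Identity Coercion bdual_of_bidual : bidual >-> bdual.
HB.instance Definition _ (R : realType) (V : funSysType R) :=
  GRing.Lmodule.on (bidual V).

Definition bidual_pos (R : realType) (V : funSysType R) : set (bidual V) :=
  [set F : bidual V | forall f : fs_dual V, dual_pos f -> 0 <= F f].

(* Every sublinear functional on a real vector space dominates a linear one
   (Hahn-Banach): a minimal sublinear functional is linear. This gives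
   V* = V*^+ - V*^+, hence the properness of the cone of V**. *)
Section Sublinear.
Variables (R : realType) (V : lmodType R).

Definition sublinear (p : V -> R) :=
  (forall v w, p (v + w) <= p v + p w) /\
  (forall (a : R) v, 0 < a -> p (a *: v) <= a * p v).

Lemma sublinearZ p (a : R) v : sublinear p -> 0 <= a -> p (a *: v) = a * p v.
Proof.
move=> [pD pZ]; rewrite le_eqVlt => /orP[/eqP <-|a0].
  rewrite scale0r mul0r; apply/eqP; rewrite eq_le; apply/andP; split.
    have := pZ 2^-1 0 _; rewrite scaler0 invr_gt0 ltr0n => /(_ isT).
    by rewrite mulrC; lra.
  have := pZ 2 0 _; rewrite scaler0 ltr0n => /(_ isT); lra.
apply/eqP; rewrite eq_le pZ //=.
have := pZ a^-1 (a *: v); rewrite invr_gt0 => /(_ a0).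
by rewrite scalerA mulVf ?gt_eqF// scale1r mulrC ler_pdivlMr// mulrC.
Qed.

Lemma sublinear0 p : sublinear p -> p 0 = 0.
Proof. by move=> sp; rewrite -(scale0r 0) sublinearZ// mul0r. Qed.

Lemma sublinear_ge p v : sublinear p -> - p (- v) <= p v.
Proof.
move=> sp; have := sp.1 v (- v); rewrite subrr sublinear0//; lra.
Qed.

Lemma minimal_sublinear p : sublinear p ->
  exists q, [/\ sublinear q, forall v, q v <= p v &
    forall q', sublinear q' -> (forall v, q' v <= q v) -> q' = q].
Proof.
move=> sp.
pose T := {q : V -> R | `[< sublinear q /\ forall v, q v <= p v >]}.
pose le (q q' : T) := `[< forall v, val q' v <= val q v >].
have Tsub (q : T) : sublinear (val q) by have /asboolP[] := valP q.
have Tle (q : T) v : val q v <= p v by have /asboolP[_] := valP q; apply.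
have Tge (q : T) v : - p (- v) <= val q v.
  by apply: le_trans (sublinear_ge _ (Tsub q)); rewrite lerN2.
have [|||A Atot|q qmax] := @Zorn T le.
- by move=> q; apply/asboolP.
- move=> q r s /asboolP qr /asboolP rs; apply/asboolP => v.
  exact: le_trans (rs v) (qr v).
- move=> q r /asboolP qr /asboolP rq; apply/val_inj/funext => v.
  by apply/eqP; rewrite eq_le qr rq.
- have [[q0 Aq0]|A0] := pselect (exists q, A q); last first.
    have pT : `[< sublinear p /\ forall v, p v <= p v >] by apply/asboolP.
    by exists (exist _ p pT) => s As; exfalso; apply: A0; exists s.
  pose m v := inf [set val q v | q in A].
  have mlb q v : A q -> m v <= val q v.
    move=> Aq; apply: ge_inf; last by exists q.
    by exists (- p (- v)) => _ [r _ <-].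
  have mge v a : (forall q, A q -> a <= val q v) -> a <= m v.
    move=> h; apply: lb_le_inf; first by exists (val q0 v); exists q0.
    by move=> _ [q Aq <-]; exact: h.
  have sm : sublinear m.
    split=> [v w|a v a0].
      rewrite -lerBlDr; apply: (mge) => q Aq.
      rewrite lerBlDr -lerBlDl; apply: (mge) => r Ar; rewrite lerBlDl.
      have [/asboolP qr|/asboolP rq] := Atot _ _ Aq Ar.
        apply: le_trans (mlb r _ Ar) _; apply: le_trans ((Tsub r).1 _ _) _.
        by rewrite lerD2r.
      apply: le_trans (mlb q _ Aq) _; apply: le_trans ((Tsub q).1 _ _) _.
      by rewrite lerD2l.
    rewrite -ler_pdivrMl//; apply: (mge) => q Aq; rewrite ler_pdivrMl//.
    by apply: le_trans (mlb q _ Aq) _; apply: (Tsub q).2.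
  have mT : `[< sublinear m /\ forall v, m v <= p v >].
    by apply/asboolP; split=> // v; exact: le_trans (mlb _ _ Aq0) (Tle q0 v).
  by exists (exist _ m mT) => s As; apply/asboolP => v; exact: mlb.
exists (val q); split=> // q' sq' q'q.
have q'T : `[< sublinear q' /\ forall v, q' v <= p v >].
  by apply/asboolP; split=> // v; exact: le_trans (q'q v) (Tle q v).
by have /(congr1 val) := qmax (exist _ q' q'T) (asboolT q'q).
Qed.

Lemma sublinear_linear p : sublinear p ->
  exists2 g : V -> R^o, linear g & forall v, g v <= p v.
Proof.
move=> /minimal_sublinear[q [sq qp qmin]]; exists q => //.
have qD y x : q (x + y) = q x + q y.
  apply/eqP; rewrite eq_le sq.1 /=.
  pose S x := [set q (x + t *: y) - t * q y | t in [set t : R | 0 <= t]].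
  pose m x := inf (S x).
  have mlb z t : 0 <= t -> m z <= q (z + t *: y) - t * q y.
    move=> t0; apply: ge_inf; last by exists t.
    exists (- q (- z)) => _ [s s0 <-].
    have := sq.1 (- z) (z + s *: y); rewrite addKr sublinearZ//; lra.
  have mge z a : (forall t, 0 <= t -> a <= q (z + t *: y) - t * q y) -> a <= m z.
    move=> h; apply: lb_le_inf => [|_ [t t0 <-]]; last exact: h.
    by exists (q (z + 0 *: y) - 0 * q y); exists 0 => /=.
  have sm : sublinear m.
    split=> [v w|a v a0].
      rewrite -lerBlDr; apply: (mge) => t t0.
      rewrite lerBlDr -lerBlDl; apply: (mge) => s s0; rewrite lerBlDl.
      have := mlb (v + w) (t + s) (addr_ge0 t0 s0).
      have := sq.1 (v + t *: y) (w + s *: y).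
      by rewrite addrACA -scalerDl mulrDl; lra.
    rewrite -ler_pdivrMl//; apply: (mge) => t t0; rewrite ler_pdivrMl//.
    have := mlb (a *: v) (a * t) (mulr_ge0 (ltW a0) t0).
    by rewrite -scalerA -scalerDr (sublinearZ _ sq (ltW a0)) mulrBr mulrA.
  have mq : m = q.
    apply: qmin => // z; have := mlb z 0 (lexx _).
    by rewrite scale0r addr0 mul0r subr0.
  have := mlb x 1 ler01; rewrite mq scale1r mul1r; lra.
have qN x : q (- x) = - q x.
  by have := qD x (- x); rewrite addNr sublinear0//; lra.
move=> a v w; rewrite qD; congr (_ + _).
have [a0|/ltW a0] := lerP 0 a; first exact: sublinearZ.
by rewrite -[LHS]opprK -qN -scaleNr sublinearZ ?oppr_ge0// mulNr opprK.
Qed.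

End Sublinear.

Lemma scaleoE (R : realType) (a : R) (x : R^o) : a *: x = a * x.
Proof. by []. Qed.

Section BidualFunctionSystem.
Variables (R : realType) (V : funSysType R).
Implicit Types (v w : V) (f g : fs_dual V) (F : bidual V) (r : R).
Local Notation pos := (fs_pos V).
Local Notation e := (fs_unit V).

Lemma positive_bounded (g : {linear V -> R^o}) :
  (forall v, pos v -> 0 <= g v) -> is_bounded_functional (@ornorm R V) g.
Proof.
move=> gp; split; [exact: linearP | exists (g e) => v].
have ge0 : 0 <= g e by apply: gp; exact: fs_pos_unit.
have gr r : pos (r *: e + v) -> pos (r *: e - v) -> `|g v| <= r * g e.
  move=> /gp + /gp; rewrite linearD linearB linearZ ler_norml /= !scaleoE => ? ?.
  by apply/andP; split; lra.
have [g0|g0] := eqVneq (g e) 0.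
  by have [r _ [/gr /[apply]]] := fs_abs_unit v; rewrite g0 mul0r mulr0.
have {}ge0 : 0 < g e by rewrite lt_neqAle eq_sym g0.
rewrite mulrC -ler_pdivrMr//; apply: ornorm_ge => r _ rp rn.
by rewrite ler_pdivrMr//; exact: gr.
Qed.

Lemma dual_le f : exists2 M : R, 0 <= M & forall r v, 0 <= r ->
  pos (r *: e + v) -> pos (r *: e - v) -> `|f v| <= M * r.
Proof.
have [M fM] := bfun_bounded f; exists `|M| => // r v r0 rp rn.
apply: le_trans (fM v) _; apply: le_trans (ler_norm _) _.
rewrite normrM ler_wpM2l// ger0_norm ?ornorm_ge0//.
apply/ler_addgt0Pr => eps eps0; apply: ornorm_le; first exact: ltr_wpDl.
  by rewrite scalerDl addrAC; apply: fs_posD => //; exact/fs_pos_unitZ/ltW.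
by rewrite scalerDl addrAC; apply: fs_posD => //; exact/fs_pos_unitZ/ltW.
Qed.

Lemma unit0_trivial : e = 0 -> forall v, v = 0.
Proof.
move=> e0 v; have [r _] := fs_abs_unit v.
by rewrite e0 scaler0 !add0r => -[? ?]; apply/fs_posN.
Qed.

Lemma dual_decomposition f : exists2 g, dual_pos g & dual_pos (g - f).
Proof.
have [e0|e0] := eqVneq e 0.
  have f0 : f = 0.
    apply/val_inj/funext => v; rewrite (unit0_trivial e0 v).
    by change (f 0 = 0); exact: linear0.
  by exists 0; rewrite ?f0 ?subr0 => v _; rewrite /=.
have [M M0 fM] := dual_le f.
have unit_ge0 r : pos (r *: e) -> 0 <= r.
  move=> rp; rewrite leNgt; apply: contra_neqN e0 => r0.
  apply/fs_posN; split; first exact: fs_pos_unit.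
  have /fs_posZ/(_ rp) : 0 <= - r^-1 by rewrite oppr_ge0 invr_le0 ltW.
  by rewrite scalerA mulNr mulVf ?lt_eqF// scaleN1r.
pose S x := [set y | exists r a,
  [/\ pos a, pos (r *: e - a - x) & y = M * r - f a]].
have Slb x : exists b, lbound (S x) b.
  have [s s0 [sp _]] := fs_abs_unit x.
  exists (- (M * s)) => _ [r [a [pa rp ->]]].
  have rsa : pos ((r + s) *: e - a).
    have := fs_posD _ _ rp sp.
    by rewrite addrCA subrK addrA -scalerDl [s + r]addrC.
  have rs : pos ((r + s) *: e) by rewrite -[X in pos X](subrK a); exact: fs_posD.
  have := fM (r + s) a (unit_ge0 _ rs) (fs_posD _ _ rs pa) rsa.
  have := ler_norm (f a); lra.
pose p x := inf (S x).
have plb x r a : pos a -> pos (r *: e - a - x) -> p x <= M * r - f a.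
  by move=> pa rp; apply: ge_inf => //; exists r, a.
have pge x b : (forall r a, pos a -> pos (r *: e - a - x) ->
    b <= M * r - f a) -> b <= p x.
  move=> h; apply: lb_le_inf => [|_ [r [a [pa rp ->]]]]; last exact: h.
  have [s s0 sx] := fs_order_unit x; exists (M * s - f 0), s, 0; split=> //.
    exact: fs_pos0.
  by rewrite subr0.
have sp : sublinear p.
  split=> [v w|c v c0].
    rewrite -lerBlDr; apply: (pge) => r a pa rp.
    rewrite lerBlDr -lerBlDl; apply: (pge) => s b pb sb; rewrite lerBlDl.
    have := plb (v + w) (r + s) (a + b) (fs_posD _ _ pa pb).
    rewrite [f (a + b)]linearD scalerDl !opprD [_ + (- a + _)]addrACA.
    rewrite [_ + (- v + _)]addrACA.
    move=> /(_ (fs_posD _ _ rp sb)); lra.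
  rewrite -ler_pdivrMl//; apply: (pge) => r a pa rp; rewrite ler_pdivrMl//.
  have := plb (c *: v) (c * r) (c *: a) (fs_posZ _ _ (ltW c0) pa).
  rewrite -scalerA -!scalerBr => /(_ (fs_posZ _ _ (ltW c0) rp)).
  by rewrite linearZ /= scaleoE; lra.
have [g lg gp] := sublinear_linear sp.
pose gl := HB.pack_for {linear V -> R^o} g (GRing.isLinear.Build R V R^o _ g lg).
have gN v : g (- v) = - g v by exact: (linearN gl).
have g_pos v : pos v -> 0 <= g v.
  move=> pv; rewrite -oppr_le0 -gN; apply: le_trans (gp _) _.
  have := plb (- v) 0 0 (fs_pos0 V); rewrite [f 0]linear0 mulr0 scale0r !subr0 opprK.
  by rewrite add0r; apply.
exists (mk_bdual (positive_bounded (g := gl) g_pos)) => // v pv.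
change (0 <= g v - f v); rewrite subr_ge0 -lerN2 -gN.
apply: le_trans (gp _) _.
have := plb (- v) 0 v pv; rewrite scale0r mulr0 sub0r opprK addNr.
by rewrite sub0r; apply; exact: fs_pos0.
Qed.

End BidualFunctionSystem.

Section BidualInstance.
Variables (R : realType) (V : funSysType R).
Local Notation pos := (fs_pos V).
Local Notation e := (fs_unit V).

Lemma dnorm_bound (f : fs_dual V) (v : V) (t : R) : 0 < t ->
  pos (t *: e + v) -> pos (t *: e - v) -> `|f v| <= t * dnorm f.
Proof.
move=> t0 tp tn; have [M M0 fM] := dual_le f.
have t1 : ornorm (t^-1 *: v) <= 1.
  apply: ornorm_le => //; rewrite -[1](mulVf (lt0r_neq0 t0)) -scalerA.
    by rewrite -scalerDr; apply: fs_posZ => //; rewrite invr_ge0 ltW.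
  by rewrite -scalerBr; apply: fs_posZ => //; rewrite invr_ge0 ltW.
suff : `|f (t^-1 *: v)| <= dnorm f.
  by rewrite linearZ normrZ /= ger0_norm ?invr_ge0 ?(ltW t0)// ler_pdivrMl.
rewrite /dnorm; apply: ub_le_sup; last by exists (t^-1 *: v).
have [N fN] := bfun_bounded f; exists `|N| => _ [w /= w1 <-].
apply: le_trans (fN w) _; apply: le_trans (ler_norm _) _.
by rewrite normrM ler_piMr// ger0_norm ?ornorm_ge0.
Qed.

Lemma dnorm_pos (f : fs_dual V) : dual_pos f -> dnorm f <= f e.
Proof.
move=> fp; rewrite /dnorm; apply: ge_sup.
  exists `|f 0|, 0 => //=; apply: (@le_trans _ _ 0) => //.
  apply/ler_addgt0Pr => eps eps0; rewrite add0r; apply: ornorm_le => //.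
    by rewrite addr0; exact/fs_pos_unitZ/ltW.
  by rewrite subr0; exact/fs_pos_unitZ/ltW.
move=> _ [v /= v1 <-].
have fr (r : R) : 0 < r -> pos (r *: e + v) -> pos (r *: e - v) ->
    `|f v| <= r * f e.
  move=> _ /fp + /fp; rewrite linearD linearB linearZ ler_norml /= !scaleoE.
  by move=> ? ?; apply/andP; split; lra.
have fe : 0 <= f e by apply: fp; exact: fs_pos_unit.
have [f0|f0] := eqVneq (f e) 0.
  have [r r0 [rp rn]] := fs_abs_unit v.
  by have := fr r r0 rp rn; rewrite f0 mulr0.
have {}fe : 0 < f e by rewrite lt_neqAle eq_sym f0.
rewrite -[leRHS]mul1r -ler_pdivrMr//; apply: le_trans v1.
by apply: ornorm_ge => r r0 rp rn; rewrite ler_pdivrMr//; exact: fr.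
Qed.

Lemma bidual_incl_bounded (v : V) :
  is_bounded_functional (@dnorm R V (@ornorm R V)) (fun f : fs_dual V => f v : R^o).
Proof.
split; first by [].
by have [t t0 [tp tn]] := fs_abs_unit v; exists t => f; exact: dnorm_bound.
Qed.

Definition bidual_incl (v : V) : bidual V := mk_bdual (bidual_incl_bounded v).

Lemma bidual_incl_linear : linear bidual_incl.
Proof.
move=> a v w; apply/val_inj/funext => f.
by change (bfun f (a *: v + w) = a *: bfun f v + bfun f w); exact: linearP.
Qed.

HB.instance Definition _ := GRing.isLinear.Build R V (bidual V) _ bidual_incl
  bidual_incl_linear.

Lemma bidual_posD F G :
  bidual_pos F -> bidual_pos G -> bidual_pos (F + G : bidual V).
Proof. by move=> Fp Gp f fp; apply: addr_ge0; [exact: Fp | exact: Gp]. Qed.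

Lemma bidual_posZ (a : R) F :
  0 <= a -> bidual_pos F -> bidual_pos (a *: F : bidual V).
Proof.
move=> a0 Fp f fp; change (0 <= a * bfun F f).
by apply: mulr_ge0 => //; exact: Fp.
Qed.

Lemma bidual_posN (F : bidual V) : bidual_pos F /\ bidual_pos (- F) <-> F = 0.
Proof.
split=> [[Fp Fn]|->]; last by rewrite oppr0; split=> f _; exact: lexx.
have F0 (f : fs_dual V) : dual_pos f -> F f = 0.
  move=> fp; apply/eqP; rewrite eq_le Fp// andbT.
  by rewrite -oppr_ge0; exact: Fn.
apply/val_inj/funext => f; change (F f = 0).
have [g gp gf] := dual_decomposition f.
have FB : F (g - (g - f) : fs_dual V) = F g - F (g - f : fs_dual V) by exact: linearB.
by rewrite -(subKr g f) FB (F0 _ gp) (F0 _ gf) subrr.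
Qed.

Lemma bidual_order_unit (F : bidual V) :
  exists2 r : R, 0 < r & bidual_pos (r *: bidual_incl e - F : bidual V).
Proof.
have [M FM] := bfun_bounded F; exists (`|M| + 1); first by rewrite ltr_wpDl.
move=> f fp; change (0 <= (`|M| + 1) * f e - F f); rewrite subr_ge0.
apply: le_trans (ler_norm _) _; apply: le_trans (FM f) _.
apply: le_trans (ler_norm _) _; rewrite normrM.
have d0 : 0 <= dnorm f.
  have := dnorm_bound f (v := 0) ltr01; rewrite addr0 subr0 scale1r mul1r.
  by move=> /(_ (fs_pos_unit V) (fs_pos_unit V)); exact: le_trans.
rewrite (ger0_norm d0); apply: ler_pM => //; last exact: dnorm_pos.
by rewrite lerDl.
Qed.

Lemma bidual_archimedean (F : bidual V) :
  (forall eps : R, 0 < eps -> bidual_pos (eps *: bidual_incl e + F : bidual V)) ->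
  bidual_pos F.
Proof.
move=> h f fp; apply/ler_addgt0Pr => eps eps0.
have fe : 0 <= f e by apply: fp; exact: fs_pos_unit.
have k0 : 0 < f e + 1 by rewrite ltr_wpDl.
have := h (eps / (f e + 1)) (divr_gt0 eps0 k0) f fp.
rewrite [X in 0 <= X]/(_ * f e + F f).
move=> /le_trans; apply; rewrite [leRHS]addrC lerD2r mulrAC ler_pdivrMr//.
by rewrite ler_wpM2l ?(ltW eps0)// lerDl.
Qed.

HB.instance Definition _ := isFunctionSystem.Build R (bidual V)
  bidual_posD bidual_posZ bidual_posN bidual_order_unit bidual_archimedean.

End BidualInstance.

Definition linfty (R : realType) (n : nat) : Type := 'rV[R]_n.

Section Linfty.
Variables (R : realType) (n : nat).
Local Notation T := (linfty R n).

HB.instance Definition _ := GRing.Lmodule.copy T 'rV[R]_n.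

Definition linfty_pos : set T := [set v : 'rV[R]_n | forall i, 0 <= v ord0 i].
Definition linfty_unit : T := const_mx 1.

Lemma linfty_posD v w : linfty_pos v -> linfty_pos w -> linfty_pos (v + w).
Proof. by move=> vp wp i; rewrite mxE addr_ge0. Qed.

Lemma linfty_posZ (a : R) v : 0 <= a -> linfty_pos v -> linfty_pos (a *: v).
Proof. by move=> a0 vp i; rewrite mxE mulr_ge0. Qed.

Lemma linfty_posN v : linfty_pos v /\ linfty_pos (- v) <-> v = 0.
Proof.
split=> [[vp vn]|->]; last by rewrite oppr0; split=> i; rewrite mxE.
apply/rowP => i; apply/eqP; rewrite mxE eq_le vp andbT -oppr_ge0.
by have := vn i; rewrite mxE.
Qed.

Lemma linfty_order_unit v :
  exists2 r : R, 0 < r & linfty_pos (r *: linfty_unit - v).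
Proof.
exists (\sum_i `|(v : 'rV[R]_n) ord0 i| + 1).
  by rewrite ltr_wpDl// sumr_ge0.
move=> i; rewrite !mxE mulr1 subr_ge0 (bigD1 i)//= -addrA.
by rewrite ler_wpDr ?ler_norm// addr_ge0// sumr_ge0.
Qed.

Lemma linfty_archimedean v :
  (forall eps : R, 0 < eps -> linfty_pos (eps *: linfty_unit + v)) ->
  linfty_pos v.
Proof.
move=> h i; apply/ler_addgt0Pr => eps eps0.
by have := h eps eps0 i; rewrite !mxE mulr1 addrC.
Qed.

HB.instance Definition _ := isFunctionSystem.Build R T
  linfty_posD linfty_posZ linfty_posN linfty_order_unit linfty_archimedean.

End Linfty.

HB.mixin Record isCompactHausdorff K & Topological K := {
  compact_setT : compact [set: K] ;
  hausdorff_setT : hausdorff_space K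
}.

#[short(type="compactHausdorffType")]
HB.structure Definition CompactHausdorff :=
  {K of isCompactHausdorff K & Topological K}.

Section ContinuousFunctions.
Variables (R : realType) (K : compactHausdorffType).

Definition continuous_functions : {pred (K -> R^o)} :=
  [pred f | `[< continuous (f : K -> R^o) >]].

Definition cfun : Type := {f : K -> R^o | f \in continuous_functions}.

Lemma continuous_functions_submod : submod_closed continuous_functions.
Proof.
split; first by apply/asboolP => x; exact: cvg_cst.
move=> a f g /asboolP cf /asboolP cg; apply/asboolP => x.
apply: (@cvgD _ R^o); last exact: cg.
by apply: (@cvgZ _ R^o); [exact: cvg_cst | exact: cf].
Qed.

HB.instance Definition _ :=
  GRing.isSubmodClosed.Build R (K -> R^o) continuous_functions
    continuous_functions_submod.
HB.instance Definition _ := [isSub for (@sval _ _ : cfun -> (K -> R^o))].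
HB.instance Definition _ := [Choice of cfun by <:].
HB.instance Definition _ := [SubChoice_isSubLmodule of cfun by <:].

Definition cfun_pos : set cfun := [set f : cfun | forall x, 0 <= val f x].

Lemma cst_continuous_functions : (cst 1 : K -> R^o) \in continuous_functions.
Proof. by apply/asboolP => x; exact: cvg_cst. Qed.

Definition cfun_unit : cfun := exist _ (cst 1) cst_continuous_functions.

Lemma cfun_posD f g : cfun_pos f -> cfun_pos g -> cfun_pos (f + g).
Proof. by move=> fp gp x; exact: addr_ge0. Qed.

Lemma cfun_posZ (a : R) f : 0 <= a -> cfun_pos f -> cfun_pos (a *: f).
Proof.
move=> a0 fp x; change (0 <= a * val f x).
by apply: mulr_ge0 => //; exact: fp.
Qed.

Lemma cfun_posN f : cfun_pos f /\ cfun_pos (- f) <-> f = 0.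
Proof.
split=> [[fp fn]|->]; last by rewrite oppr0; split=> x; exact: lexx.
apply/val_inj/funext => x; apply/eqP; rewrite eq_le; apply/andP; split.
  by rewrite -oppr_ge0; exact: fn.
exact: fp.
Qed.

Lemma cfun_order_unit f : exists2 r : R, 0 < r & cfun_pos (r *: cfun_unit - f).
Proof.
have /asboolP cf := valP f.
have [M [_ fM]] : bounded_set (val f @` [set: K]).
  apply: compact_bounded; apply: continuous_compact; last exact: compact_setT.
  exact: continuous_subspaceT.
exists (`|M| + 1); first by rewrite ltr_wpDl.
move=> x; change (0 <= (`|M| + 1) * 1 - val f x); rewrite mulr1 subr_ge0.
apply: le_trans (ler_norm _) _; apply: (fM _ _ (val f x)); last by exists x.
by apply: le_lt_trans (ler_norm _) _; rewrite ltrDl.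
Qed.

Lemma cfun_archimedean f :
  (forall eps : R, 0 < eps -> cfun_pos (eps *: cfun_unit + f)) -> cfun_pos f.
Proof.
move=> h x; apply/ler_addgt0Pr => eps eps0; have := h eps eps0 x.
by rewrite [X in 0 <= X]/(eps * 1 + val f x) mulr1 addrC.
Qed.

HB.instance Definition _ := isFunctionSystem.Build R cfun
  cfun_posD cfun_posZ cfun_posN cfun_order_unit cfun_archimedean.

End ContinuousFunctions.

(* The algebraic tensor product: formal sums of pairs modulo the congruence
   generated by commutativity of the sum and the bilinearity relations. *)
Inductive tensor_eq (R : realType) (V W : lmodType R) :
    seq (V * W) -> seq (V * W) -> Prop :=
| tensor_eq_refl s : tensor_eq s s
| tensor_eq_sym s t : tensor_eq s t -> tensor_eq t s
| tensor_eq_trans s t u : tensor_eq s t -> tensor_eq t u -> tensor_eq s u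
| tensor_eq_cat s s' t t' :
    tensor_eq s s' -> tensor_eq t t' -> tensor_eq (s ++ t) (s' ++ t')
| tensor_eq_catC s t : tensor_eq (s ++ t) (t ++ s)
| tensor_eq_Dl v v' w : tensor_eq [:: (v + v', w)] [:: (v, w); (v', w)]
| tensor_eq_Dr v w w' : tensor_eq [:: (v, w + w')] [:: (v, w); (v, w')]
| tensor_eq_Z (a : R) v w : tensor_eq [:: (a *: v, w)] [:: (v, a *: w)]
| tensor_eq_0 w : tensor_eq [:: (0, w)] [::].

Section Tensor.
Variables (R : realType) (V W : lmodType R).
Local Notation teq := (@tensor_eq R V W).

Definition tensor_rel : rel (seq (V * W)) := fun s t => `[< teq s t >].

Lemma tensor_rel_refl : reflexive tensor_rel.
Proof. by move=> s; apply/asboolP; exact: tensor_eq_refl. Qed.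

Lemma tensor_rel_sym : symmetric tensor_rel.
Proof.
by move=> s t; apply/asboolP/asboolP; exact: tensor_eq_sym.
Qed.

Lemma tensor_rel_trans : transitive tensor_rel.
Proof.
by move=> s t u /asboolP ts /asboolP su; apply/asboolP; exact: tensor_eq_trans su.
Qed.

Canonical tensor_equiv :=
  EquivRel tensor_rel tensor_rel_refl tensor_rel_sym tensor_rel_trans.

Definition tensor : Type := {eq_quot tensor_equiv}.
HB.instance Definition _ := EqQuotient.on tensor.
HB.instance Definition _ := Choice.on tensor.

Lemma tensor_piP s t : teq s t <-> \pi_tensor s = \pi_tensor t.
Proof.
split=> [st|/eqmodP/asboolP//].
by apply/eqmodP/asboolP.
Qed.

Lemma tensor_reprK s : teq (repr (\pi_tensor s)) s.
Proof. by apply/tensor_piP; rewrite reprK. Qed.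

Definition tscale (a : R) (s : seq (V * W)) := [seq (a *: p.1, p.2) | p <- s].

Lemma tensor_eq_scale a s t : teq s t -> teq (tscale a s) (tscale a t).
Proof.
elim=> {s t} /=.
- by move=> s; exact: tensor_eq_refl.
- by move=> s t _; exact: tensor_eq_sym.
- by move=> s t u _ st _; exact: tensor_eq_trans.
- by move=> s s' t t' _ ss _ tt; rewrite /tscale !map_cat; exact: tensor_eq_cat.
- by move=> s t; rewrite /tscale !map_cat; exact: tensor_eq_catC.
- by move=> v v' w; rewrite scalerDr; exact: tensor_eq_Dl.
- by move=> v w w'; exact: tensor_eq_Dr.
- by move=> b v w; rewrite scalerA mulrC -scalerA; exact: tensor_eq_Z.
- by move=> w; rewrite scaler0; exact: tensor_eq_0.
Qed.

Lemma tensor_eq_scaleD a b s : teq (tscale (a + b) s) (tscale a s ++ tscale b s).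
Proof.
elim: s => [|[v w] s IH] /=; first exact: tensor_eq_refl.
rewrite -cat1s -[_ :: (_ ++ _)]cat1s scalerDl.
apply: tensor_eq_trans (tensor_eq_cat (tensor_eq_Dl _ _ _) IH) _.
rewrite -[[:: _; _]]cat1s -catA; apply: tensor_eq_cat; first exact: tensor_eq_refl.
rewrite -[(_, w) :: tscale b s]cat1s !catA; apply: tensor_eq_cat.
  exact: tensor_eq_catC.
exact: tensor_eq_refl.
Qed.

Lemma tensor_eq_scale0 s : teq (tscale 0 s) [::].
Proof.
elim: s => [|[v w] s IH] /=; first exact: tensor_eq_refl.
rewrite scale0r -cat1s; exact: (tensor_eq_cat (tensor_eq_0 _ _) IH).
Qed.

Definition tensor0 : tensor := \pi_tensor [::].
Definition tensor_add (x y : tensor) : tensor := \pi_tensor (repr x ++ repr y).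
Definition tensor_scale (a : R) (x : tensor) : tensor := \pi_tensor (tscale a (repr x)).
Definition tensor_opp : tensor -> tensor := tensor_scale (-1).

Lemma tensor_addE s t :
  tensor_add (\pi_tensor s) (\pi_tensor t) = \pi_tensor (s ++ t).
Proof. by apply/tensor_piP/tensor_eq_cat; exact: tensor_reprK. Qed.

Lemma tensor_scaleE a s : tensor_scale a (\pi_tensor s) = \pi_tensor (tscale a s).
Proof. by apply/tensor_piP/tensor_eq_scale; exact: tensor_reprK. Qed.

Lemma tensor_addA : associative tensor_add.
Proof.
elim/quotW=> s; elim/quotW=> t; elim/quotW=> u.
by rewrite (tensor_addE t u) (tensor_addE s) (tensor_addE s t) tensor_addE catA.
Qed.

Lemma tensor_addC : commutative tensor_add.
Proof.
elim/quotW=> s; elim/quotW=> t.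
rewrite (tensor_addE s t) (tensor_addE t s); apply/tensor_piP.
exact: tensor_eq_catC.
Qed.

Lemma tensor_add0 : left_id tensor0 tensor_add.
Proof. by elim/quotW=> s; rewrite tensor_addE. Qed.

Lemma tensor_scale1 : left_id 1 tensor_scale.
Proof.
elim/quotW=> s; rewrite tensor_scaleE; congr (\pi_tensor _).
by rewrite /tscale -[RHS]map_id; apply: eq_map => -[v w] /=; rewrite scale1r.
Qed.

Lemma tensor_scaleDl x :
  {morph tensor_scale^~ x : a b / a + b >-> tensor_add a b}.
Proof.
elim/quotW: x => s a b; rewrite !(tensor_scaleE _ s) tensor_addE; apply/tensor_piP.
exact: tensor_eq_scaleD.
Qed.

Lemma tensor_addN : left_inverse tensor0 tensor_opp tensor_add.
Proof.
move=> x; rewrite -{2}(tensor_scale1 x) /tensor_opp -tensor_scaleDl addNr.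
elim/quotW: x => s; rewrite tensor_scaleE; apply/tensor_piP.
exact: tensor_eq_scale0.
Qed.

HB.instance Definition _ := GRing.isZmodule.Build tensor
  tensor_addA tensor_addC tensor_add0 tensor_addN.

Lemma tensor_scaleA a b x :
  tensor_scale a (tensor_scale b x) = tensor_scale (a * b) x.
Proof.
elim/quotW: x => s; rewrite (tensor_scaleE b) !tensor_scaleE; congr (\pi_tensor _).
by rewrite /tscale -map_comp; apply: eq_map => p /=; rewrite scalerA.
Qed.

Lemma tensor_scaleDr : right_distributive tensor_scale +%R.
Proof.
move=> a; elim/quotW=> s; elim/quotW=> t.
change (tensor_scale a (tensor_add (\pi s) (\pi t)) =
  tensor_add (tensor_scale a (\pi s)) (tensor_scale a (\pi t))).
rewrite (tensor_addE s t) tensor_scaleE (tensor_scaleE a s) (tensor_scaleE a t).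
by rewrite tensor_addE /tscale map_cat.
Qed.

HB.instance Definition _ := GRing.Zmodule_isLmodule.Build R tensor
  tensor_scaleA tensor_scale1 tensor_scaleDr tensor_scaleDl.

Definition tens (v : V) (w : W) : tensor := \pi_tensor [:: (v, w)].

Definition bilinear_map (U : lmodType R) (B : V -> W -> U) :=
  (forall w, linear (B^~ w)) /\ (forall v, linear (B v)).

(* For B bilinear the value does not depend on the representative, see
   tens_lift_pi. *)
Definition tens_lift (U : lmodType R) (B : V -> W -> U) (z : tensor) : U :=
  \sum_(p <- repr z) B p.1 p.2.

Lemma tensor_eq_lift (U : lmodType R) (B : V -> W -> U) s t :
  bilinear_map B -> teq s t ->
  \sum_(p <- s) B p.1 p.2 = \sum_(p <- t) B p.1 p.2.
Proof.
move=> [Bl Br]; elim=> {s t} //=.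
- by move=> s t u _ -> _ ->.
- by move=> s s' t t' _ ss _ tt; rewrite !big_cat /= ss tt.
- by move=> s t; rewrite !big_cat /= addrC.
- move=> v v' w; rewrite !(big_cons, big_nil) /= !addr0.
  by have := Bl w 1 v v'; rewrite !scale1r.
- move=> v w w'; rewrite !(big_cons, big_nil) /= !addr0.
  by have := Br v 1 w w'; rewrite !scale1r.
- move=> a v w; rewrite !(big_cons, big_nil) /= !addr0.
  have Bl0 : B 0 w = 0.
    by have := Bl w (-1) 0 0; rewrite /= scaler0 addr0 scaleN1r addNr.
  have Br0 : B v 0 = 0.
    by have := Br v (-1) 0 0; rewrite /= scaler0 addr0 scaleN1r addNr.
  have := Bl w a v 0; have := Br v a w 0.
  by rewrite /= Bl0 Br0 !addr0 => -> ->.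
- move=> w; rewrite !(big_cons, big_nil) /= addr0.
  by have := Bl w (-1) 0 0; rewrite /= scaler0 addr0 scaleN1r addNr.
Qed.

Lemma tens_lift_pi (U : lmodType R) (B : V -> W -> U) s : bilinear_map B ->
  tens_lift B (\pi_tensor s) = \sum_(p <- s) B p.1 p.2.
Proof. by move=> BB; apply: tensor_eq_lift => //; exact: tensor_reprK. Qed.

Lemma tens_lift_tens (U : lmodType R) (B : V -> W -> U) v w : bilinear_map B ->
  tens_lift B (tens v w) = B v w.
Proof. by move=> BB; rewrite tens_lift_pi// big_seq1. Qed.

Lemma tens_lift_linear (U : lmodType R) (B : V -> W -> U) : bilinear_map B ->
  linear (tens_lift B).
Proof.
move=> BB a; elim/quotW=> s; elim/quotW=> t.
rewrite [a *: _]tensor_scaleE [_ + _ in LHS]tensor_addE !tens_lift_pi//.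
rewrite big_cat big_map /= scaler_sumr; congr (_ + _).
apply: eq_bigr => p _; have := BB.1 p.2 a p.1 0.
have -> : B 0 p.2 = 0.
  by have := BB.1 p.2 (-1) 0 0; rewrite /= scaler0 addr0 scaleN1r addNr.
by rewrite /= !addr0.
Qed.

Lemma tens_bilinear : bilinear_map tens.
Proof.
have E a v w : a *: tens v w = \pi_tensor [:: (a *: v, w)] := tensor_scaleE a _.
have D s t : \pi_tensor s + \pi_tensor t = \pi_tensor (s ++ t) := tensor_addE s t.
split=> [w a v v'|v a w w'] /=; rewrite E D; apply/tensor_piP.
  exact: (tensor_eq_Dl (a *: v)).
apply: tensor_eq_trans (tensor_eq_Dr _ _ _) _.
rewrite -[[:: (v, _); _]]cat1s; apply: tensor_eq_cat; last exact: tensor_eq_refl.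
exact/tensor_eq_sym/tensor_eq_Z.
Qed.

End Tensor.

Notation "v ⊗ w" := (tens v w) (at level 40, left associativity) : ring_scope.

Section TensorMap.
Variables (R : realType) (V V' W W' : lmodType R).
Variables (f : {linear V -> V'}) (g : {linear W -> W'}).

Definition tens_map : tensor V W -> tensor V' W' :=
  tens_lift (fun v w => f v ⊗ g w).

Lemma tens_map_bilinear : bilinear_map (fun v w => f v ⊗ g w).
Proof.
split=> [w a v v'|v a w w'].
  by rewrite linearP; exact: (tens_bilinear V' W').1.
by rewrite linearP; exact: (tens_bilinear V' W').2.
Qed.

HB.instance Definition _ := GRing.isLinear.Build R (tensor V W) (tensor V' W') _
  tens_map (tens_lift_linear tens_map_bilinear).

End TensorMap.

Section TensorCones.
Variables (R : realType) (V W : funSysType R).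

Definition alg_cone : set (tensor V W) :=
  [set z | exists s : seq (V * W),
    (forall p, p \in s -> fs_pos V p.1 /\ fs_pos W p.2) /\
    z = \sum_(p <- s) p.1 ⊗ p.2].

Definition min_cone : set (tensor V W) :=
  [set z | forall (f : V -> R^o) (g : W -> R^o), is_state f -> is_state g ->
    0 <= tens_lift (fun v w => f v * g w : R^o) z].

Definition max_cone : set (tensor V W) :=
  [set z | forall eps : R, 0 < eps ->
    alg_cone (z + eps *: (fs_unit V ⊗ fs_unit W))].

End TensorCones.

Arguments min_cone {R} V W.
Arguments max_cone {R} V W.

Record directedSet := DirectedSet {
  ds_carrier :> Type ;
  ds_le : ds_carrier -> ds_carrier -> Prop ;
  ds_refl : forall a, ds_le a a ;
  ds_trans : forall a b c, ds_le a b -> ds_le b c -> ds_le a c ;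
  ds_inhabited : inhabited ds_carrier ;
  ds_directed : forall a b, exists c, ds_le a c /\ ds_le b c
}.

(* Convergence of a net x : L -> T is convergence of x along this filter. *)
Definition net_filter (L : directedSet) : set_system L :=
  [set A | exists l0, forall l, ds_le l0 l -> A l].
Arguments net_filter : clear implicits.

(* V** with the weak* topology: the topology induced by evaluation at the
   elements of V*. *)
Definition weak_star (R : realType) (V : funSysType R) : Type :=
  initial_topology (fun (F : bidual V) => (F : fs_dual V -> R^o) : {ptws fs_dual V -> R^o}).
HB.instance Definition _ (R : realType) (V : funSysType R) :=
  Topological.on (weak_star V).

(* R^V with the topology of pointwise convergence, in which S(V) with the weak*
   topology is a compact convex subset. *)
Definition functions_on (R : realType) (V : lmodType R) : Type := V -> R^o.
HB.instance Definition _ (R : realType) (V : lmodType R) :=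
  GRing.Lmodule.copy (functions_on V) (V -> R^o).
HB.instance Definition _ (R : realType) (V : lmodType R) :=
  Topological.copy (functions_on V) {ptws V -> R^o}.

Definition state_space (R : realType) (V : funSysType R) : set (functions_on V) :=
  [set f | is_state f].
Arguments state_space {R} V.

(* Meant for a compact convex K in a Hausdorff locally convex space E. *)
Section ChoquetSimplex.
Local Open Scope ereal_scope.
Variables (R : realType) (E : preTopologicalLmodType R) (K : set E).

(* measurableType requires a point; 0 is one. *)
Definition pointed_at0 : Type := E.
HB.instance Definition _ := Choice.on pointed_at0.
HB.instance Definition _ := isPointed.Build pointed_at0 (0 : E)%R.

Definition borel : Type := @g_sigma_algebraType pointed_at0 (@open E).
HB.instance Definition _ := Measurable.on borel.

(* Normalized Radon (inner regular Borel) measures on the compact set K, as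
   measures on the Borel sets of E carried by K. *)
Definition radon_probability (mu : probability borel R) :=
  mu K = 1 /\
  forall A : set borel, measurable A ->
    mu A = ereal_sup [set mu C | C in [set C : set E | compact C /\ C `<=` A]].

Definition affine_on (f : E -> R^o) :=
  forall (t : R) x y, (0 <= t <= 1)%R -> K x -> K y ->
    f (t *: x + (1 - t) *: y)%R = (t *: f x + (1 - t) *: f y)%R.

Definition represents (mu : probability borel R) (x : E) :=
  forall f : E -> R^o, {within K, continuous f} -> affine_on f ->
    \int[mu]_(y in K) (f y)%:E = (f x)%:E.

Definition choquet_le (mu nu : probability borel R) :=
  forall f : E -> R^o, {within K, continuous f} -> convex_function K f ->
    \int[mu]_(y in K) (f y)%:E <= \int[nu]_(y in K) (f y)%:E.

Definition same_measure (mu nu : probability borel R) :=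
  forall A : set borel, measurable A -> mu A = nu A.

(* Maximal in the Choquet order. *)
Definition boundary_measure (mu : probability borel R) :=
  radon_probability mu /\
  forall nu, radon_probability nu -> choquet_le mu nu -> same_measure nu mu.

Definition choquet_simplex :=
  forall x, K x -> exists mu,
    [/\ boundary_measure mu, represents mu x &
        forall nu, boundary_measure nu -> represents nu x -> same_measure nu mu].

End ChoquetSimplex.

Definition nuclear (R : realType) (V : funSysType R) :=
  forall W : funSysType R, min_cone V W = max_cone V W.

(* Main.v *)
(** The conditions are linked through two properties of V. The first is
    approximability: the identity is a limit of maps v |-> sum_i f_i(v) v_i, where the
    f_i are states and the v_i are positive with sum the unit. In norm this is (iii), and
    it gives min = max at once; by a minimax argument it follows from its weak version,
    where the v_i lie in V**. The second is the Riesz decomposition property of V*, in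
    the form of the inequality [riesz_ineq]. Testing (ii) or (ix) on the affine functions
    on a square, seen inside R^4, gives [riesz_ineq]; under it, an extension of a map
    into V** exists by Kantorovich's argument, so V** is injective. An injective V** is
    the range of a projection from C(K), which is approximable by partitions of unity,
    and this closes the circle of (i)-(ix). For (iv), states on V** are approximated by
    states of V.

    For (x), let L be the lattice of functions on S(V) generated by V. By the Riesz
    representation theorem the states of L are the Radon probability measures on S(V),
    and the Choquet order is comparison on maxima of finite families in V. If V** is
    injective, the inclusion of V extends to a positive map from L to V**, whose value
    at a state x of V is the greatest state of L extending x; hence S(V) is a simplex.
    Conversely, if x = x1 + x2 = y1 + y2, both splittings extend to states of L, which
    lie below the unique maximal extension of x, and this is [riesz_ineq]. *)
Require Import Defs.
From HB Require Import structures.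
From mathcomp Require Import all_boot all_order all_algebra.
From mathcomp Require Import all_classical all_reals all_analysis.
From mathcomp Require Import generic_quotient measurable_realfun ring lra.
Set Implicit Arguments.
Unset Strict Implicit.
Unset Printing Implicit Defensive.
Import Order.TTheory GRing.Theory Num.Theory.
Import numFieldNormedType.Exports.
Local Open Scope classical_set_scope.
Local Open Scope ring_scope.

(** * The Mazur-Orlicz theorem and extension of states *)

(** The obstacle is that neither V* nor V** is known to be a lattice, while Kantorovich's extension
    takes infima in V**. The Riesz property is therefore kept as an inequality: it can be read off
    from one positive bilinear form at one tensor, or from one state of the lattice L at two
    elements, and separation recovers the decomposition from it. Infima in V** are prescribed by
    their values on positive functionals: the pointwise infimum for a directed family, an infimum
    over splittings of the functional for the family of majorants.

    An injective V** gives partitions of the unit with elements in V** rather than in V. To return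
    to V in norm, the states of such a partition are kept and its elements made variable in V; if
    every choice fails, duality gives one functional that rules out the original partition as well.

    Separation arguments are instances of [mazur_orlicz], with a cone S of constraints [a <= g x]
    compatible with a sublinear bound. Since S(V) need not be metrizable, maximal measures are
    handled through the Choquet order alone, on the compact state space of L. *)

Definition mk_linear (R : realType) (U W : lmodType R) (f : U -> W) (lf : linear f) :
    {linear U -> W} :=
  HB.pack_for {linear U -> W} f (GRing.isLinear.Build R U W _ f lf).

Section Families.
Variables (R : realType) (I : finType) (V : lmodType R).

Definition single (i : I) (v : V) : I -> V := fun j => if j == i then v else 0.

Lemma single_linear i : linear (single i).
Proof.
move=> c v w; apply/funext => j; rewrite /single !fctE.
by case: eqP => // _; rewrite scaler0 addr0.
Qed.

Lemma single_sum (h : I -> V) : h = \sum_i single i (h i).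
Proof.
apply/funext => j; rewrite fct_sumE (bigD1 j)//= /single eqxx big1 ?addr0// => i.
by rewrite eq_sym => /negbTE ->.
Qed.

Lemma family_functional (g : {linear (I -> V) -> R^o}) :
  exists2 z : I -> {linear V -> R^o}, forall i v, z i v = g (single i v) &
    forall h, g h = \sum_i z i (h i).
Proof.
have zl i : linear (fun v => g (single i v) : R^o).
  by move=> c v w; rewrite single_linear linearP.
by exists (fun i => mk_linear (zl i)) => // h; rewrite [in LHS](single_sum h) linear_sum.
Qed.

End Families.

Lemma coordinate_functional (R : realType) (I : finType) (g : {linear (I -> R^o) -> R^o}) :
  exists2 l : I -> R, forall i, l i = g (single i 1) & forall h, g h = \sum_i h i * l i.
Proof.
have [z zE gz] := family_functional g; exists (fun i => z i 1) => // h.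
rewrite gz; apply: eq_bigr => i _.
by rewrite -[in RHS]scaleoE -linearZ scaleoE mulr1.
Qed.

Section Sublinear.
Variables (R : realType) (X : lmodType R).

(** [S] is a convex cone of constraints [a <= g x]. Its infimal convolution with [p],
    [r v = inf (p (v + x) - a)], is again sublinear, and any linear [g <= r] works: the trivial
    constraint gives [g <= p], and [r (- x) <= - a] gives the constraint at [x]. A relation may hold
    both [(x, a)] and [(- x, - a)], which prescribes an exact value. *)
Lemma mazur_orlicz (p : X -> R) (S : X -> R -> Prop) : sublinear p ->
  S 0 0 ->
  (forall x y a b, S x a -> S y b -> S (x + y) (a + b)) ->
  (forall c x a, 0 < c -> S x a -> S (c *: x) (c * a)) ->
  (forall x a, S x a -> a <= p x) ->
  exists2 g : {linear X -> R^o}, (forall v, g v <= p v) &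
    forall x a, S x a -> a <= g x.
Proof.
move=> sp S0 SD SZ Sp.
pose A v := [set t | exists x a, S x a /\ t = p (v + x) - a].
pose r v := inf (A v).
have rlb v x a : S x a -> r v <= p (v + x) - a.
  move=> Sx; apply: ge_inf; last by exists x, a.
  exists (- p (- v)) => _ [y [b [Sy ->]]].
  have := sp.1 (- v) (v + y); rewrite addKr; have := Sp _ _ Sy; lra.
have rge v b : (forall x a, S x a -> b <= p (v + x) - a) -> b <= r v.
  move=> h; apply: lb_le_inf => [|_ [x [a [Sx ->]]]]; last exact: h.
  by exists (p (v + 0) - 0), 0, 0.
have sr : sublinear r.
  split=> [v w|c v c0].
    rewrite -lerBlDr; apply: (rge) => x a Sx.
    rewrite lerBlDr -lerBlDl; apply: (rge) => y b Sy; rewrite lerBlDl.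
    have := rlb (v + w) _ _ (SD _ _ _ _ Sx Sy).
    have := sp.1 (v + x) (w + y); rewrite addrACA; lra.
  rewrite -ler_pdivrMl//; apply: (rge) => x a Sx; rewrite ler_pdivrMl//.
  have := rlb (c *: v) _ _ (SZ _ _ _ c0 Sx).
  by rewrite -scalerDr (sublinearZ _ sp (ltW c0)) mulrBr.
have [g lg gr] := sublinear_linear sr.
pose gl := mk_linear lg.
exists gl => [v|x a Sx].
  by apply: le_trans (gr v) _; have := rlb v _ _ S0; rewrite addr0 subr0.
have /= := gr (- x); have := rlb (- x) _ _ Sx; rewrite addNr (sublinear0 sp).
have -> : g (- x) = - g x by exact: (linearN gl).
rewrite /=; lra.
Qed.

End Sublinear.

Section OrderNorm.
Variables (R : realType) (V : funSysType R).
Implicit Types (v w : V) (a r : R).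
Local Notation pos := (fs_pos V).
Local Notation e := (fs_unit V).

Lemma fs_pos_sum (I : eqType) (s : seq I) (F : I -> V) :
  (forall i, i \in s -> pos (F i)) -> pos (\sum_(i <- s) F i).
Proof.
move=> h; rewrite big_seq; apply: big_ind => //; first exact: fs_pos0.
by move=> x y; exact: fs_posD.
Qed.

Lemma fs_pos_unit_mono a r v : a <= r -> pos (a *: e + v) -> pos (r *: e + v).
Proof.
move=> ar h; rewrite -(subrK a r) scalerDl -addrA.
by apply: fs_posD => //; apply: fs_pos_unitZ; rewrite subr_ge0.
Qed.

Lemma ornorm_lt v r : ornorm v < r -> pos (r *: e + v) /\ pos (r *: e - v).
Proof.
move=> /inf_lt[|s [s0 [sp sn]] /ltW sr].
  by have [t t0 h] := fs_abs_unit v; exists t.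
by split; apply: fs_pos_unit_mono sr _.
Qed.

Lemma ornorm_sublinear : sublinear (@ornorm R V).
Proof.
split=> [v w|c v c0].
  rewrite -lerBlDr; apply: ornorm_ge => r r0 rp rn.
  rewrite lerBlDr -lerBlDl; apply: ornorm_ge => s s0 sp sn; rewrite lerBlDl.
  apply: ornorm_le; first exact: addr_gt0.
    by rewrite scalerDl addrACA; apply: fs_posD.
  by rewrite scalerDl opprD addrACA; apply: fs_posD.
rewrite -ler_pdivrMl//; apply: ornorm_ge => r r0 rp rn; rewrite ler_pdivrMl//.
apply: ornorm_le; first exact: mulr_gt0.
  by rewrite -scalerA -scalerDr; apply: fs_posZ => //; exact: ltW.
by rewrite -scalerA -scalerBr; apply: fs_posZ => //; exact: ltW.
Qed.

Lemma ornormN v : ornorm (- v) = ornorm v.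
Proof.
rewrite /ornorm; congr inf; apply/seteqP.
by split=> r /= [r0 [rp rn]]; rewrite opprK in rn *.
Qed.

Lemma ornorm_unit : ornorm e <= 1.
Proof.
apply: ornorm_le => //; rewrite scale1r ?subrr; last exact: fs_pos0.
by apply: fs_posD; exact: fs_pos_unit.
Qed.

Lemma dominated_bounded (M : R) (g : {linear V -> R^o}) :
  (forall v, g v <= M * ornorm v) -> is_bounded_functional (@ornorm R V) g.
Proof.
move=> gM; split; first exact: linearP.
exists M => v; rewrite ler_norml gM andbT lerNl -ornormN.
by rewrite -linearN gM.
Qed.

(** If [0 <= v <= r e], then [r e - v] has norm at most [r], so [r - g v <= r]. *)
Lemma norm1_state (g : {linear V -> R^o}) :
  (forall v, g v <= ornorm v) -> 1 <= g e -> is_state g.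
Proof.
move=> gN g1; have ge : g e = 1.
  by apply/eqP; rewrite eq_le g1 andbT; apply: le_trans (gN _) ornorm_unit.
split=> [||//]; first exact: linearP.
move=> v vp; have [r r0 rv] := fs_order_unit v.
have : g (r *: e - v) <= r.
  apply: le_trans (gN _) _; apply: ornorm_le => //; last first.
    by rewrite opprB addrCA subrr addr0.
  by apply: fs_posD => //; exact/fs_pos_unitZ/ltW.
by rewrite linearB linearZ /= ge scaleoE mulr1; lra.
Qed.

Lemma states_positive v : (forall f, @is_state R V f -> 0 <= f v) -> pos v.
Proof.
move=> h; apply: contrapT => npv.
have [eps eps0 neps] : exists2 eps : R, 0 < eps & ~ pos (eps *: e + v).
  apply: contrapT => H; apply: npv; apply: fs_archimedean => eps eps0.
  by apply: contrapT => H'; apply: H; exists eps.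
have e0 : e <> 0 by move=> e0; apply: npv; rewrite (unit0_trivial e0 v); exact: fs_pos0.
have neps' (d : R) : pos (d *: e + v) -> eps <= d.
  by move=> H; rewrite leNgt; apply/negP => /ltW de; apply: neps; apply: fs_pos_unit_mono H.
have unit_le (t : R) : pos (t *: e) -> 0 <= t.
  move=> tp; rewrite leNgt; apply/negP => t0; apply: e0; apply/fs_posN.
  split; first exact: fs_pos_unit.
  have /fs_posZ/(_ tp) : 0 <= - t^-1 by rewrite oppr_ge0 invr_le0 ltW.
  by rewrite scalerA mulNr mulVf ?lt_eqF// scaleN1r.
(* The cone spanned by the constraints [1 <= g e] and [eps <= g (- v)]. It is compatible with the
   norm because [(r - t) e + s v >= 0] forces [s eps <= r - t], by the choice of [eps]. *)
pose S (x : V) (a : R) := exists t s : R,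
  [/\ 0 <= t, 0 <= s, x = t *: e - s *: v & a = t + s * eps].
have [||||g gN gS] := @mazur_orlicz R V (@ornorm R V) S ornorm_sublinear.
- by exists 0, 0; rewrite !scale0r subrr mul0r addr0.
- move=> _ _ _ _ [t [s [t0 s0 -> ->]]] [t' [s' [t'0 s'0 -> ->]]].
  exists (t + t'), (s + s'); split; rewrite ?addr_ge0//.
    by rewrite !scalerDl opprD addrACA.
  by rewrite mulrDl addrACA.
- move=> c _ _ c0 [t [s [t0 s0 -> ->]]]; exists (c * t), (c * s).
  by split; rewrite ?mulr_ge0 ?(ltW c0)// ?scalerBr ?scalerA// mulrDr mulrA.
- move=> _ _ [t [s [t0 s0 -> ->]]]; apply: ornorm_ge => r r0 _.
  rewrite opprB addrCA -scalerBl addrC => rp.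
  move: s0; rewrite le_eqVlt => /orP[/eqP s0|s0].
    move: rp; rewrite -s0 scale0r addr0 mul0r addr0 => /unit_le; lra.
  have : pos (s^-1 *: ((r - t) *: e + s *: v)).
    by apply: fs_posZ; rewrite ?invr_ge0 ?(ltW s0)// .
  rewrite scalerDr !scalerA mulVf ?gt_eqF// scale1r => /neps'.
  by rewrite ler_pdivlMl// => ?; lra.
have /h : is_state g.
  apply: norm1_state => //; apply: gS; exists 1, 0.
  by rewrite scale1r scale0r subr0 mul0r addr0.
have : eps <= g (- v).
  by apply: gS; exists 0, 1; rewrite scale1r scale0r sub0r mul1r add0r.
by rewrite linearN /=; lra.
Qed.

End OrderNorm.

(** The graph of [f] is a subspace, so Mazur-Orlicz makes [g] agree with [f] on it; norm at most one
    and value one at the unit then give positivity. *)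
Lemma state_extension (R : realType) (W1 W2 : funSysType R)
    (i : {linear W1 -> W2}) (f : W1 -> R^o) : fs_inclusion i -> is_state f ->
  exists2 g : {linear W2 -> R^o}, is_state g & forall w, g (i w) = f w.
Proof.
move=> [iu ip] [lf fp f1].
pose fl := mk_linear lf.
have fB (r : R) w : f (r *: fs_unit W1 - w) = r - f w.
  by rewrite -[f]/(fl : _ -> _) linearB linearZ /= f1 scaleoE mulr1.
pose S (x : W2) (a : R) := exists w, x = i w /\ a = f w.
have [||||g gN gS] := @mazur_orlicz R W2 (@ornorm R W2) S (@ornorm_sublinear R W2).
- by exists 0; rewrite linear0 -[f]/(fl : _ -> _) linear0.
- move=> _ _ _ _ [w [-> ->]] [w' [-> ->]]; exists (w + w').
  by rewrite linearD -[f]/(fl : _ -> _) linearD.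
- move=> c _ _ _ [w [-> ->]]; exists (c *: w).
  by rewrite linearZ -[f]/(fl : _ -> _) linearZ.
- move=> _ _ [w [-> ->]]; apply: ornorm_ge => r r0 _.
  by rewrite -iu -linearZ -linearB -ip => /fp; rewrite fB subr_ge0.
exists g => [|w].
  by apply: norm1_state => //; apply: gS; exists (fs_unit W1); rewrite iu f1.
apply/eqP; rewrite eq_le; apply/andP; split; last by apply: gS; exists w.
have := gS (- i w) (- f w); rewrite linearN lerN2; apply.
by exists (- w); rewrite linearN -[f]/(fl : _ -> _) linearN.
Qed.

(** * Tensor products and approximation of the identity *)

Section TensorTheory.
Variables (R : realType) (V W : lmodType R).

Lemma tensDl (v v' : V) (w : W) : (v + v') ⊗ w = v ⊗ w + v' ⊗ w.
Proof. by have := (tens_bilinear V W).1 w 1 v v'; rewrite !scale1r. Qed.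

Lemma tensDr (v : V) (w w' : W) : v ⊗ (w + w') = v ⊗ w + v ⊗ w'.
Proof. by have := (tens_bilinear V W).2 v 1 w w'; rewrite !scale1r. Qed.

Lemma tens0l (w : W) : (0 : V) ⊗ w = 0.
Proof. by apply: (addrI (0 ⊗ w)); rewrite -tensDl !addr0. Qed.

Lemma tens0r (v : V) : v ⊗ (0 : W) = 0.
Proof. by apply: (addrI (v ⊗ 0)); rewrite -tensDr !addr0. Qed.

Lemma tensZl (a : R) (v : V) (w : W) : (a *: v) ⊗ w = a *: (v ⊗ w).
Proof. by have := (tens_bilinear V W).1 w a v 0; rewrite /= addr0 tens0l addr0. Qed.

Lemma tensZr (a : R) (v : V) (w : W) : v ⊗ (a *: w) = a *: (v ⊗ w).
Proof. by have := (tens_bilinear V W).2 v a w 0; rewrite /= addr0 tens0r addr0. Qed.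

Lemma tensNl (v : V) (w : W) : (- v) ⊗ w = - (v ⊗ w).
Proof. by rewrite -scaleN1r tensZl scaleN1r. Qed.

Lemma tensNr (v : V) (w : W) : v ⊗ (- w) = - (v ⊗ w).
Proof. by rewrite -scaleN1r tensZr scaleN1r. Qed.

Lemma tens_suml (I : Type) (s : seq I) (F : I -> V) (w : W) :
  (\sum_(i <- s) F i) ⊗ w = \sum_(i <- s) F i ⊗ w.
Proof. by apply: (big_morph (fun v => v ⊗ w)) => [x y|]; rewrite ?tensDl ?tens0l. Qed.

Lemma tens_sumr (I : Type) (s : seq I) (v : V) (F : I -> W) :
  v ⊗ (\sum_(i <- s) F i) = \sum_(i <- s) v ⊗ F i.
Proof. by apply: (big_morph (fun w => v ⊗ w)) => [x y|]; rewrite ?tensDr ?tens0r. Qed.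

Lemma tensor_sum (z : tensor V W) : exists s : seq (V * W), z = \sum_(p <- s) p.1 ⊗ p.2.
Proof.
elim/quotW: z => s; exists s; elim: s => [|p s IH]; first by rewrite big_nil.
rewrite big_cons -IH; case: p => v w.
by have := tensor_addE [:: (v, w)] s; move=> <-.
Qed.

Lemma tens_lift_sum (U : lmodType R) (B : V -> W -> U) (I : Type) (s : seq I)
    (F : I -> V) (G : I -> W) : bilinear_map B ->
  tens_lift B (\sum_(i <- s) F i ⊗ G i) = \sum_(i <- s) B (F i) (G i).
Proof.
move=> BB; pose l := mk_linear (tens_lift_linear BB).
rewrite -[tens_lift B]/(l : _ -> _) linear_sum /=; apply: eq_bigr => i _.
exact: tens_lift_tens.
Qed.

Lemma tens_liftD (U : lmodType R) (B : V -> W -> U) : bilinear_map B ->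
  {morph tens_lift B : x y / x + y}.
Proof.
by move=> BB x y; have := tens_lift_linear BB 1 x y; rewrite !scale1r.
Qed.

Lemma tens_liftZ (U : lmodType R) (B : V -> W -> U) a x : bilinear_map B ->
  tens_lift B (a *: x) = a *: tens_lift B x.
Proof.
move=> BB; pose l := mk_linear (tens_lift_linear BB).
by rewrite -[tens_lift B]/(l : _ -> _) linearZ.
Qed.

End TensorTheory.

Lemma tens_map_tens (R : realType) (V V' W W' : lmodType R)
    (f : {linear V -> V'}) (g : {linear W -> W'}) v w :
  tens_map f g (v ⊗ w) = f v ⊗ g w.
Proof. by rewrite [LHS]tens_lift_tens//; exact: tens_map_bilinear. Qed.

Section Cones.
Variables (R : realType) (V W : funSysType R).

Lemma alg_coneD (x y : tensor V W) : alg_cone x -> alg_cone y -> alg_cone (x + y).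
Proof.
move=> [s [sp ->]] [t [tp ->]]; exists (s ++ t); split; last by rewrite big_cat.
by move=> p; rewrite mem_cat => /orP[/sp|/tp].
Qed.

Lemma alg_cone0 : alg_cone (0 : tensor V W).
Proof. by exists [::]; rewrite big_nil. Qed.

Lemma alg_cone_sum (I : eqType) (s : seq I) (F : I -> tensor V W) :
  (forall i, i \in s -> alg_cone (F i)) -> alg_cone (\sum_(i <- s) F i).
Proof.
move=> h; rewrite big_seq; apply: big_ind => //; first exact: alg_cone0.
exact: alg_coneD.
Qed.

Lemma alg_cone_tens (v : V) (w : W) : fs_pos V v -> fs_pos W w -> alg_cone (v ⊗ w).
Proof.
move=> vp wp; exists [:: (v, w)]; split; last by rewrite big_seq1.
by move=> p; rewrite inE => /eqP ->.
Qed.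

(** Half the sum of [(k e + v) ⊗ (l d + w)] and [(k e - v) ⊗ (l d - w)]: the mixed terms cancel. It
    absorbs a norm error in one tensor factor into a small multiple of the unit tensor. *)
Lemma alg_cone_small (k l : R) (v : V) (w : W) :
  fs_pos V (k *: fs_unit V + v) -> fs_pos V (k *: fs_unit V - v) ->
  fs_pos W (l *: fs_unit W + w) -> fs_pos W (l *: fs_unit W - w) ->
  alg_cone (v ⊗ w + (k * l) *: (fs_unit V ⊗ fs_unit W)).
Proof.
set e := fs_unit V; set d := fs_unit W => vp vn wp wn.
have -> : v ⊗ w + (k * l) *: (e ⊗ d) =
    (2^-1 *: (k *: e + v)) ⊗ (l *: d + w) + (2^-1 *: (k *: e - v)) ⊗ (l *: d - w).
  rewrite !tensZl -scalerDr !tensDl !tensDr !tensNl !tensNr opprK !tensZl !tensZr.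
  set a := e ⊗ d; set b := e ⊗ w; set c := v ⊗ d; set f := v ⊗ w.
  have -> : k *: (l *: a) + k *: b + (l *: c + f) + (k *: (l *: a) - k *: b + (- (l *: c) + f)) =
     (k *: (l *: a) + f) + (k *: (l *: a) + f).
    rewrite addrACA [X in X + _]addrACA [X in _ + X]addrACA !subrr addr0 add0r.
    by rewrite addrACA.
  rewrite scalerA addrC; set y := (_ + f).
  by rewrite -mulr2n -[y *+ 2]scaler_nat scalerA mulVf ?pnatr_eq0// scale1r.
by apply: alg_coneD; apply: alg_cone_tens => //; apply: fs_posZ => //; rewrite invr_ge0.
Qed.

Lemma alg_max (z : tensor V W) : alg_cone z -> max_cone V W z.
Proof.
move=> zp eps eps0; apply: alg_coneD => //; rewrite -tensZl; apply: alg_cone_tens.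
  exact/fs_pos_unitZ/ltW.
exact: fs_pos_unit.
Qed.

Lemma max_cone_ge0 (B : V -> W -> R^o) (z : tensor V W) : bilinear_map B ->
  (forall v w, fs_pos V v -> fs_pos W w -> 0 <= B v w) ->
  max_cone V W z -> 0 <= tens_lift B z.
Proof.
move=> BB Bp zp; have B0 : 0 <= B (fs_unit V) (fs_unit W) by apply: Bp; exact: fs_pos_unit.
set b := B _ _ in B0.
apply/ler_addgt0Pr => eps eps0.
(* [b] may be zero, hence the denominator [b + 1]; the same device recurs wherever a bound is only
   known to be nonnegative. *)
have b1 : 0 < b + 1 by rewrite ltr_wpDl.
have [s [sp sE]] := zp (eps / (b + 1)) (divr_gt0 eps0 b1).
have : 0 <= tens_lift B (z + (eps / (b + 1)) *: (fs_unit V ⊗ fs_unit W)).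
  rewrite sE tens_lift_sum// big_seq sumr_ge0// => p /sp[p1 p2]; exact: Bp.
rewrite tens_liftD// tens_liftZ// tens_lift_tens// => /le_trans; apply.
rewrite lerD2l scaleoE -/b mulrAC ler_pdivrMr// ler_wpM2l ?(ltW eps0)//.
by rewrite lerDl.
Qed.

Lemma state_bilinear (f : V -> R^o) (g : W -> R^o) : is_state f -> is_state g ->
  bilinear_map (fun v w => f v * g w : R^o).
Proof.
move=> [lf _ _] [lg _ _]; split=> [w a v v'|v a w w'] /=.
  by rewrite lf mulrDl -scalerAl.
by rewrite lg mulrDr -scalerAr.
Qed.

Lemma max_min (z : tensor V W) : max_cone V W z -> min_cone V W z.
Proof.
move=> zp f g fs gs; apply: max_cone_ge0 => //; first exact: state_bilinear.
by case: fs gs => _ fp _ [_ gp _] v w vp wp; apply: mulr_ge0; [exact: fp|exact: gp].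
Qed.

End Cones.

Section UnitPartition.
Variables (R : realType) (V Z : funSysType R).

(** The target [Z] is separate from [V] so that partitions with elements in V** are covered. *)
Definition unit_partition (s : seq ((V -> R^o) * Z)) :=
  (forall q, q \in s -> is_state q.1 /\ fs_pos Z q.2) /\
  \sum_(q <- s) q.2 = fs_unit Z.

(** For a unit partition, these are exactly the unital positive maps that factor through some
    [linfty], see [partition_of_maps] and [maps_of_partition]. *)
Definition frank (s : seq ((V -> R^o) * Z)) (v : V) : Z :=
  \sum_(q <- s) q.1 v *: q.2.

End UnitPartition.

Definition approx_id (R : realType) (V : funSysType R) :=
  forall (t : seq V) (eps : R), 0 < eps ->
  exists2 s : seq ((V -> R^o) * V), unit_partition s & forall v, v \in t ->
    fs_pos V (eps *: fs_unit V + (frank s v - v)) /\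
    fs_pos V (eps *: fs_unit V - (frank s v - v)).

(** Applying [frank s] to the first factor turns [z] into a sum of [q.2 ⊗ w_q], where [w_q] is the
    slice of [z] by the state [q.1]. Slices of a min-positive tensor are positive, since the states
    of [W] detect positivity; the error is absorbed by [alg_cone_small]. *)
Lemma approx_nuclear (R : realType) (V : funSysType R) : approx_id V -> nuclear V.
Proof.
move=> Vap W; apply/seteqP; split=> z; last exact: max_min.
have [t ->] := tensor_sum z => zmin eps eps0.
have /choice[l lP] : forall w : W, exists l : R, [/\ 0 < l,
    fs_pos W (l *: fs_unit W + w) & fs_pos W (l *: fs_unit W - w)].
  by move=> w; have [l l0 [lp ln]] := fs_abs_unit w; exists l.
pose L := \sum_(p <- t) l p.2.
have L0 : 0 <= L by rewrite /L sumr_ge0// => p _; have [/ltW] := lP p.2.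
have L1 : 0 < L + 1 by rewrite ltr_wpDl.
set eW := fs_unit W; set e := fs_unit V.
have [s [sp s1] st] := Vap [seq p.1 | p <- t] (eps / (L + 1)) (divr_gt0 eps0 L1).
pose d := eps / (L + 1).
have d0 : 0 < d by exact: divr_gt0.
(* The errors take the share [d * L <= eps] of the unit tensor; the rest of [eps] stays with the
   main part. *)
have -> : \sum_(p <- t) p.1 ⊗ p.2 + eps *: (e ⊗ eW) =
    \sum_(p <- t) ((p.1 - frank s p.1) ⊗ p.2 + (d * l p.2) *: (e ⊗ eW)) +
    (\sum_(p <- t) frank s p.1 ⊗ p.2 + (eps - d * L) *: (e ⊗ eW)).
  rewrite big_split /= -scaler_suml -mulr_sumr -/L addrACA -scalerDl addrC.
  rewrite [d * L + _]addrC subrK -big_split /= addrC; congr (_ + _).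
  by apply: eq_bigr => p _; rewrite -tensDl subrK.
apply: alg_coneD.
  apply: alg_cone_sum => p pt; have [_ lp ln] := lP p.2.
  have [fp fn] := st p.1 (map_f _ pt).
  apply: alg_cone_small => //; first by rewrite -opprB.
  by rewrite opprB.
apply: alg_coneD; last first.
  rewrite -tensZl; apply: alg_cone_tens; last exact: fs_pos_unit.
  apply: fs_pos_unitZ; rewrite subr_ge0 /d mulrAC ler_pdivrMr// ler_wpM2l ?(ltW eps0)//.
  by rewrite lerDl.
rewrite (eq_bigr (fun p => \sum_(q <- s) q.2 ⊗ (q.1 p.1 *: p.2))); last first.
  by move=> p _; rewrite tens_suml; apply: eq_bigr => q _; rewrite tensZl tensZr.
rewrite exchange_big /=; apply: alg_cone_sum => q qs; have [q1 q2] := sp q qs.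
rewrite -tens_sumr; apply: alg_cone_tens => //; apply: states_positive => g gs.
have := zmin q.1 g q1 gs; rewrite tens_lift_sum; last exact: state_bilinear.
have [lg _ _] := gs.
pose gl := mk_linear lg.
rewrite -[g]/(gl : _ -> _) linear_sum /=; congr (0 <= _).
by apply: eq_bigr => p _; rewrite -[g]/(gl : _ -> _) linearZ.
Qed.

(** * From weak approximation in the bidual to norm approximation *)

Section Minimax.
Variables (R : realType) (V : funSysType R).
Local Notation pos := (fs_pos V).
Local Notation e := (fs_unit V).

Lemma dominated_dual (M : R) (g : {linear V -> R^o}) :
  (forall v, g v <= M * ornorm v) -> exists f : fs_dual V, forall v, f v = g v.
Proof. by move=> gM; exists (mk_bdual (dominated_bounded gM)). Qed.

Lemma ornorm_sublinearM (M : R) : 0 <= M -> sublinear (fun v : V => M * ornorm v).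
Proof.
move=> M0; have [nD nZ] := @ornorm_sublinear R V; split=> [v w|a v a0].
  by rewrite -mulrDr ler_wpM2l.
by rewrite mulrCA ler_wpM2l// nZ.
Qed.

Lemma le_ornorm (M a : R) (v : V) : 0 < M ->
  (forall r, 0 < r -> pos (r *: e + v) -> pos (r *: e - v) -> a <= M * r) ->
  a <= M * ornorm v.
Proof.
move=> M0 h; rewrite -ler_pdivrMl//; apply: ornorm_ge => r r0 rp rn.
by rewrite ler_pdivrMl//; exact: h.
Qed.

(** Duality for the infimum of finitely many functionals: a lower bound [alpha] of its value at [e],
    computed over partitions of the unit, is reached by a functional below all the [g i]. The
    hypothesis concerns partitions in V only, but the functional [h] can be tested against
    partitions in V** too. *)
Lemma partition_minimax (n : nat) (g : 'I_n.+1 -> fs_dual V) (alpha : R) :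
  (forall p : 'I_n.+1 -> V, (forall i, pos (p i)) -> \sum_i p i = e ->
    alpha <= \sum_i g i (p i)) ->
  exists h : fs_dual V, (forall i v, pos v -> h v <= g i v) /\ alpha <= h e.
Proof.
move=> H; have [M0 M00 gM] := dual_le (g ord0).
(* If [d = t e - sum of u_i] lies between [- r e] and [r e], the slack costs
   [g_0 (r e + d) <= 2 M0 r] and at most [r] times the absolute value of [alpha]; the final 1 keeps
   [M] positive. *)
pose M := 2 * M0 + `|alpha| + 1.
have Mgt0 : 0 < M by rewrite /M ltr_wpDl// addr_ge0// mulr_ge0.
pose S (x : V) (a : R) := exists (t : R) (u : 'I_n.+1 -> V),
  [/\ 0 <= t, forall i, pos (u i), x = t *: e - \sum_i u i &
      a = t * alpha - \sum_i g i (u i)].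
have [||||f fN fS] := @mazur_orlicz R V _ S (ornorm_sublinearM (ltW Mgt0)).
- exists 0, (fun=> 0); split => //; first by move=> _; exact: fs_pos0.
    by rewrite scale0r big1// subr0.
  by rewrite mul0r big1 ?subr0// => i _; rewrite linear0.
- move=> _ _ _ _ [t [u [t0 u0 -> ->]]] [t' [u' [t'0 u'0 -> ->]]].
  exists (t + t'), (fun i => u i + u' i); split; rewrite ?addr_ge0//.
  + by move=> i; exact: fs_posD.
  + by rewrite scalerDl big_split opprD addrACA.
  + have -> : \sum_i g i (u i + u' i) = \sum_i g i (u i) + \sum_i g i (u' i).
      by rewrite -big_split; apply: eq_bigr => i _; rewrite linearD.
    by rewrite mulrDl opprD addrACA.
- move=> c _ _ c0 [t [u [t0 u0 -> ->]]]; exists (c * t), (fun i => c *: u i).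
  split; rewrite ?mulr_ge0 ?(ltW c0)//.
  + by move=> i; apply: fs_posZ => //; exact: ltW.
  + by rewrite scalerBr scalerA scaler_sumr.
  + rewrite mulrBr mulrA mulr_sumr; congr (_ - _).
    by apply: eq_bigr => i _; rewrite linearZ.
- move=> _ _ [t [u [t0 u0 -> ->]]]; apply: le_ornorm => // r r0.
  set d := t *: e - _ => dp dn.
  have tr0 : 0 < t + r by rewrite ltr_wpDl.
  (* The slack [r e + d] is positive; added to the member at [ord0], it makes the sum exactly
     [(t + r) e], so that the hypothesis applies after division. *)
  pose u' i := if i == ord0 then u i + (r *: e + d) else u i.
  have u'E : \sum_i u' i = (t + r) *: e.
    rewrite (bigD1 ord0)//= /u' eqxx (eq_bigr u); last by move=> i /negPf ->.
    have uE : \sum_i u i = u ord0 + \sum_(i < n.+1 | i != ord0) u i by rewrite (bigD1 ord0).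
    by rewrite addrAC -uE /d addrCA [X in _ + X]addrC subrK addrC -scalerDl.
  have u'g : \sum_i g i (u' i) = \sum_i g i (u i) + g ord0 (r *: e + d).
    rewrite (bigD1 ord0)//= [in RHS](bigD1 ord0)//= /u' eqxx linearD.
    rewrite addrAC; congr (_ + _ + _); apply: eq_bigr => i /negPf -> //.
  have := H (fun i => (t + r)^-1 *: u' i); rewrite -scaler_sumr u'E scalerA.
  rewrite mulVf ?gt_eqF// scale1r => /(_ _ erefl).
  have -> : \sum_i g i ((t + r)^-1 *: u' i) = (t + r)^-1 * \sum_i g i (u' i).
    by rewrite mulr_sumr; apply: eq_bigr => i _; rewrite linearZ.
  rewrite u'g ler_pdivlMl// => h.
  have {}h : (t + r) * alpha <= \sum_i g i (u i) + g ord0 (r *: e + d).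
    apply: h => i; apply: fs_posZ; first by rewrite invr_ge0 ltW.
    by rewrite /u'; case: ifP => // _; apply: fs_posD.
  have := gM r d (ltW r0) dp dn; have := gM 1 e ler01.
  rewrite scale1r subrr => /(_ (fs_posD _ _ (fs_pos_unit V) (fs_pos_unit V)) (fs_pos0 V)).
  move: h; rewrite linearD linearZ /= scaleoE.
  set x := g ord0 e; set y := g ord0 d; set z := \sum_i _ => h xM yM.
  have rx : r * x <= r * M0.
    by rewrite ler_wpM2l ?(ltW r0)//; apply: le_trans (ler_norm _) _; rewrite mulr1 in xM.
  have ra : - (r * alpha) <= r * `|alpha|.
    by rewrite -mulrN ler_wpM2l ?(ltW r0)// -normrN ler_norm.
  have yy := le_trans (ler_norm _) yM.
  rewrite /M !mulrDl; move: h; rewrite mulrDl; lra.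
have [h hf] := dominated_dual fN; exists h; split=> [i v vp|]; rewrite hf.
  have := fS (- v) (- g i v); rewrite linearN lerN2; apply.
  exists 0, (fun j => if j == i then v else 0); split=> //.
  - by move=> j; case: ifP => // _; exact: fs_pos0.
  - by rewrite scale0r sub0r -big_mkcond big_pred1_eq.
  - rewrite mul0r sub0r (eq_bigr (fun j => if j == i then g j v else 0)).
      by rewrite -big_mkcond big_pred1_eq.
    by move=> j _; case: ifP; rewrite ?linear0.
apply: fS; exists 1, (fun=> 0); split => //; first by move=> _; exact: fs_pos0.
  by rewrite scale1r big1// subr0.
by rewrite mul1r big1 ?subr0// => i _; rewrite linear0.
Qed.

Lemma trivial_or_states : e <> 0 -> exists f : fs_dual V, dual_pos f /\ f e = 1.
Proof.
move=> e0; have [f fs] : exists f : V -> R^o, is_state f.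
  apply: contrapT => h; apply: e0; apply/fs_posN; split; first exact: fs_pos_unit.
  by apply: states_positive => f fs; exfalso; apply: h; exists f.
have [lf fp f1] := fs.
pose fl := mk_linear lf.
by exists (mk_bdual (positive_bounded (g := fl) fp)).
Qed.

End Minimax.

Section WeakApprox.
Variables (R : realType) (V : funSysType R).
Local Notation pos := (fs_pos V).
Local Notation e := (fs_unit V).

(** One signed sum has to be small, rather than each term: separation in a finite power of V
    produces a single functional, whose components are the second entries of [t]. *)
Definition weak_approx := forall (t : seq (V * fs_dual V)) (d : R), 0 < d ->
  exists2 s : seq ((V -> R^o) * bidual V), unit_partition s &
    `|\sum_(p <- t) ((frank s p.1 : bidual V) p.2 - p.2 p.1)| <= d.

Lemma bidual_sumE (I : Type) (s : seq I) (F : I -> bidual V) (f : fs_dual V) :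
  (\sum_(i <- s) F i : bidual V) f = \sum_(i <- s) F i f.
Proof.
by apply: (big_morph (fun G : bidual V => G f)).
Qed.

Lemma dual_sumE (I : Type) (s : seq I) (F : I -> fs_dual V) (v : V) :
  (\sum_(i <- s) F i : fs_dual V) v = \sum_(i <- s) F i v.
Proof.
by apply: (big_morph (fun G : fs_dual V => G v)).
Qed.

(* If no partition of the unit approximates the identity in norm on t, then
   Mazur-Orlicz gives functionals F_j such that every unit partition in V
   satisfies sum_j F_j (error at t_j) >= eps; partition_minimax bounds such a sum
   from below on unit partitions in V** as well, against weak approximation. *)
Lemma weak_approx_approx : weak_approx -> approx_id V.
Proof.
move=> Vw t eps eps0; have [e0|e0] := eqVneq e 0.
  exists [::]; first by split=> //; rewrite big_nil.
  move=> v _; rewrite (unit0_trivial e0 (frank _ _ - v)) subr0 addr0.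
  by split; exact/fs_pos_unitZ/ltW.
apply: contrapT => nap; pose m := size t.
pose X : lmodType R := ('I_m -> V).
pose p (x : X) := \sum_j ornorm (x j).
have [nD nZ] := @ornorm_sublinear R V.
have sp : sublinear p.
  split=> [x y|c x c0]; first by rewrite -big_split /=; apply: ler_sum => j _; exact: nD.
  by rewrite mulr_sumr; apply: ler_sum => j _; exact: nZ.
(* Partitions of [c e] instead of [e], so that the errors form a cone: concatenation adds them, and
   rescaling the elements rescales them. *)
pose S (x : X) (a : R) := exists (c : R) (s : seq ((V -> R^o) * V)),
  [/\ 0 <= c, forall q, q \in s -> is_state q.1 /\ pos q.2, \sum_(q <- s) q.2 = c *: e,
      x = (fun j => frank s t`_j - c *: t`_j) & a = c * eps].
have [||||g gp gS] := @mazur_orlicz R X p S sp.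
- exists 0, [::]; split=> //; rewrite ?big_nil ?scale0r ?mul0r//.
  by apply/funext => j; rewrite /frank big_nil scale0r subr0.
- move=> _ _ _ _ [c [s [c0 s0 s1 -> ->]]] [c' [s' [c'0 s'0 s'1 -> ->]]].
  exists (c + c'), (s ++ s'); split; rewrite ?addr_ge0 ?mulrDl//.
  + by move=> q; rewrite mem_cat => /orP[/s0|/s'0].
  + by rewrite big_cat /= s1 s'1 scalerDl.
  + apply/funext => j; rewrite /frank big_cat scalerDl opprD /= addrACA.
    by [].
- move=> k _ _ k0 [c [s [c0 s0 s1 -> ->]]].
  exists (k * c), [seq (q.1, k *: q.2) | q <- s]; split; rewrite ?mulr_ge0 ?mulrA ?(ltW k0)//.
  + move=> _ /mapP[q /s0 [q1 q2] ->]; split=> //=; apply: fs_posZ => //; exact: ltW.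
  + by rewrite big_map -scaler_sumr s1 scalerA.
  + apply/funext => j; rewrite /frank big_map -scalerA.
    rewrite [LHS]scalerBr scaler_sumr; congr (_ - _).
    by apply: eq_bigr => q _; rewrite !scalerA mulrC.
- move=> _ _ [c [s [c0 s0 s1 -> ->]]].
  move: c0; rewrite le_eqVlt => /orP[/eqP <-|c0].
    by rewrite mul0r sumr_ge0// => j _; exact: ornorm_ge0.
  pose s' := [seq (q.1, c^-1 *: q.2) | q <- s].
  have s'P : unit_partition s'.
    split; last by rewrite big_map -scaler_sumr s1 scalerA mulVf ?gt_eqF// scale1r.
    move=> _ /mapP[q /s0 [q1 q2] ->]; split=> //=; apply: fs_posZ => //.
    by rewrite invr_ge0 ltW.
  have s'E v : frank s' v = c^-1 *: frank s v.
    rewrite /frank big_map scaler_sumr; apply: eq_bigr => q _.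
    by rewrite !scalerA mulrC.
  rewrite leNgt; apply/negP => sumlt; apply: nap; exists s' => // v /(nthP 0)[j jm jv].
  pose x v := frank s v - c *: v.
  have : ornorm (c^-1 *: x v) < eps.
    rewrite (sublinearZ _ (@ornorm_sublinear R V)) ?invr_ge0 ?(ltW c0)//.
    rewrite ltr_pdivrMl//; apply: le_lt_trans sumlt.
    rewrite /p (bigD1 (Ordinal jm))//= jv lerDl sumr_ge0// => i _; exact: ornorm_ge0.
  rewrite /x scalerBr -s'E scalerA mulVf ?gt_eqF// scale1r.
  exact: ornorm_lt.
have [z zE gz] := family_functional g.
have /choice[F FE] : forall j, exists F : fs_dual V, forall v, F v = z j v.
  move=> j; apply: (@dominated_dual R V 1) => v; rewrite zE; apply: le_trans (gp _) _.
  rewrite /p (bigD1 j)//= /single eqxx big1 ?addr0 ?mul1r// => i /negPf ->.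
  by rewrite (sublinear0 (@ornorm_sublinear R V)).
have gF x : g x = \sum_j F j (x j) by rewrite gz; apply: eq_bigr => j _; rewrite FE.
have [s [sp0 s1] sd] := Vw [seq (t`_(nat_of_ord j), F j) | j <- enum 'I_m] (eps / 2) (divr_gt0 eps0 (ltr0n _ 2)).
pose c := \sum_j F j t`_j.
pose d := (fun=> 0, 0) : (V -> R^o) * bidual V.
have sn0 : s != [::].
  apply/eqP => s0; have [f [fp f1]] := trivial_or_states (elimN eqP e0).
  have : (0 : bidual V) f = 1 by rewrite -f1 -[RHS]/(bidual_incl e f) -[bidual_incl e]/(fs_unit (bidual V)) -s1 s0 big_nil.
  by move=> /esym/eqP; rewrite oner_eq0.
have [n sn] : exists n, size s = n.+1 by case: (s) sn0 => // q s' _; exists (size s').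
(* The states of [s] stay, its elements become variable: for any partition with these states, in V
   or in V**, pairing its i-th element with [G i] and summing gives the sum over [j] of [F j] at the
   approximant of the j-th point. *)
pose G (i : 'I_n.+1) : fs_dual V := \sum_(j < m) (nth d s i).1 t`_j *: F j.
have [p0 p0P p01|h [hG hc]] := @partition_minimax R V n G (c + eps).
  have : eps <= g (fun j => \sum_(i < n.+1) (nth d s i).1 t`_j *: p0 i - 1 *: t`_j).
    apply: gS; exists 1, [seq ((nth d s (i : 'I_n.+1)).1, p0 i) | i <- enum 'I_n.+1].
    split=> //; rewrite ?mul1r//.
    - move=> _ /mapP[i _ ->]; split=> //=.
      by have [] := sp0 (nth d s i) (mem_nth _ _); rewrite ?sn.
    - by rewrite big_map big_enum /= p01 scale1r.
    - by apply/funext => j; rewrite /frank big_map big_enum.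
  rewrite gF (eq_bigr (fun j : 'I_m => \sum_(i < n.+1) (nth d s i).1 t`_j * F j (p0 i) - F j t`_j)).
    rewrite sumrB -/c exchange_big /= lerBrDl; congr (_ <= _).
    apply: eq_bigr => i _; rewrite dual_sumE; apply: eq_bigr => j _.
    by [].
  move=> j _; rewrite scale1r linearB linear_sum; congr (_ - _).
  by apply: eq_bigr => i _; rewrite linearZ.
have : \sum_(i < n.+1) (nth d s i).2 (G i) <= c + eps / 2.
  move: sd; rewrite big_map big_enum /= sumrB -/c => /(le_trans (ler_norm _)).
  rewrite lerBlDl; congr (_ <= _).
  rewrite (eq_bigr (fun j : 'I_m => \sum_(i < n.+1) (nth d s i).1 t`_j * (nth d s i).2 (F j))).
    rewrite exchange_big /=; apply: eq_bigr => i _; rewrite linear_sum.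
    by apply: eq_bigr => j _; rewrite linearZ.
  move=> j _; rewrite /frank bidual_sumE (big_nth d) sn big_mkord.
  by [].
have : \sum_(i < n.+1) (nth d s i).2 h <= \sum_(i < n.+1) (nth d s i).2 (G i).
  apply: ler_sum => i _; rewrite -subr_ge0 -linearB.
  have [_ ip] : is_state (nth d s i).1 /\ fs_pos _ (nth d s i).2.
    by apply: sp0; rewrite mem_nth// sn.
  by apply: ip => v vp; rewrite /= subr_ge0 hG.
have -> : \sum_(i < n.+1) (nth d s i).2 h = h e.
  rewrite -[RHS]/(bidual_incl e h) -[bidual_incl e]/(fs_unit (bidual V)) -s1.
  by rewrite bidual_sumE (big_nth d) sn big_mkord.
lra.
Qed.

End WeakApprox.

(** * Nets of maps through finite-dimensional spaces *)

Section PartitionMaps.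
Variables (R : realType) (V Z : funSysType R).

Lemma partition_of_maps (n : nat) (phi : {linear V -> linfty R n})
    (psi : {linear linfty R n -> Z}) : unital_positive phi -> unital_positive psi ->
  exists2 s : seq ((V -> R^o) * Z), unit_partition s &
    forall v, frank s v = psi (phi v).
Proof.
move=> [phi1 phip] [psi1 psip].
pose dl i : linfty R n := delta_mx 0 i.
have dlE (x : linfty R n) : x = \sum_i (x : 'rV[R]_n) 0 i *: dl i := row_sum_delta x.
exists [seq (fun v => (phi v : 'rV[R]_n) 0 i : R^o, psi (dl i)) | i <- enum 'I_n]; last first.
  move=> v; rewrite /frank big_map big_enum /= [in RHS](dlE (phi v)) linear_sum.
  by apply: eq_bigr => i _; rewrite linearZ.
split; last first.
  rewrite big_map big_enum /= -linear_sum -psi1; congr (psi _).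
  rewrite [RHS]dlE; apply: eq_bigr => i _.
  by rewrite mxE scale1r.
move=> _ /mapP[i _ ->] /=; split; last first.
  by apply: psip => j; rewrite mxE; case: (_ && _).
split=> [a v w|v vp|]; last by rewrite phi1 mxE.
  by rewrite linearP mxE [X in X + _]mxE.
exact: phip.
Qed.

Lemma maps_of_partition (s : seq ((V -> R^o) * Z)) : unit_partition s ->
  exists (phi : {linear V -> linfty R (size s)}) (psi : {linear linfty R (size s) -> Z}),
  [/\ unital_positive phi, unital_positive psi, forall v, psi (phi v) = frank s v,
    forall v i, (phi v : 'rV_(size s)) 0 i = (nth (fun=> 0, 0) s i).1 v &
    forall r : 'rV_(size s), psi r = \sum_i r 0 i *: (nth (fun=> 0, 0) s i).2].
Proof.
move=> [sp s1]; set d := (fun=> 0, 0).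
have np (i : 'I_(size s)) : is_state (nth d s i).1 /\ fs_pos Z (nth d s i).2.
  exact/sp/mem_nth.
pose f v : linfty R (size s) := \row_i (nth d s i).1 v.
have lf : linear f.
  by move=> a v w; apply/rowP => i; rewrite !mxE; have [[-> _ _] _] := np i.
pose phi := mk_linear lf.
pose g (r : linfty R (size s)) := \sum_i (r : 'rV[R]_(size s)) 0 i *: (nth d s i).2.
have lg : linear g.
  move=> a x y; rewrite /g scaler_sumr -big_split; apply: eq_bigr => i _ /=.
  by rewrite mxE [X in X + _]mxE scalerDl scalerA.
pose psi := mk_linear lg.
exists phi, psi; split=> //.
- split; first by apply/rowP => i; rewrite !mxE; have [[_ _ ->] _] := np i.
  by move=> v vp i; rewrite mxE; have [[_ h _] _] := np i; exact: h.
- split=> [|r rp].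
    rewrite /unital_map -[LHS]/(g _) /g -s1 (big_nth d) big_mkord; apply: eq_bigr => i _.
    by rewrite mxE scale1r.
  by apply: fs_pos_sum => i _; apply: fs_posZ; [exact: rp|have [] := np i].
- move=> v; rewrite -[LHS]/(g _) /g /frank (big_nth d) big_mkord; apply: eq_bigr => i _.
  by rewrite mxE.
- by move=> v i; rewrite mxE.
Qed.

End PartitionMaps.

Lemma net_filter_proper (L : directedSet) : ProperFilter (net_filter L).
Proof.
split=> [[l0 h]|]; first exact: (h l0 (ds_refl l0)).
split=> [|A B [a ha] [b hb]|A B AB [a ha]].
- by have [l] := ds_inhabited L; exists l.
- have [c [ac bc]] := ds_directed a b; exists c => l cl; split.
    exact: ha (ds_trans ac cl).
  exact: hb (ds_trans bc cl).
- by exists a => l /ha /AB.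
Qed.

Section SeqNet.
Variable T : choiceType.

(** A finite set of test points paired with a precision [1/(n+1)]: the order that turns an
    approximation statement for finite sets into a net. *)
Definition seq_net_le (a b : seq T * nat) := {subset a.1 <= b.1} /\ (a.2 <= b.2)%N.

Lemma seq_net_refl a : seq_net_le a a. Proof. by split. Qed.

Lemma seq_net_trans a b c : seq_net_le a b -> seq_net_le b c -> seq_net_le a c.
Proof.
by move=> [ab ab'] [bc bc']; split=> [x /ab /bc//|]; exact: leq_trans bc'.
Qed.

Lemma seq_net_directed a b : exists c, seq_net_le a c /\ seq_net_le b c.
Proof.
exists (a.1 ++ b.1, maxn a.2 b.2); split; split=> /= [x xa|].
- by rewrite mem_cat xa.
- exact: leq_maxl.
- by rewrite mem_cat xa orbT.
- exact: leq_maxr.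
Qed.

Definition seq_net : directedSet := DirectedSet seq_net_refl seq_net_trans
  (inhabits ([::], 0%N)) seq_net_directed.

End SeqNet.

Section ApproxNet.
Variables (R : realType) (V : funSysType R).

Definition point_norm_approx :=
   exists (L : directedSet) (n : L -> nat)
          (phi : forall l, {linear V -> linfty R (n l)})
          (psi : forall l, {linear linfty R (n l) -> V}),
     [/\ forall l, unital_positive (phi l),
         forall l, unital_positive (psi l) &
         forall v, (fun l => ornorm (psi l (phi l v) - v)) @ net_filter L
                     --> (0 : R)].

Lemma approx_net : approx_id V -> point_norm_approx.
Proof.
move=> Vap.
have /choice[s sP] : forall l : seq_net V, exists s : seq ((V -> R^o) * V),
    unit_partition s /\ forall v, v \in l.1 ->
    fs_pos V (l.2.+1%:R^-1 *: fs_unit V + (frank s v - v)) /\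
    fs_pos V (l.2.+1%:R^-1 *: fs_unit V - (frank s v - v)).
  move=> l; have l0 : 0 < l.2.+1%:R^-1 :> R by [].
  by have [s ? ?] := Vap l.1 _ l0; exists s.
pose phiP l := cid (maps_of_partition (sP l).1).
pose psiP l := cid (svalP (phiP l)).
pose phi l := sval (phiP l); pose psi l := sval (psiP l).
have pP l := svalP (psiP l).
exists (seq_net V), (fun l => size (s l)), phi, psi.
split=> [l|l|v]; try by have [] := pP l.
have FF := net_filter_proper (seq_net V).
apply/cvgrPdist_le => eps eps0.
have [N Neps] : exists N : nat, N.+1%:R^-1 <= eps.
  exists (Num.truncn eps^-1); rewrite -[leRHS]invrK lef_pV2 ?posrE ?invr_gt0//.
  exact/ltW/truncnS_gt.
exists ([:: v], N) => l [vl Nl].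
rewrite sub0r normrN ger0_norm ?ornorm_ge0//.
have [_ _ -> _ _] := pP l; have [hp hn] := (sP l).2 v (vl v (mem_head _ _)).
apply: le_trans Neps; apply: (@le_trans _ _ l.2.+1%:R^-1).
  exact: ornorm_le.
by rewrite lef_pV2 ?posrE// ler_nat ltnS.
Qed.

Lemma net_approx : point_norm_approx -> approx_id V.
Proof.
move=> [L [n [phi [psi [phiP psiP cv]]]]] t eps eps0.
have FF := net_filter_proper L.
have : \forall l \near net_filter L, forall v, v \in t ->
    ornorm (psi l (phi l v) - v) < eps.
  elim: t => [|v t IH]; first by near=> l.
  have /cvgr_lt/(_ _ eps0) nv := cv v.
  near=> l => w; rewrite inE => /orP[/eqP ->|]; first by near: l.
  by move: w; near: l.
move=> /filter_ex[l lP].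
have [s s1 sE] := partition_of_maps (phiP l) (psiP l).
by exists s => // v /lP; rewrite sE; exact: ornorm_lt.
Unshelve. all: by end_near.
Qed.

End ApproxNet.

Lemma ptws_cvg (R : realType) (U : choiceType) (F : set_system {ptws U -> R^o})
    (f : {ptws U -> R^o}) : Filter F ->
  (forall u, (fun g : {ptws U -> R^o} => g u) @ F --> f u) -> F --> f.
Proof.
move=> FF h; apply/cvg_sup => u A [_ [[B Bo <-] Bf] BA].
have /h : nbhs (f u) B by apply: open_nbhs_nbhs.
exact: (filterS BA).
Qed.

Lemma cvg_initial (S : choiceType) (T : topologicalType) (f : S -> T)
    (F : set_system S) (s : S) : Filter F -> f @ F --> f s ->
  F --> (s : initial_topology f).
Proof.
move=> FF h A [_ [[B Bo <-] Bs] BA].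
have /h : nbhs (f s) B by apply: open_nbhs_nbhs.
exact: (filterS BA).
Qed.

Section DualCone.
Variables (R : realType) (V : funSysType R).

Lemma dualD (f g : fs_dual V) v : (f + g : fs_dual V) v = f v + g v.
Proof. by []. Qed.

Lemma dualB (f g : fs_dual V) v : (f - g : fs_dual V) v = f v - g v.
Proof. by []. Qed.

Lemma dualZ (a : R) (f : fs_dual V) v : (a *: f : fs_dual V) v = a * f v.
Proof. by []. Qed.

Lemma dual_posD (f g : fs_dual V) : dual_pos f -> dual_pos g -> dual_pos (f + g).
Proof. by move=> fp gp v vp; rewrite dualD addr_ge0 ?fp ?gp. Qed.

Lemma dual_posZ (a : R) (f : fs_dual V) : 0 <= a -> dual_pos f -> dual_pos (a *: f).
Proof. by move=> a0 fp v vp; rewrite dualZ mulr_ge0 ?fp. Qed.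

End DualCone.

Section WeakStar.
Variables (R : realType) (V : funSysType R).

Lemma weak_star_cvg (F : set_system (weak_star V)) (G : weak_star V) : Filter F ->
  (forall f : fs_dual V, (fun H : weak_star V => (H : bidual V) f : R^o) @ F
     --> ((G : bidual V) f : R^o)) -> F --> G.
Proof.
move=> FF h; apply: cvg_initial; apply: ptws_cvg => f A Af.
exact: (h f A Af).
Qed.

Lemma weak_star_eval (f : fs_dual V) :
  continuous (fun H : weak_star V => (H : bidual V) f : R^o).
Proof.
move=> H; apply: (@continuous_comp _ _ _
  (fun H : weak_star V => ((H : bidual V) : fs_dual V -> R^o) : {ptws fs_dual V -> R^o})
  (fun g : {ptws fs_dual V -> R^o} => g f)).
  exact: initial_continuous.
exact: (@proj_continuous (fs_dual V) (fun=> R^o) f).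
Qed.

(** This compares the order norm of V** with weak* convergence: [f] is the difference of the
    positive [g] and [g - f], and an order bound on [F] can be evaluated at a positive
    functional. *)
Lemma bidual_bound (f : fs_dual V) : exists2 C : R, 0 <= C & forall (r : R) (F : bidual V),
  0 <= r -> bidual_pos (r *: fs_unit (bidual V) + F : bidual V) ->
  bidual_pos (r *: fs_unit (bidual V) - F : bidual V) -> `|F f| <= C * r.
Proof.
have [g gp gf] := dual_decomposition f.
pose e := fs_unit V.
have ge : 0 <= g e by apply: gp; exact: fs_pos_unit.
have gfe : 0 <= (g - f : fs_dual V) e by apply: gf; exact: fs_pos_unit.
exists (g e + (g - f : fs_dual V) e) => [|r F r0 Fp Fn]; first exact: addr_ge0.
have bd (h : fs_dual V) : dual_pos h -> `|F h| <= h e * r.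
  move=> hp; have : 0 <= r * h e + F h := Fp h hp.
  have : 0 <= r * h e - F h := Fn h hp.
  by rewrite ler_norml mulrC => ? ?; apply/andP; split; lra.
have -> : F f = F g - F (g - f : fs_dual V) by rewrite -[in LHS](subKr g f) -linearB.
by rewrite mulrDl; apply: le_trans (ler_normB _ _) _; apply: lerD; exact: bd.
Qed.

Lemma incl_unital_positive : unital_positive (@bidual_incl R V).
Proof. by split=> // v vp f; exact. Qed.

Lemma unital_positive_comp (U W Z : funSysType R) (f : W -> Z) (g : U -> W) :
  unital_positive f -> unital_positive g -> unital_positive (f \o g).
Proof.
move=> [f1 fp] [g1 gp]; split; last by move=> u up /=; exact/fp/gp.
by rewrite /unital_map /= g1 f1.
Qed.

Definition point_weak_approx :=
   exists (L : directedSet) (n : L -> nat)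
          (phi : forall l, {linear bidual V -> linfty R (n l)})
          (psi : forall l, {linear linfty R (n l) -> bidual V}),
     [/\ forall l, unital_positive (phi l) /\
                   continuous (phi l : weak_star V -> 'rV[R]_(n l)),
         forall l, unital_positive (psi l) /\
                   continuous (psi l : 'rV[R]_(n l) -> weak_star V) &
         forall F : bidual V,
           ((fun l => psi l (phi l F)) : L -> weak_star V) @ net_filter L
             --> (F : weak_star V)].

Lemma point_weak_weak : point_weak_approx -> weak_approx V.
Proof.
move=> [L [n [phi [psi [phiP psiP cv]]]]] t d d0.
have FF := net_filter_proper L.
pose c := d / (size t).+1%:R.
have c0 : 0 < c by exact: divr_gt0.
have : \forall l \near net_filter L, forall p : V * fs_dual V, p \in t ->
    `|(psi l (phi l (bidual_incl p.1)) : bidual V) p.2 - p.2 p.1| <= c.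
  elim: (t) => [|v s IH]; first by near=> l.
  have nv : (fun l => (psi l (phi l (bidual_incl v.1)) : bidual V) v.2 : R^o) @ net_filter L -->
      (v.2 v.1 : R^o).
    move=> A Af; have := @weak_star_eval v.2 (bidual_incl v.1) A Af.
    exact: (cv (bidual_incl v.1)).
  move/cvgrPdist_le : nv => /(_ c c0) nv.
  near=> l => w; rewrite inE => /orP[/eqP ->|]; first by rewrite distrC; near: l.
  by move: w; near: l.
move=> /filter_ex[l lP].
have [s s1 sE] := partition_of_maps (unital_positive_comp (phiP l).1 incl_unital_positive
  : @unital_positive _ V _ (phi l \o @bidual_incl R V)) (psiP l).1.
exists s => //; apply: le_trans (ler_norm_sum _ _ _) _.
apply: (@le_trans _ _ (\sum_(p <- t) c)).
  by rewrite big_seq [leRHS]big_seq; apply: ler_sum => p pt; rewrite sE; exact: lP.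
rewrite big_const_seq iter_addr addr0 count_predT -mulr_natr /c mulrAC ler_pdivrMr//.
by rewrite ler_pM2l// ler_nat.
Unshelve. all: by end_near.
Qed.

(** Otherwise separation in a finite power of R gives a combination [F] of the elements of [t] with
    [F f >= phi F + eps] at every state [f] of V. Positivity in V** is tested on positive
    functionals of V, so [F - (phi F + eps) 1] is positive, yet [phi] sends it to [- eps]. *)
Lemma state_density (phi : bidual V -> R^o) (t : seq (bidual V)) (eps : R) :
  is_state phi -> 0 < eps -> exists f : fs_dual V, [/\ dual_pos f, f (fs_unit V) = 1 &
    forall F : bidual V, F \in t -> `|F f - phi F| <= eps].
Proof.
move=> [lphi phip phi1] eps0; apply: contrapT => H; pose m := size t.
pose T (j : 'I_m) : bidual V := t`_j.
pose phil := mk_linear lphi.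
pose X : lmodType R := ('I_m -> R^o).
pose p (x : X) := \sum_j `|x j|.
have sp : sublinear p.
  split=> [x y|c x c0]; first by rewrite -big_split /=; apply: ler_sum => j _; exact: ler_normD.
  by rewrite mulr_sumr; apply: ler_sum => j _; rewrite normrZ gtr0_norm.
pose S (x : X) (a : R) := exists f : fs_dual V, [/\ dual_pos f,
  x = (fun j => T j f - f (fs_unit V) * phi (T j)) & a = f (fs_unit V) * eps].
have [||||g gp gS] := @mazur_orlicz R X p S sp.
- exists 0; split; first by move=> v _; exact: lexx.
    by apply/funext => j; rewrite /= linear0 mul0r subr0.
  by rewrite mul0r.
- move=> _ _ _ _ [f [fp -> ->]] [f' [fp' -> ->]]; exists (f + f').
  split; first exact: dual_posD.
    apply/funext => j; rewrite linearD dualD mulrDl opprD.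
    by rewrite addrACA.
  by rewrite dualD mulrDl.
- move=> c _ _ c0 [f [fp -> ->]]; exists (c *: f).
  split; first by apply: dual_posZ => //; exact: ltW.
    apply/funext => j; rewrite linearZ dualZ -mulrA.
    exact: mulrBr.
  by rewrite dualZ mulrA.
- move=> _ _ [f [fp -> ->]]; set c := f (fs_unit V).
  have : 0 <= c by apply: fp; exact: fs_pos_unit.
  rewrite le_eqVlt => /orP[/eqP <-|c0]; first by rewrite mul0r sumr_ge0.
  rewrite leNgt; apply/negP => sumlt; apply: H; exists (c^-1 *: f); split.
  + by apply: dual_posZ => //; rewrite invr_ge0 ltW.
  + by rewrite -[LHS]/(c^-1 * c) mulVf ?gt_eqF.
  + move=> F /(nthP 0)[j jm <-]; rewrite -[t`_j]/(T (Ordinal jm)) linearZ /= scaleoE.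
    rewrite -(ler_pM2l c0) -[X in X * `|_|]gtr0_norm// -normrM mulrBr mulrA divff ?gt_eqF//.
    rewrite mul1r; apply: le_trans (ltW sumlt).
    by rewrite /p (bigD1 (Ordinal jm))//= lerDl sumr_ge0.
have [l _ gE] := coordinate_functional g.
pose F : bidual V := \sum_j l j *: T j.
have FE f : F f = \sum_j l j * T j f.
  by rewrite bidual_sumE.
have phiF : phi F = \sum_j l j * phi (T j).
  by rewrite -[phi]/(phil : _ -> _) linear_sum; apply: eq_bigr => j _; rewrite linearZ.
have : fs_pos (bidual V) (F - (phi F + eps) *: fs_unit (bidual V)).
  move=> f fp; rewrite -[X in 0 <= X]/(F f - (phi F + eps) * f (fs_unit V)).
  have := gS _ _ (ex_intro _ f (And3 fp erefl erefl)); rewrite gE.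
  rewrite (eq_bigr (fun j => l j * T j f -
     f (fs_unit V) * (l j * phi (T j)))); last first.
    by move=> j _; rewrite mulrBl mulrC; congr (_ - _); rewrite -mulrA [phi _ * _]mulrC.
  by rewrite sumrB -mulr_sumr -FE -phiF subr_ge0 mulrDl lerBrDl addrC [phi F * _]mulrC
     [eps * _]mulrC addrC.
move=> /phip; rewrite -[phi]/(phil : _ -> _) linearB linearZ /= phi1 scaleoE mulr1.
lra.
Qed.

End WeakStar.

Section BidualNet.
Variables (R : realType) (V : funSysType R).

Lemma mx_continuous (T : topologicalType) (n : nat) (f : T -> 'rV[R]_n) :
  (forall i, continuous (fun x => f x 0 i)) -> continuous f.
Proof.
move=> h x A [P Pn PA]; have : \forall y \near x, forall i, P 0 i (f y 0 i).
  by apply: filter_forall => i; exact: (h i x _ (Pn 0 i)).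
by apply: filterS => y Py; apply: PA => i j; rewrite (ord1 i).
Qed.

Lemma sum_continuous (T : topologicalType) (I : Type) (s : seq I) (f : I -> T -> R^o) :
  (forall i, continuous (f i)) -> continuous (fun x => \sum_(i <- s) f i x).
Proof.
move=> h; elim: s => [|i s IH].
  by under eq_fun do rewrite big_nil; move=> x; exact: cvg_cst.
under eq_fun do rewrite big_cons; move=> x; apply: (@cvgD _ R^o); first exact: h.
exact: IH.
Qed.

Lemma coordM_continuous (n : nat) (i : 'I_n) (c : R) :
  continuous (fun r : 'rV[R]_n => r 0 i * c : R^o).
Proof.
move=> x; apply: (@cvgM R 'rV[R]_n (nbhs x)); last exact: cvg_cst.
exact: (@coord_continuous R 1 n 0 i x).
Qed.

(** A state of V** need not be weak* continuous, so each is replaced by evaluation at a state of V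
    that agrees with it up to [eps] on the test points. As the elements sum to the unit, this costs
    one more [eps], whence the factor 2. *)
Lemma bidual_approx_net : approx_id (bidual V) -> point_weak_approx V.
Proof.
move=> Vap.
have /choice[s sP] : forall l : seq_net (bidual V),
    exists s : seq ((bidual V -> R^o) * bidual V), [/\ unit_partition s,
      forall q, q \in s -> exists f : fs_dual V, q.1 = (fun F : bidual V => F f) &
      forall F : bidual V, F \in l.1 ->
    bidual_pos ((2 * l.2.+1%:R^-1) *: fs_unit (bidual V) + (frank s F - F) : bidual V) /\
    bidual_pos ((2 * l.2.+1%:R^-1) *: fs_unit (bidual V) - (frank s F - F) : bidual V)].
  move=> l; have eps0 : 0 < l.2.+1%:R^-1 :> R by [].
  set eps := l.2.+1%:R^-1 in eps0 *.
  have [s [sp s1] st] := Vap l.1 _ eps0.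
  have /choice[h hP] : forall phi : bidual V -> R^o, exists f : fs_dual V, is_state phi ->
      [/\ dual_pos f, f (fs_unit V) = 1 & forall F : bidual V, F \in l.1 -> `|F f - phi F| <= eps].
    move=> phi; have [ps|ps] := pselect (is_state phi).
      by have [f fP] := state_density l.1 ps eps0; exists f.
    by exists 0.
  pose s' := [seq ((fun F : bidual V => F (h q.1) : R^o), q.2) | q <- s].
  have s'E (F : bidual V) : frank s' F = frank s F + \sum_(q <- s) (F (h q.1) - q.1 F) *: q.2.
    rewrite /frank big_map -big_split; apply: eq_bigr => q _ /=.
    by rewrite -scalerDl addrC subrK.
  exists s'; split.
  - split; last by rewrite big_map.
    move=> _ /mapP[q /sp[q1 q2] ->] /=; split=> //; have [hp h1 _] := hP _ q1.
    by split=> // F Fp; exact: Fp.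
  - by move=> _ /mapP[q _ ->]; exists (h q.1).
  - move=> F Fl; have [Fp Fn] := st F Fl; rewrite s'E.
    set D := \sum_(q <- s) _.
    have Dp : fs_pos (bidual V) (eps *: fs_unit (bidual V) + D).
      rewrite -s1 scaler_sumr -big_split; apply: fs_pos_sum => q qs /=.
      rewrite -scalerDl; have [q1 q2] := sp q qs; apply: fs_posZ => //.
      have [_ _ /(_ F Fl)] := hP _ q1; rewrite ler_norml => /andP[]; lra.
    have Dn : fs_pos (bidual V) (eps *: fs_unit (bidual V) - D).
      rewrite -s1 scaler_sumr -sumrB; apply: fs_pos_sum => q qs /=.
      rewrite -scalerBl; have [q1 q2] := sp q qs; apply: fs_posZ => //.
      by have [_ _ /(_ F Fl)] := hP _ q1; rewrite ler_norml => /andP[]; lra.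
    have -> : frank s F + D - F = (frank s F - F) + D by rewrite addrAC.
    rewrite mulrDl mul1r scalerDl; split.
      by rewrite addrACA; exact: fs_posD Fp Dp.
    by rewrite opprD addrACA; exact: fs_posD Fn Dn.
pose phiP l := cid (let: And3 a _ _ := sP l in maps_of_partition a).
pose psiP l := cid (svalP (phiP l)).
pose phi l := sval (phiP l); pose psi l := sval (psiP l).
have pP l := svalP (psiP l).
exists (seq_net (bidual V)), (fun l => size (s l)), phi, psi; split.
- move=> l; have [p1 _ _ p2 _] := pP l; split=> //.
  apply: mx_continuous => i.
  have [_ sPq _] := sP l.
  have [f fE] := sPq _ (mem_nth (fun=> 0, 0) (ltn_ord i)).
  rewrite (_ : (fun x => _) = (fun H : weak_star V => (H : bidual V) f : R^o)).
    exact: weak_star_eval.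
  by apply/funext => H; rewrite p2 fE.
- move=> l; have [_ p1 _ _ p2] := pP l; split=> //.
  move=> r; have Fr : Filter (nbhs (r : 'rV[R]_(size (s l)))) := @nbhs_filter _ _.
  have Fp : Filter ((psi l : _ -> weak_star V) @ (r : 'rV[R]_(size (s l)))) := fmap_filter _ _.
  apply: weak_star_cvg => f.
  change ((fun r => (psi l r : bidual V) f : R^o) @ r --> ((psi l r : bidual V) f : R^o)).
  pose c (i : 'I_(size (s l))) : R := ((nth (fun=> 0, 0) (s l) i).2 : bidual V) f.
  have E r' : (psi l r' : bidual V) f =
      \sum_i (r' : 'rV[R]_(size (s l))) 0 i * c i.
    by rewrite /psi p2 bidual_sumE.
  rewrite E (_ : (fun r' => _) = (fun r' : 'rV[R]_(size (s l)) =>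
     \sum_i r' 0 i * c i : R^o)); last by apply/funext.
  apply: (sum_continuous (f := fun i (r' : 'rV[R]_(size (s l))) => r' 0 i * c i : R^o)) => i.
  exact: coordM_continuous.
- move=> F; have FF := net_filter_proper (seq_net (bidual V)).
  apply: weak_star_cvg => f.
  have [C C0 fC] := bidual_bound f.
  apply/cvgrPdist_le => eps eps0.
  have [N Neps] : exists N : nat, C * (2 * N.+1%:R^-1) <= eps.
    exists (Num.truncn (eps^-1 * (C * 2))).
    rewrite mulrA ler_pdivrMr// -ler_pdivrMl//.
    exact/ltW/truncnS_gt.
  exists ([:: F], N) => l [Fl Nl] /=.
  have [_ _ /(_ F (Fl F (mem_head _ _)))[hp hn]] := sP l.
  have [_ _ psE _ _] := pP l; rewrite /psi /phi psE distrC.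
  have := fC (2 * l.2.+1%:R^-1) (frank (s l) F - F) _ hp hn.
  rewrite mulr_ge0// => /(_ isT) h.
  apply: le_trans h _; apply: le_trans Neps.
  by rewrite ler_wpM2l// ler_wpM2l// lef_pV2 ?posrE// ler_nat ltnS.
Qed.

End BidualNet.

(** * Approximation in vector lattices of functions *)

Section LatticeApprox.
Variables (R : realType) (L : funSysType R) (S : choiceType) (ev : S -> {linear L -> R^o}).
Hypothesis ev_pos : forall f, fs_pos L f <-> forall x, 0 <= ev x f.
Hypothesis ev_unit : forall x, ev x (fs_unit L) = 1.
Hypothesis ev_max : forall f g, exists h, forall x, ev x h = Num.max (ev x f) (ev x g).

Local Notation e := (fs_unit L).

Lemma ev_inj f g : (forall x, ev x f = ev x g) -> f = g.
Proof.
move=> fg; apply/eqP; rewrite -subr_eq0; apply/eqP/fs_posN.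
by split; apply/ev_pos => x; rewrite ?linearN linearB fg subrr ?oppr0.
Qed.

Lemma ev_state x : is_state (ev x).
Proof. by split=> [|v /ev_pos|] //; exact: linearP. Qed.

(** Total boundedness for the pseudo-metric given by [t]: the values at the elements of [t] are
    sorted into cells of length [d], and one point is kept for each code that occurs. Points with
    the same code have values within [d] of each other. *)
Lemma ev_net (t : seq L) (d : R) : 0 < d -> exists P : seq S, forall x, exists2 p, p \in P &
  forall f, f \in t -> `|ev x f - ev p f| <= d.
Proof.
move=> d0; pose m := size t.
have /choice[r rP] : forall f : L, exists r : R, 0 < r /\ forall x, - r <= ev x f <= r.
  move=> f; have [r r0 [/ev_pos rp /ev_pos rn]] := fs_abs_unit f; exists r; split=> // x.
  have := rp x; have := rn x; rewrite !linearD linearN !linearZ /= ev_unit scaleoE mulr1.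
  by move=> ? ?; apply/andP; split; lra.
pose c (f : L) x := Num.truncn ((ev x f + r f) / d).
pose N := (\max_(f <- t) Num.truncn (2 * r f / d))%N.
have cN f x : f \in t -> (c f x < N.+1)%N.
  move=> ft; rewrite ltnS; apply: (@leq_trans (Num.truncn (2 * r f / d))).
    apply: le_truncn; rewrite ler_pM2r ?invr_gt0//.
    by have [_ /(_ x)/andP[]] := rP f; lra.
  by rewrite /N (big_rem f)//= leq_maxl.
pose code x : {ffun 'I_m -> 'I_N.+1} := [ffun j : 'I_m => inord (c t`_j x)].
pose pk (k : {ffun 'I_m -> 'I_N.+1}) : option S :=
  if pselect (exists x, code x = k) is left h then Some (sval (cid h)) else None.
exists (pmap pk (enum {ffun 'I_m -> 'I_N.+1})) => x.
have [p pkE pE] : exists2 p, pk (code x) = Some p & code p = code x.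
  rewrite /pk; case: pselect => [h|[]]; last by exists x.
  by exists (sval (cid h)) => //; exact: (svalP (cid h)).
exists p; first by rewrite mem_pmap -pkE map_f// mem_enum.
move=> f ft; have /(nthP 0)[j jm jf] := ft.
have : c f p = c f x.
  move/ffunP : pE => /(_ (Ordinal jm)); rewrite !ffunE /= jf => /(congr1 val) /=.
  by rewrite !inordK ?cN.
rewrite /c; set a := _ / d; set b := _ / d => ab.
have tr y : 0 <= (ev y f + r f) / d.
  by rewrite divr_ge0// ?(ltW d0)//; have [_ /(_ y)/andP[]] := rP f; lra.
have /andP[a1 a2] := truncn_itv (tr p); have /andP[b1 b2] := truncn_itv (tr x).
rewrite -/a -/b in a1 a2 b1 b2; rewrite ab in a1 a2.
rewrite -natr1 in a2 b2.
have dE : ev x f - ev p f = (b - a) * d.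
  by rewrite /a /b -mulrBl divfK ?gt_eqF//; lra.
rewrite dE normrM [`|d|]gtr0_norm// -[leRHS]mul1r ler_wpM2r ?(ltW d0)//.
by rewrite ler_norml; apply/andP; split; lra.
Qed.

(* A finite d-net P of S for the pseudo-metric given by t yields the functions
   u_p = 2 - dev_p / d, at least 1 near p and positive only where the elements of t
   vary by at most eps; truncated successively by 1, they telescope to a
   partition of the unit. *)
Lemma lattice_approx : approx_id L.
Proof.
move=> t eps eps0; pose d := eps / 2; have d0 : 0 < d by exact: divr_gt0.
have [P PP] := ev_net t d0.
have /choice[mx mxP] : forall fg : L * L, exists h, forall x,
  ev x h = Num.max (ev x fg.1) (ev x fg.2) by move=> fg; exact: ev_max.
pose dev p := foldr (fun f a => mx (mx (f - ev p f *: e, ev p f *: e - f), a)) 0 t.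
have evB x p f : ev x (f - ev p f *: e) = ev x f - ev p f.
  by rewrite linearB linearZ /= ev_unit scaleoE mulr1.
have evB' x p f : ev x (ev p f *: e - f) = ev p f - ev x f.
  by rewrite linearB linearZ /= ev_unit scaleoE mulr1.
have dev_ge p x f : f \in t -> `|ev x f - ev p f| <= ev x (dev p).
  rewrite /dev; elim: t {PP dev} => // g t IH; rewrite inE /= mxP /= le_max mxP /= evB evB'.
  move=> /orP[/eqP ->|/IH ->]; last by rewrite orbT.
  apply/orP; left; rewrite le_max; have [h|h] := lerP 0 (ev x g - ev p g).
    by rewrite ger0_norm// lexx.
  by rewrite ltr0_norm// opprB lexx orbT.
have dev_le p x : (forall f, f \in t -> `|ev x f - ev p f| <= d) -> ev x (dev p) <= d.
  rewrite /dev; elim: t {PP dev dev_ge} => [_|g t IH h] /=; first by rewrite linear0 ltW.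
  rewrite mxP /= ge_max mxP /= ge_max evB evB'.
  have := h g (mem_head _ _); rewrite ler_norml => /andP[h1 h2].
  rewrite IH ?andbT; last by move=> f ft; apply: h; rewrite inE ft orbT.
  by apply/andP; split; lra.
pose u p := 2 *: e - d^-1 *: dev p.
have uE p x : ev x (u p) = 2 - d^-1 * ev x (dev p).
  by rewrite linearB !linearZ /= ev_unit !scaleoE mulr1.
pose nxt c p := - mx (- e, - mx (c, u p)).
have nxtE c p x : ev x (nxt c p) = Num.min 1 (Num.max (ev x c) (ev x (u p))).
  by rewrite /nxt linearN mxP /= !linearN mxP /= ev_unit -oppr_min opprK.
pose go := fix go c Q := if Q is p :: Q' then
  (ev p : L -> R^o, nxt c p - c) :: go (nxt c p) Q' else [::].
have goP Q : forall c, (forall x, 0 <= ev x c <= 1) ->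
    (forall q, q \in go c Q -> exists2 p, q.1 = ev p & forall x,
       0 <= ev x q.2 /\ forall f, f \in t -> `|ev p f - ev x f| * ev x q.2 <= eps * ev x q.2) /\
    ((forall x, ev x c = 1 \/ exists2 p, p \in Q & 1 <= ev x (u p)) ->
      \sum_(q <- go c Q) q.2 = e - c).
  elim: Q => [|p Q IH] c c01 /=.
    split=> // h; rewrite big_nil; apply: ev_inj => x; rewrite linear0 linearB ev_unit /=.
    by have [->|[]] := h x; rewrite ?subrr.
  have c01' x : 0 <= ev x (nxt c p) <= 1.
    have /andP[c0 c1] := c01 x; rewrite nxtE le_min ge_min le_max c0 ler01 /=.
    by rewrite lexx.
  have [IH1 IH2] := IH _ c01'; split=> [q|h].
    rewrite inE => /orP[/eqP ->|/IH1//] /=; exists p => // x.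
    have /andP[c0 c1] := c01 x.
    have c'c : 0 <= ev x (nxt c p - c).
      by rewrite linearB /= subr_ge0 nxtE le_min c1 le_max lexx.
    split=> // f ft; have [->|nz] := eqVneq (ev x (nxt c p - c)) 0; first by rewrite !mulr0.
    rewrite ler_wpM2r// distrC; apply: le_trans (dev_ge p x f ft) _.
    (* A nonzero increment at [x] forces [u p > 0] there, that is a deviation below [2 d = eps]; for
       [u p <= 0] the truncated maximum would stay at [c]. *)
    have up : 0 < ev x (u p).
      rewrite ltNge; apply/negP => up; move/negP: nz; apply; rewrite linearB nxtE /=.
      by rewrite max_l ?(le_trans up)// min_r// subrr.
    move: up; rewrite uE subr_gt0 ltr_pdivrMl// => /ltW; rewrite /d; lra.
  rewrite big_cons IH2; first by rewrite /= addrC addrA subrK.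
  move=> x; have [xc|[p']] := h x.
    by left; rewrite nxtE xc min_l// le_max lexx.
  rewrite inE => /orP[/eqP ->|p'Q] u1; last by right; exists p'.
  by left; rewrite nxtE min_l// le_max u1 orbT.
have [|go1 go2] := goP P 0; first by move=> x; rewrite linear0 lexx ler01.
have sumE : \sum_(q <- go 0 P) q.2 = e.
  rewrite go2 ?subr0// => x; right; have [p pP pt] := PP x; exists p => //.
  have : d^-1 * ev x (dev p) <= 1 by rewrite ler_pdivrMl// mulr1 dev_le.
  by rewrite uE; lra.
exists (go 0 P).
  split=> // q /go1[p -> qp]; split; first exact: ev_state.
  by apply/ev_pos => x; have [] := qp x.
move=> f ft.
have bd x : `|ev x (frank (go 0 P) f - f)| <= eps.
  have -> : frank (go 0 P) f - f = \sum_(q <- go 0 P) (q.1 f - ev x f) *: q.2 + (ev x f *: e - f).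
    rewrite -sumE scaler_sumr addrA -big_split; congr (_ - _); apply: eq_bigr => q _ /=.
    by rewrite -scalerDl subrK.
  rewrite linearD evB' subrr addr0 linear_sum.
  apply: le_trans (ler_norm_sum _ _ _) _.
  have -> : eps = \sum_(q <- go 0 P) eps * ev x q.2.
    by rewrite -mulr_sumr -linear_sum sumE ev_unit mulr1.
  rewrite big_seq [leRHS]big_seq; apply: ler_sum => q /go1[p -> /(_ x)[q0 /(_ f ft)]].
  by rewrite linearZ normrM (ger0_norm q0).
by split; apply/ev_pos => x; have := bd x; rewrite ler_norml => /andP[h1 h2];
  rewrite ?linearB ?[ev x (_ + _)]linearD ?linearZ /= ?linearB /= in h1 h2 *;
  rewrite ev_unit scaleoE mulr1; lra.
Qed.

End LatticeApprox.

Section PMax.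
Variables (R : realType) (Z : lmodType R).
Implicit Types (s t : seq Z) (f : Z -> R^o).

(* For nonempty s; [pmax [::] f] is the junk value [f 0]. *)
Definition pmax s f : R := foldr (fun w a => Num.max (f w) a) (f (head 0 s)) s.

Lemma pmax_ge s f w : w \in s -> f w <= pmax s f.
Proof.
rewrite /pmax; move: (f (head 0 s)) => a; elim: s => // v s IH.
by rewrite inE /= le_max => /orP[/eqP ->|/IH ->]; rewrite ?lexx ?orbT.
Qed.

Lemma pmax_mem s f : s != [::] -> exists2 w, w \in s & pmax s f = f w.
Proof.
have H a r : foldr (fun w a => Num.max (f w) a) a r = a \/
    exists2 w, w \in r & foldr (fun w a => Num.max (f w) a) a r = f w.
  elim: r => [|w r IH] /=; first by left.
  case: lerP => _; last by right; exists w; rewrite ?mem_head.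
  by case: IH => [->|[v vr ->]]; [left|right; exists v; rewrite ?inE ?vr ?orbT].
case: s => // v s _; have [vE|//] := H (f v) (v :: s).
by exists v; rewrite ?mem_head.
Qed.

Lemma pmax_le s f y : s != [::] -> (forall w, w \in s -> f w <= y) -> pmax s f <= y.
Proof. by move=> s0 sy; have [w ws ->] := pmax_mem f s0; exact: sy. Qed.

Lemma pmax_eq s f y w : (forall v, v \in s -> f v <= y) ->
  w \in s -> y = f w -> pmax s f = y.
Proof.
move=> sy ws yw; apply/eqP; rewrite eq_le pmax_le//=; last by case: (s) ws.
by rewrite yw pmax_ge.
Qed.

Lemma pmax1 v f : pmax [:: v] f = f v.
Proof. by rewrite (@pmax_eq _ _ (f v) v)// ?mem_head// => w; rewrite inE => /eqP ->. Qed.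

Lemma pmax_cat s t f : s != [::] -> t != [::] ->
  pmax (s ++ t) f = Num.max (pmax s f) (pmax t f).
Proof.
move=> s0 t0; have [w ws sw] := pmax_mem f s0; have [v vt tv] := pmax_mem f t0.
have ub u : u \in s ++ t -> f u <= Num.max (pmax s f) (pmax t f).
  by rewrite mem_cat le_max => /orP[us|ut]; apply/orP; [left|right]; exact: pmax_ge.
have [st|st] := lerP (pmax s f) (pmax t f).
  apply: (@pmax_eq _ _ _ v); rewrite ?mem_cat ?vt ?orbT//.
  by move=> u /ub; rewrite max_r.
apply: (@pmax_eq _ _ _ w); rewrite ?mem_cat ?ws//.
by move=> u /ub; rewrite (max_l (ltW st)).
Qed.

Definition addpairs s t : seq Z := [seq v + w | v <- s, w <- t].

Lemma addpairs_neq0 s t : s != [::] -> t != [::] -> addpairs s t != [::].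
Proof. by case: s => // v s _; case: t. Qed.

Lemma pmaxD s t (f : {linear Z -> R^o}) : s != [::] -> t != [::] ->
  pmax (addpairs s t) f = pmax s f + pmax t f.
Proof.
move=> s0 t0; have [w ws sw] := pmax_mem f s0; have [v vt tv] := pmax_mem f t0.
apply: (@pmax_eq _ _ _ (w + v)).
- move=> _ /allpairsP[[a b] /= [sa tb ->]]; rewrite linearD.
  by apply: lerD; exact: pmax_ge.
- by apply/allpairsP; exists (w, v).
- by rewrite linearD sw tv.
Qed.

Lemma pmaxZ (a : R) s (f : {linear Z -> R^o}) : s != [::] -> 0 <= a ->
  pmax [seq a *: v | v <- s] f = a * pmax s f.
Proof.
move=> s0 a0; have [w ws sw] := pmax_mem f s0; apply: (@pmax_eq _ _ _ (a *: w)).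
- move=> _ /mapP[v vs ->]; rewrite linearZ /=.
  by rewrite ler_wpM2l// pmax_ge.
- exact: map_f.
- by rewrite linearZ sw.
Qed.

End PMax.

(** * The vector lattice generated by a function system *)

Section StateLattice.
Variables (R : realType) (Z : funSysType R).

Definition states : {pred (Z -> R^o)} := [pred f | `[< is_state f >]].
Definition stateT : Type := {f : Z -> R^o | f \in states}.
HB.instance Definition _ := [isSub for (@sval _ _ : stateT -> (Z -> R^o))].
HB.instance Definition _ := [Choice of stateT by <:].

Definition stfun (x : stateT) : Z -> R^o := val x.

Lemma stateTP (x : stateT) : is_state (stfun x).
Proof. by have /asboolP := valP x. Qed.

Lemma stfun_linear (x : stateT) : linear (stfun x).
Proof. by have [] := stateTP x. Qed.

HB.instance Definition _ (x : stateT) :=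
  GRing.isLinear.Build R Z R^o _ (stfun x) (stfun_linear x).

Definition mk_state (f : Z -> R^o) (fP : is_state f) : stateT :=
  exist _ f (asboolT fP).

(** Differences of finite maxima are closed under sums, scalars and, by [max (a - b) (c - d) = max
    (a + d) (c + b) - (b + d)], under maxima; so they are the whole vector lattice generated by [Z]
    in the functions on its states. *)
Definition lat_fun (s t : seq Z) : stateT -> R^o :=
  fun x => pmax s (stfun x) - pmax t (stfun x).

Definition latP (F : stateT -> R^o) :=
  exists s t, [/\ s != [::], t != [::] & F = lat_fun s t].

Definition lat_pred : {pred (stateT -> R^o)} := [pred F | `[< latP F >]].
Definition lattice_system : Type := {F : stateT -> R^o | F \in lat_pred}.

Lemma lat_submod : submod_closed lat_pred.
Proof.
split.
  apply/asboolP; exists [:: 0], [:: 0]; split=> //; apply/funext => x.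
  by rewrite /lat_fun subrr.
move=> a F G /asboolP[s [t [s0 t0 ->]]] /asboolP[s' [t' [s'0 t'0 ->]]]; apply/asboolP.
have [a0|a0] := lerP 0 a.
  exists (addpairs [seq a *: v | v <- s] s'), (addpairs [seq a *: v | v <- t] t').
  have as0 : [seq a *: v | v <- s] != [::] by rewrite -size_eq0 size_map size_eq0.
  have at0 : [seq a *: v | v <- t] != [::] by rewrite -size_eq0 size_map size_eq0.
  split; rewrite ?addpairs_neq0//; apply/funext => x.
  rewrite /lat_fun !pmaxD// !pmaxZ// opprD addrACA -mulrBr.
  by [].
have {}a0 : 0 <= - a by rewrite oppr_ge0 ltW.
exists (addpairs [seq - a *: v | v <- t] s'), (addpairs [seq - a *: v | v <- s] t').
have as0 : [seq - a *: v | v <- s] != [::] by rewrite -size_eq0 size_map size_eq0.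
have at0 : [seq - a *: v | v <- t] != [::] by rewrite -size_eq0 size_map size_eq0.
split; rewrite ?addpairs_neq0//; apply/funext => x.
rewrite /lat_fun !pmaxD// !pmaxZ// opprD addrACA -mulrBr mulNr -mulrN opprB.
by [].
Qed.

HB.instance Definition _ :=
  GRing.isSubmodClosed.Build R (stateT -> R^o) lat_pred lat_submod.
HB.instance Definition _ := [isSub for (@sval _ _ : lattice_system -> (stateT -> R^o))].
HB.instance Definition _ := [Choice of lattice_system by <:].
HB.instance Definition _ := [SubChoice_isSubLmodule of lattice_system by <:].

Definition mk_lat (s t : seq Z) (s0 : s != [::]) (t0 : t != [::]) : lattice_system :=
  exist _ (lat_fun s t) (asboolT (ex_intro _ s (ex_intro _ t (And3 s0 t0 erefl)))).

Definition lev (x : stateT) (F : lattice_system) : R^o := val F x.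

Lemma lev_linear x : linear (lev x).
Proof. by []. Qed.

HB.instance Definition _ x :=
  GRing.isLinear.Build R lattice_system R^o _ (lev x) (lev_linear x).

Definition lat_pos : set lattice_system := [set F | forall x, 0 <= lev x F].
Definition lat_unit : lattice_system :=
  @mk_lat [:: fs_unit Z] [:: 0] isT isT.

Lemma lev_unit x : lev x lat_unit = 1.
Proof.
rewrite -[LHS]/(lat_fun _ _ x) /lat_fun !pmax1 linear0 subr0.
by have [] := stateTP x.
Qed.

Lemma lev_inj F G : (forall x, lev x F = lev x G) -> F = G.
Proof. by move=> h; apply/val_inj/funext. Qed.

Lemma latD F G : lat_pos F -> lat_pos G -> lat_pos (F + G).
Proof. by move=> Fp Gp x; rewrite linearD addr_ge0 ?Fp ?Gp. Qed.

Lemma latZ (a : R) F : 0 <= a -> lat_pos F -> lat_pos (a *: F).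
Proof. by move=> a0 Fp x; rewrite linearZ mulr_ge0 ?Fp. Qed.

Lemma latN F : lat_pos F /\ lat_pos (- F) <-> F = 0.
Proof.
split=> [[Fp Fn]|->]; last by rewrite oppr0; split=> x; rewrite linear0.
apply: lev_inj => x; apply/eqP; rewrite linear0 eq_le Fp andbT -oppr_ge0.
by have := Fn x; rewrite linearN.
Qed.

Lemma state_bound (v : Z) : exists2 r, 0 < r & forall x : stateT, - r <= stfun x v <= r.
Proof.
have [r r0 [rp rn]] := fs_abs_unit v; exists r => // x.
have [_ xp x1] := stateTP x; have := xp _ rp; have := xp _ rn.
rewrite !linearD linearN !linearZ /= x1 scaleoE mulr1 => ? ?.
by apply/andP; split; lra.
Qed.

Lemma pmax_bound (s : seq Z) : s != [::] ->
  exists2 r, 0 < r & forall x : stateT, - r <= pmax s (stfun x) <= r.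
Proof.
move=> s0; have /choice[r rP] : forall v : Z, exists r : R,
    0 < r /\ forall x : stateT, - r <= stfun x v <= r.
  by move=> v; have [r r0 h] := state_bound v; exists r.
have rge0 v : 0 <= r v by have [/ltW] := rP v.
exists (\sum_(v <- s) r v + 1); first by rewrite ltr_wpDl// sumr_ge0.
move=> x; have [w ws ->] := pmax_mem (stfun x) s0.
have [_ /(_ x)/andP[w1 w2]] := rP w.
have : r w <= \sum_(v <- s) r v by rewrite (big_rem w)//= lerDl sumr_ge0.
by move=> ?; apply/andP; split; lra.
Qed.

Lemma lat_order_unit F : exists2 r : R, 0 < r & lat_pos (r *: lat_unit - F).
Proof.
have /asboolP[s [t [s0 t0 FE]]] := valP F.
have [r r0 rs] := pmax_bound s0; have [r' r'0 rt] := pmax_bound t0.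
exists (r + r'); first exact: addr_gt0.
move=> x; rewrite linearB linearZ /= lev_unit scaleoE mulr1.
have -> : lev x F = lat_fun s t x by rewrite -FE.
by have /andP[? ?] := rs x; have /andP[? ?] := rt x; rewrite /lat_fun; lra.
Qed.

Lemma lat_archimedean F :
  (forall eps : R, 0 < eps -> lat_pos (eps *: lat_unit + F)) -> lat_pos F.
Proof.
move=> h x; apply/ler_addgt0Pr => eps eps0; have := h eps eps0 x.
by rewrite linearD linearZ /= lev_unit scaleoE mulr1 addrC.
Qed.

HB.instance Definition _ := isFunctionSystem.Build R lattice_system
  latD latZ latN lat_order_unit lat_archimedean.

Lemma lat_max (F G : lattice_system) : exists H : lattice_system, forall x,
  lev x H = Num.max (lev x F) (lev x G).
Proof.
have /asboolP[s [t [s0 t0 FE]]] := valP F.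
have /asboolP[s' [t' [s'0 t'0 GE]]] := valP G.
have n1 : addpairs s t' ++ addpairs s' t != [::].
  by rewrite -size_eq0 size_cat addn_eq0 negb_and !size_eq0 addpairs_neq0.
exists (mk_lat n1 (addpairs_neq0 t0 t'0)) => x.
have -> : lev x F = lat_fun s t x by rewrite -FE.
have -> : lev x G = lat_fun s' t' x by rewrite -GE.
rewrite -[LHS]/(lat_fun _ _ x) /lat_fun pmax_cat ?addpairs_neq0// !pmaxD//.
pose m u := pmax u (stfun x).
change (Num.max (m s + m t') (m s' + m t) - (m t + m t') = Num.max (m s - m t) (m s' - m t')).
have [?|?] := lerP (m s + m t') (m s' + m t);
  by have [?|?] := lerP (m s - m t) (m s' - m t'); lra.
Qed.

Lemma lattice_system_approx : approx_id lattice_system.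
Proof. by apply: (@lattice_approx R lattice_system stateT lev) => //; [exact: lev_unit|exact: lat_max]. Qed.

Definition lat_incl (v : Z) : lattice_system := @mk_lat [:: v] [:: 0] isT isT.

Lemma lev_incl x v : lev x (lat_incl v) = stfun x v.
Proof. by rewrite -[LHS]/(lat_fun _ _ x) /lat_fun !pmax1 linear0 subr0. Qed.

Lemma lat_incl_linear : linear lat_incl.
Proof.
by move=> a v w; apply: lev_inj => x; rewrite lev_incl !linearP /= !lev_incl.
Qed.

HB.instance Definition _ := GRing.isLinear.Build R Z lattice_system _ lat_incl lat_incl_linear.

Lemma lat_incl_inclusion : fs_inclusion lat_incl.
Proof.
split; first by [].
move=> v; split=> [vp x|h]; first by rewrite lev_incl; have [_ h _] := stateTP x; exact: h.
apply: states_positive => f fs; have := h (mk_state fs).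
by rewrite lev_incl.
Qed.

End StateLattice.

(** * The compact space of states and Kadison's representation *)

Section RealContinuous.
Variables (R : realType) (T : topologicalType).
Implicit Types f g : T -> R^o.

Lemma cont_add f g : continuous f -> continuous g -> continuous (fun x => f x + g x : R^o).
Proof. by move=> cf cg x; apply: (@cvgD _ R^o); [exact: cf|exact: cg]. Qed.

Lemma cont_sub f g : continuous f -> continuous g -> continuous (fun x => f x - g x : R^o).
Proof. by move=> cf cg x; apply: (@cvgB _ R^o); [exact: cf|exact: cg]. Qed.

Lemma cont_scale (a : R) f : continuous f -> continuous (fun x => a * f x : R^o).
Proof. by move=> cf x; apply: cvgM; [exact: cvg_cst|exact: cf]. Qed.

Lemma cont_max f g : continuous f -> continuous g ->
  continuous (fun x => Num.max (f x) (g x) : R^o).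
Proof. by move=> cf cg x; apply: continuous_max; [exact: cf|exact: cg]. Qed.

End RealContinuous.

Section StateCompact.
Variables (R : realType) (Z : funSysType R).

Lemma value_continuous (v : Z) : continuous (fun f : functions_on Z => f v : R^o).
Proof. exact: (@proj_continuous Z (fun=> R^o) v). Qed.

Lemma state_space_closed : closed (@state_space R Z).
Proof.
have -> : @state_space R Z = 
    (\bigcap_(p in [set: R * Z * Z]) (fun f : functions_on Z =>
        f (p.1.1 *: p.1.2 + p.2) - (p.1.1 * f p.1.2 + f p.2) : R^o) @^-1` [set 0]) `&`
    (\bigcap_(v in fs_pos Z) (fun f : functions_on Z => f v : R^o) @^-1` [set x : R | 0 <= x]) `&`
    ((fun f : functions_on Z => f (fs_unit Z) : R^o) @^-1` [set 1]).
  apply/seteqP; split=> f.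
    move=> [fl fp f1]; split=> //; split=> // -[[a v] w] _ /=.
    by rewrite fl subrr.
  move=> [[fl fp] f1]; split=> // a v w.
  by apply/eqP; rewrite -subr_eq0; apply/eqP; exact: (fl (a, v, w) I).
apply: closedI; first apply: closedI.
- apply: closed_bigI => -[[a v] w] _ /=; apply: preimage_closed => [f _|]; last exact: closed_eq.
  apply: cont_sub; first exact: value_continuous.
  apply: cont_add; last exact: value_continuous.
  by apply: cont_scale; exact: value_continuous.
- apply: closed_bigI => v _; apply: preimage_closed; last exact: closed_ge.
  by move=> f _; exact: value_continuous.
- by apply: preimage_closed => [f _|]; [exact: value_continuous|exact: closed_eq].
Qed.

(** Banach-Alaoglu: an order bound for each [v] places the states in a product of segments. *)
Lemma state_space_compact : compact (@state_space R Z).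
Proof.
have /choice[r rP] : forall v : Z, exists r : R,
    0 < r /\ forall x : stateT Z, - r <= stfun x v <= r.
  by move=> v; have [r r0 h] := state_bound v; exists r.
apply: (@subclosed_compact _ _ [set f : functions_on Z | forall v, `[- r v, r v]%classic (f v)]).
- exact: state_space_closed.
- apply: (@tychonoff Z (fun=> R^o : topologicalType) (fun v => `[- r v, r v]%classic)) => v.
  exact: segment_compact.
- by move=> f fs v; have [_ /(_ (mk_state fs))] := rP v; rewrite /= in_itv.
Qed.

End StateCompact.

Section StateTopology.
Variables (R : realType) (Z : funSysType R).

HB.instance Definition _ := Topological.copy (stateT Z)
  (initial_topology (fun x : stateT Z => stfun x : functions_on Z)).

Lemma stfun_continuous : continuous (fun x : stateT Z => stfun x : functions_on Z).
Proof. exact: initial_continuous. Qed.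

Lemma stateT_compact : compact [set: stateT Z].
Proof.
move=> F FF _; pose i (x : stateT Z) : functions_on Z := stfun x.
have Fi : ProperFilter (i @ F) by exact: fmap_proper_filter.
have [|f [fs fc]] := @state_space_compact R Z (i @ F) Fi.
  have h : [set: stateT Z] `<=` i @^-1` (@state_space R Z) by move=> x _; exact: stateTP.
  exact: (filterS h filterT).
exists (mk_state fs); split=> // A B FA [_ [[U Uo <-] Ux] UB].
have [|_ [[x Ax <-] Ux']] := fc (i @` A) U _ (open_nbhs_nbhs (conj Uo Ux)).
  have h : A `<=` i @^-1` (i @` A) by move=> x Ax; exists x.
  exact: (filterS h FA).
by exists x; split=> //; apply: UB.
Qed.

Lemma stateT_eval_continuous (v : Z) : continuous (fun x : stateT Z => stfun x v : R^o).
Proof.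
move=> x; apply: (@continuous_comp (stateT Z) (functions_on Z) R^o
  (fun x : stateT Z => stfun x : functions_on Z) (fun f : functions_on Z => f v)).
  exact: stfun_continuous.
exact: value_continuous.
Qed.

Lemma stateT_hausdorff : hausdorff_space (stateT Z).
Proof.
move=> p q pq; apply/val_inj/funext => v.
pose h (x : stateT Z) : R^o := stfun x v.
have hc : continuous h.
  exact: stateT_eval_continuous.
apply: (@Rhausdorff R) => A B pA qB.
by have [x [xA xB]] := pq _ _ (hc p A pA) (hc q B qB); exists (h x).
Qed.

HB.instance Definition _ := isCompactHausdorff.Build (stateT Z)
  stateT_compact stateT_hausdorff.

Lemma gelfand_in (v : Z) : (fun x : stateT Z => stfun x v : R^o) \in @continuous_functions R (stateT Z).
Proof. by apply/asboolP; exact: stateT_eval_continuous. Qed.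

Definition gelfand (v : Z) : cfun R (stateT Z) :=
  exist _ (fun x : stateT Z => stfun x v : R^o) (gelfand_in v).

Lemma gelfand_linear : linear gelfand.
Proof.
move=> a v w; apply/val_inj/funext => x.
by change (stfun x (a *: v + w) = a *: stfun x v + stfun x w); exact: linearP.
Qed.

HB.instance Definition _ :=
  GRing.isLinear.Build R Z (cfun R (stateT Z)) _ gelfand gelfand_linear.

(** Kadison's representation. Applied to V**, it supplies a concrete C(K) on which the retraction
    condition can be tested. *)
Lemma gelfand_inclusion : fs_inclusion gelfand.
Proof.
split; first by apply/val_inj/funext => x; have [_ _] := stateTP x.
move=> v; split=> [vp x|h]; first by have [_ h _] := stateTP x; exact: h.
by apply: states_positive => f fs; exact: (h (mk_state fs)).
Qed.

End StateTopology.

Section CfunApprox.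
Variables (R : realType) (K : compactHausdorffType).

Definition cfun_ev (x : K) (f : cfun R K) : R^o := val f x.

Lemma cfun_ev_linear x : linear (cfun_ev x).
Proof. by []. Qed.

HB.instance Definition _ x :=
  GRing.isLinear.Build R (cfun R K) R^o _ (cfun_ev x) (cfun_ev_linear x).

Lemma cfun_approx : approx_id (cfun R K).
Proof.
apply: (@lattice_approx R (cfun R K) K cfun_ev) => // f g.
have /asboolP cf := valP f; have /asboolP cg := valP g.
have h : (fun x => Num.max (val f x) (val g x) : R^o) \in @continuous_functions R K.
  by apply/asboolP; exact: cont_max.
by exists (exist _ (fun x => Num.max (val f x) (val g x) : R^o) h).
Qed.

End CfunApprox.

(** * From injectivity of the bidual to approximation *)

Section Implications.
Variables (R : realType) (V : funSysType R).

(** States of [L] are restricted along [i] and elements of [L] pushed through [Phi], so a partition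
    for [L] becomes one for V with elements in V**. The order bound on the error survives [Phi], and
    the constants [C] turn it into a bound on values. *)
Lemma bidual_projection_weak (L : funSysType R) (i : {linear V -> L})
    (Phi : {linear L -> bidual V}) : approx_id L -> unital_positive i ->
  unital_positive Phi -> (forall v, Phi (i v) = bidual_incl v) -> weak_approx V.
Proof.
move=> Lap [i1 ip] [Phi1 Phip] PhiE t d d0.
have /choice[C CP] : forall f : fs_dual V, exists C : R, 0 <= C /\
    forall (r : R) (F : bidual V), 0 <= r ->
     bidual_pos (r *: fs_unit (bidual V) + F : bidual V) ->
     bidual_pos (r *: fs_unit (bidual V) - F : bidual V) -> `|F f| <= C * r.
  by move=> f; have [C C0 h] := bidual_bound f; exists C.
pose M := \sum_(p <- t) C p.2.
have M0 : 0 <= M by rewrite sumr_ge0// => p _; have [] := CP p.2.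
have M1 : 0 < M + 1 by rewrite ltr_wpDl.
have [s [sp s1] st] := Lap [seq i p.1 | p <- t] (d / (M + 1)) (divr_gt0 d0 M1).
pose s' := [seq ((fun v => q.1 (i v) : R^o), Phi q.2 : bidual V) | q <- s].
have s'E v : frank s' v = Phi (frank s (i v)).
  by rewrite /frank big_map linear_sum; apply: eq_bigr => q _; rewrite linearZ.
exists s'.
  split; last by rewrite big_map /= -linear_sum s1 Phi1.
  move=> _ /mapP[q /sp[[ql qp q1] q2] ->]; split=> /=; last exact: Phip.
  split=> [a v w|v vp|]; first by rewrite linearP ql.
    exact/qp/ip.
  by rewrite i1.
apply: le_trans (ler_norm_sum _ _ _) _.
apply: (@le_trans _ _ (\sum_(p <- t) C p.2 * (d / (M + 1)))); last first.
  rewrite -mulr_suml -/M mulrA ler_pdivrMr// mulrC ler_pM2l// lerDl.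
  by [].
rewrite big_seq [leRHS]big_seq; apply: ler_sum => p pt.
have [fp fn] := st (i p.1) (map_f (fun p => i p.1) pt).
case: p pt fp fn => v f /= pt fp fn.
change (`|(frank s' v - bidual_incl v : bidual V) f| <= C f * (d / (M + 1))).
have [C0 Cb] := CP f; apply: Cb; first by rewrite divr_ge0// ltW.
  have := Phip _ fp; rewrite linearD linearZ /= linearB Phi1 PhiE -s'E.
  by [].
have := Phip _ fn; rewrite !linearB linearZ /= Phi1 PhiE -s'E.
by [].
Qed.

Definition cfun_retract := forall (K : compactHausdorffType) (j : {linear bidual V -> cfun R K}),
     fs_inclusion j ->
     exists2 Phi : {linear cfun R K -> bidual V},
       unital_positive Phi & forall v, Phi (j (bidual_incl v)) = bidual_incl v.

Lemma inclusion_up (V1 V2 : funSysType R) (i : {linear V1 -> V2}) :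
  fs_inclusion i -> unital_positive i.
Proof. by move=> [i1 ip]; split=> // v; exact: (ip v).1. Qed.

Lemma cfun_retract_weak : cfun_retract -> weak_approx V.
Proof.
move=> h; have gi := gelfand_inclusion (bidual V).
have [Phi Phip PhiE] := h _ (@gelfand R (bidual V)) gi.
apply: (bidual_projection_weak (i := @gelfand R (bidual V) \o @bidual_incl R V) _ _ Phip PhiE).
  exact: cfun_approx.
exact: unital_positive_comp (inclusion_up gi) (incl_unital_positive V).
Qed.

Lemma injective_cfun_retract : injective_fs (bidual V) -> cfun_retract.
Proof.
move=> inj K j ji; have [|Phi Phip PhiE] := inj _ _ j ji idfun; first by split.
by exists Phi => // v; rewrite PhiE.
Qed.

(** Extending the identity over [lattice_system] makes V** a unital positive retract of an
    approximable system, and such retracts inherit approximability. *)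
Lemma injective_bidual_approx : injective_fs (bidual V) -> approx_id (bidual V).
Proof.
move=> inj; have li := lat_incl_inclusion (bidual V).
have [|Phi [Phi1 Phip] PhiE] := inj _ _ _ li idfun; first by split.
move=> t eps eps0.
have [s [sp s1] st] := lattice_system_approx [seq lat_incl F | F <- t] eps0.
pose s' := [seq ((fun F => q.1 (lat_incl F) : R^o), Phi q.2 : bidual V) | q <- s].
have s'E v : frank s' v = Phi (frank s (lat_incl v)).
  by rewrite /frank big_map linear_sum; apply: eq_bigr => q _; rewrite linearZ.
exists s'.
  split; last by rewrite big_map /= -linear_sum s1 Phi1.
  move=> _ /mapP[q /sp[[ql qp q1] q2] ->]; split=> /=; last exact: Phip.
  have [li1 lip] := inclusion_up li.
  split=> [a v w|v vp|]; first by rewrite linearP ql.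
    exact/qp/lip.
  by rewrite li1.
move=> F Ft; have [fp fn] := st (lat_incl F) (map_f _ Ft).
have E : Phi (frank s (lat_incl F) - lat_incl F) = frank s' F - F.
  by rewrite linearB PhiE s'E.
split; [have := Phip _ fp|have := Phip _ fn].
  by rewrite linearD linearZ /= Phi1 E.
by rewrite linearB linearZ /= Phi1 E.
Qed.

End Implications.

(** * The square and the Riesz decomposition property *)

Section TensorEmbeddings.
Variables (R : realType).
Implicit Types V W E : funSysType R.

Lemma min_cone_functorial V V' W W' (i : {linear V -> V'}) (j : {linear W -> W'}) z :
  unital_positive i -> unital_positive j -> min_cone V W z ->
  min_cone V' W' (tens_map i j z).
Proof.
move=> [i1 ip] [j1 jp]; have [t ->] := tensor_sum z => zp f g fs gs.
have st (U U' : funSysType R) (k : {linear U -> U'}) (h : U' -> R^o) : unital_map k -> positive_map k -> is_state h ->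
    is_state (fun u => h (k u)).
  move=> k1 kp [hl hp h1]; split=> [a v w|v vp|]; first by rewrite linearP hl.
    exact/hp/kp.
  by rewrite k1.
have := zp _ _ (st _ _ i f i1 ip fs) (st _ _ j g j1 jp gs).
rewrite tens_lift_sum; last by apply: state_bilinear; exact: st.
rewrite linear_sum (eq_bigr (fun p => i p.1 ⊗ j p.2)); last by move=> p _; exact: tens_map_tens.
by rewrite tens_lift_sum//; exact: state_bilinear.
Qed.

Lemma max_cone_functorial V V' W W' (i : {linear V -> V'}) (j : {linear W -> W'}) z :
  unital_positive i -> unital_positive j -> max_cone V W z ->
  max_cone V' W' (tens_map i j z).
Proof.
move=> [i1 ip] [j1 jp] zp eps eps0; have [s [sp sE]] := zp eps eps0.
exists [seq (i p.1, j p.2) | p <- s]; split.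
  by move=> _ /mapP[p /sp[p1 p2] ->]; split; [exact: ip|exact: jp].
rewrite -i1 -j1 -tens_map_tens -linearZ -linearD sE linear_sum big_map.
by apply: eq_bigr => p _; exact: tens_map_tens.
Qed.

Lemma min_cone_inclusion V V' W W' (i : {linear V -> V'}) (j : {linear W -> W'}) z :
  fs_inclusion i -> fs_inclusion j -> min_cone V' W' (tens_map i j z) -> min_cone V W z.
Proof.
move=> ii jj; have [t ->] := tensor_sum z => zp f g fs gs.
have [F Fs FE] := state_extension ii fs; have [G Gs GE] := state_extension jj gs.
have := zp F G Fs Gs.
rewrite linear_sum (eq_bigr (fun p => i p.1 ⊗ j p.2)); last by move=> p _; exact: tens_map_tens.
rewrite tens_lift_sum; last exact: state_bilinear.
rewrite tens_lift_sum; last exact: state_bilinear.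
by congr (0 <= _); apply: eq_bigr => p _; rewrite FE GE.
Qed.

Lemma idfun_inclusion W : @fs_inclusion R W W idfun.
Proof. by split. Qed.

Lemma max_embedding V V' W W' (i : {linear V -> V'}) (j : {linear W -> W'}) :
  min_cone V W = max_cone V W -> fs_inclusion i -> fs_inclusion j ->
  order_embedding (max_cone V W) (max_cone V' W') (tens_map i j).
Proof.
move=> VW ii jj z; split.
  by apply: max_cone_functorial; exact: inclusion_up.
by move=> /max_min zp; rewrite -VW; exact: min_cone_inclusion zp.
Qed.

(** Min-positivity passes to [L], where it is max-positivity, and the embedding brings it back. With
    an approximable [L] this turns a condition on embeddings into equality of the two cones for V
    itself. *)
Lemma embedding_min_max V E (L : funSysType R) (i : {linear V -> L}) : fs_inclusion i ->
  min_cone L E = max_cone L E ->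
  order_embedding (max_cone V E) (max_cone L E) (tens_map i idfun) ->
  min_cone V E = max_cone V E.
Proof.
move=> ii LE emb; apply/seteqP; split=> z; last exact: max_min.
move=> zp; apply/emb; rewrite -LE; apply: min_cone_functorial zp; apply: inclusion_up => //.
Qed.

End TensorEmbeddings.

Section Square.
Variable R : realType.

(* The affine functions on a square, given by their values at three vertices;
   the value at the fourth vertex is c_2 + c_3 - c_1. *)
Definition square : Type := (R^o * R^o * R^o)%type.
HB.instance Definition _ := GRing.Lmodule.on square.

Definition sq_row (c : square) : linfty R 4 :=
  \row_(k < 4) nth 0 [:: c.1.1; c.1.2; c.2; c.1.2 + c.2 - c.1.1] k.

Lemma sq_row_linear : linear sq_row.
Proof.
move=> a c d; apply/rowP => -[[|[|[|[|//]]]] k]; rewrite !mxE //=.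
by rewrite !scaleoE mulrBr mulrDr; lra.
Qed.

HB.instance Definition _ := GRing.isLinear.Build R square (linfty R 4) _ sq_row sq_row_linear.

Definition sq_unit : square := (1, 1, 1).

Lemma sq_row_unit : sq_row sq_unit = fs_unit (linfty R 4).
Proof. by apply/rowP => -[[|[|[|[|//]]]] k]; rewrite !mxE //=; lra. Qed.

Definition sq_pos : set square := [set c | fs_pos _ (sq_row c)].

Lemma sq_posD c d : sq_pos c -> sq_pos d -> sq_pos (c + d).
Proof. by rewrite /sq_pos /= linearD; exact: fs_posD. Qed.

Lemma sq_posZ (a : R) c : 0 <= a -> sq_pos c -> sq_pos (a *: c).
Proof. by rewrite /sq_pos /= linearZ; exact: fs_posZ. Qed.

Lemma sq_posN c : sq_pos c /\ sq_pos (- c) <-> c = 0.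
Proof.
split=> [|->]; last by rewrite oppr0 /sq_pos /= linear0; split; exact: fs_pos0.
rewrite /sq_pos /= linearN => /fs_posN/rowP h.
have := h (Ordinal (isT : (2 < 4)%N)); have := h (Ordinal (isT : (1 < 4)%N)).
have := h (Ordinal (isT : (0 < 4)%N)); rewrite !mxE /=.
by case: c {h} => [[x y] z] /= -> -> ->.
Qed.

Lemma sq_order_unit c : exists2 r : R, 0 < r & sq_pos (r *: sq_unit - c).
Proof.
have [r r0 h] := fs_order_unit (sq_row c); exists r => //.
by move: h; rewrite -sq_row_unit -linearZ -linearB.
Qed.

Lemma sq_archimedean c :
  (forall eps : R, 0 < eps -> sq_pos (eps *: sq_unit + c)) -> sq_pos c.
Proof.
move=> h; apply: fs_archimedean => eps /h.
by rewrite -sq_row_unit -linearZ -linearD.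
Qed.

HB.instance Definition _ := isFunctionSystem.Build R square
  sq_posD sq_posZ sq_posN sq_order_unit sq_archimedean.

Lemma sq_row_inclusion : fs_inclusion sq_row.
Proof. by split; first exact: sq_row_unit. Qed.

Definition sq_basis (i : 'I_3) : square :=
  nth 0 [:: (1, 0, 0); (0, 1, 0); (0, 0, 1)] i.

Lemma sq_sum (c : square) : c = c.1.1 *: (1, 0, 0) + c.1.2 *: (0, 1, 0) + c.2 *: (0, 0, 1).
Proof.
case: c => [[x y] z]; congr (_, _, _); rewrite /= ?scaleoE; lra.
Qed.

Lemma sq_fin_dim : fin_dim square.
Proof.
exists 3%N, sq_basis => c; exists (fun i => nth 0 [:: c.1.1; c.1.2; c.2] i).
by rewrite !big_ord_recr big_ord0 /= add0r -sq_sum.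
Qed.

Lemma sq_posE (c : square) : fs_pos _ c <->
  [/\ 0 <= c.1.1, 0 <= c.1.2, 0 <= c.2 & 0 <= c.1.2 + c.2 - c.1.1].
Proof.
split=> [h|[h0 h1 h2 h3]]; last by move=> -[[|[|[|[|//]]]] k]; rewrite mxE.
have := h (Ordinal (isT : (3 < 4)%N)).
have := h (Ordinal (isT : (2 < 4)%N)); have := h (Ordinal (isT : (1 < 4)%N)).
by have := h (Ordinal (isT : (0 < 4)%N)); rewrite !mxE.
Qed.

End Square.

Section RieszInequality.
Variables (R : realType) (V : funSysType R).
Local Notation pos := (fs_pos V).

(* By Hahn-Banach this inequality amounts to the Riesz decomposition property
   of the cone of V*. *)
Definition riesz_ineq := forall x1 x2 y1 y2 : fs_dual V,
  dual_pos x1 -> dual_pos x2 -> dual_pos y1 -> dual_pos y2 -> x1 + x2 = y1 + y2 ->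
  forall a1 a2 b1 b2 : V, pos (a1 + b1) -> pos (a1 + b2) -> pos (a2 + b1) -> pos (a2 + b2) ->
  0 <= x1 a1 + x2 a2 + y1 b1 + y2 b2.

(** The V-valued affine function on the square with vertex values [a1 + b1], [a1 + b2], [a2 + b1];
    its fourth value is then [a2 + b2], so the hypotheses of [riesz_ineq] are positivity at the
    vertices. *)
Definition sq_tensor (a1 a2 b1 b2 : V) : tensor V (square R) :=
  (a1 + b1) ⊗ ((1, 0, 0) : square R) + (a1 + b2) ⊗ ((0, 1, 0) : square R) +
  (a2 + b1) ⊗ ((0, 0, 1) : square R).

(** At [sq_tensor] the form gives [x2 (a2 - a1) + y1 (a1 + b1) + y2 (a1 + b2)], which is the
    expression in [riesz_ineq] as soon as [x1 + x2 = y1 + y2]. *)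
Definition sq_form (x2 y1 y2 : fs_dual V) (v : V) (c : square R) : R^o :=
  (c.2 - c.1.1) * x2 v + c.1.1 * y1 v + c.1.2 * y2 v.

Lemma sq_form_bilinear x2 y1 y2 : bilinear_map (sq_form x2 y1 y2).
Proof.
split=> [c a v w|v a c d]; rewrite /sq_form /= ?linearP /= !scaleoE; lra.
Qed.

Lemma sq_tensor_riesz : (forall a1 a2 b1 b2 : V, pos (a1 + b1) -> pos (a1 + b2) ->
    pos (a2 + b1) -> pos (a2 + b2) -> max_cone V (square R) (sq_tensor a1 a2 b1 b2)) ->
  riesz_ineq.
Proof.
move=> H x1 x2 y1 y2 x1p x2p y1p y2p xy a1 a2 b1 b2 p11 p12 p21 p22.
have xyE v : x1 v + x2 v = y1 v + y2 v.
  by rewrite -[LHS]/((x1 + x2 : fs_dual V) v) xy.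
have BB := sq_form_bilinear x2 y1 y2.
have Bp v (c : square R) : pos v -> fs_pos _ c -> 0 <= sq_form x2 y1 y2 v c.
  move=> vp /sq_posE[c1 c2 c3 c4].
  have := x1p v vp; have := x2p v vp; have := y1p v vp; have := y2p v vp; have := xyE v.
  case: c c1 c2 c3 c4 => [[p q] r] /= p0 q0 r0 qr.
  rewrite /sq_form /=.
  move: (x1 v) (x2 v) (y1 v) (y2 v) => A B C D ABCD D0 C0 B0 A0.
  have [pr|pr] := lerP p r.
    by rewrite !addr_ge0// mulr_ge0// subr_ge0.
  (* For [r < p] the coefficient of [x2] is negative; [x2 = y1 + y2 - x1] trades it for a positive
     multiple of [x1], and [y2] is left with the value of [c] at the fourth vertex. *)
  have -> : (r - p) * B + p * C + q * D = (p - r) * A + r * C + (q - (p - r)) * D by nra.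
  by rewrite !addr_ge0// mulr_ge0//; lra.
have := max_cone_ge0 BB Bp (H a1 a2 b1 b2 p11 p12 p21 p22).
rewrite /sq_tensor !tens_liftD// !tens_lift_tens// /sq_form /= !linearD /=.
have := xyE a1; have := xyE a2; have := xyE b1; have := xyE b2; lra.
Qed.

Lemma sq_tensor_min (a1 a2 b1 b2 : V) : pos (a1 + b1) -> pos (a1 + b2) ->
    pos (a2 + b1) -> pos (a2 + b2) -> min_cone V (square R) (sq_tensor a1 a2 b1 b2).
Proof.
move=> p11 p12 p21 p22 f g fs gs; have BB := state_bilinear fs gs.
rewrite /sq_tensor !tens_liftD// !tens_lift_tens//.
have [fl fp _] := fs; have [gl gp _] := gs.
pose fL := mk_linear fl.
pose gL := mk_linear gl.
have := gp (f (a1 + b1), f (a1 + b2), f (a2 + b1)).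
rewrite [X in g X]sq_sum -[g]/(gL : _ -> _) !linearD !linearZ /= => h; apply: h.
apply/sq_posE; split=> /=; try exact: fp.
rewrite -[f]/(fL : _ -> _) -linearD -linearB.
have -> : a1 + b2 + (a2 + b1) - (a1 + b1) = a2 + b2.
  by rewrite addrACA [b2 + b1]addrC addrACA [X in X - _]addrC addrK.
exact: fp.
Qed.

(** In R^4 the tensor is the sum of its four vertex values against the unit vectors, hence visibly
    positive; an embedding of max tensor products brings this positivity back to the square. *)
Lemma sq_tensor_row (a1 a2 b1 b2 : V) : pos (a1 + b1) -> pos (a1 + b2) ->
    pos (a2 + b1) -> pos (a2 + b2) ->
  max_cone V (linfty R 4) (tens_map idfun (@sq_row R) (sq_tensor a1 a2 b1 b2)).
Proof.
move=> p11 p12 p21 p22; apply: alg_max.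
pose dl (i : nat) (h : (i < 4)%N) : linfty R 4 := delta_mx 0 (Ordinal h).
have dlp i h : fs_pos _ (@dl i h) by move=> k; rewrite mxE; case: (_ && _).
have E1 : sq_row ((1, 0, 0) : square R) = @dl 0 isT - @dl 3 isT.
  by apply/rowP => -[[|[|[|[|//]]]] k]; rewrite !mxE /= ?(subr0, add0r, addr0).
have E2 : sq_row ((0, 1, 0) : square R) = @dl 1 isT + @dl 3 isT.
  by apply/rowP => -[[|[|[|[|//]]]] k]; rewrite !mxE /= ?(subr0, add0r, addr0).
have E3 : sq_row ((0, 0, 1) : square R) = @dl 2 isT + @dl 3 isT.
  by apply/rowP => -[[|[|[|[|//]]]] k]; rewrite !mxE /= ?(subr0, add0r, addr0).
have -> : tens_map idfun (@sq_row R) (sq_tensor a1 a2 b1 b2) =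
    (a1 + b1) ⊗ @dl 0 isT + (a1 + b2) ⊗ @dl 1 isT + (a2 + b1) ⊗ @dl 2 isT +
    (a2 + b2) ⊗ @dl 3 isT.
  transitivity ((a1 + b1) ⊗ sq_row ((1, 0, 0) : square R) +
    (a1 + b2) ⊗ sq_row ((0, 1, 0) : square R) + (a2 + b1) ⊗ sq_row ((0, 0, 1) : square R)).
    by rewrite /sq_tensor !linearD; congr (_ + _ + _); exact: tens_map_tens.
  rewrite E1 E2 E3 !tensDr tensNr.
  have -> : a2 + b2 = a1 + b2 + (a2 + b1) - (a1 + b1).
    by rewrite addrACA [b2 + b1]addrC addrACA [X in X - _]addrC addrK.
  rewrite [(_ - _) ⊗ _]tensDl [(a1 + b2 + _) ⊗ _]tensDl tensNl.
  set x := (a1 + b1) ⊗ _; set x' := (a1 + b1) ⊗ _.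
  set y := (a1 + b2) ⊗ _; set y' := (a1 + b2) ⊗ _.
  set z := (a2 + b1) ⊗ _; set z' := (a2 + b1) ⊗ _.
  rewrite [x - x' + _]addrACA [X in X = _]addrACA; congr (_ + _).
  by rewrite [- x' + y']addrC addrAC.
by repeat apply: alg_coneD; exact: alg_cone_tens.
Qed.

Lemma embedding_riesz :
  order_embedding (max_cone V (square R)) (max_cone V (linfty R 4)) (tens_map idfun (@sq_row R)) ->
  riesz_ineq.
Proof. by move=> emb; apply: sq_tensor_riesz => *; apply/emb; exact: sq_tensor_row. Qed.

Lemma min_max_riesz : min_cone V (square R) = max_cone V (square R) -> riesz_ineq.
Proof. by move=> mm; apply: sq_tensor_riesz => *; rewrite -mm; exact: sq_tensor_min. Qed.

End RieszInequality.

(** * Decomposition in the dual and infima in the bidual *)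

Section Dual.
Variables (R : realType) (V : funSysType R).
Local Notation pos := (fs_pos V).
Local Notation e := (fs_unit V).

(** The four functionals are sought as one functional on 2 by 2 families, with value at least
    [x1 a1 + x2 a2 + y1 b1 + y2 b2] whenever [u_ij >= a_i + b_j]. For families equal to [a_i + b_j],
    both signs force equality, so the row sums are the [x_i] and the column sums the [y_j]. *)
Lemma riesz_refine : riesz_ineq V -> forall x1 x2 y1 y2 : fs_dual V,
  dual_pos x1 -> dual_pos x2 -> dual_pos y1 -> dual_pos y2 -> x1 + x2 = y1 + y2 ->
  exists z11 z12 z21 z22 : fs_dual V,
  [/\ dual_pos z11, dual_pos z12, dual_pos z21 & dual_pos z22] /\
  [/\ x1 = z11 + z12, x2 = z21 + z22, y1 = z11 + z21 & y2 = z12 + z22].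
Proof.
move=> H x1 x2 y1 y2 x1p x2p y1p y2p xy.
pose c := (x1 + x2 : fs_dual V) e.
have c0 : 0 <= c by apply: dual_posD => //; exact: fs_pos_unit.
pose X := bool * bool -> V; pose N (u : X) : R := \sum_i ornorm (u i).
pose p (u : X) : R := c * N u.
have [nD nZ] := @ornorm_sublinear R V.
have sp : sublinear p.
  split=> [u v|a u a0]; rewrite /p /N.
    by rewrite -mulrDr ler_wpM2l// -big_split; apply: ler_sum => i _; exact: nD.
  by rewrite mulrCA ler_wpM2l// mulr_sumr; apply: ler_sum => i _; exact: nZ.
pose v4 (a b : bool -> V) := x1 (a true) + x2 (a false) + y1 (b true) + y2 (b false).
pose S (u : X) (t : R) := exists a b : bool -> V,
  (forall i, pos (u i - (a i.1 + b i.2))) /\ t = v4 a b.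
have [||||g gp gS] := @mazur_orlicz R X p S sp.
- exists (fun=> 0), (fun=> 0); split=> [i|]; last by rewrite /v4 !linear0 !addr0.
  by rewrite addr0 subr0; exact: fs_pos0.
- move=> u u' _ _ [a [b [h ->]]] [a' [b' [h' ->]]].
  exists (fun j => a j + a' j), (fun j => b j + b' j); split=> [i|].
    rewrite -[X in X - _]/(u i + u' i) [X in _ - X]addrACA opprD addrACA.
    exact: fs_posD.
  by rewrite /v4 !linearD /=; lra.
- move=> k u _ k0 [a [b [h ->]]]; exists (fun j => k *: a j), (fun j => k *: b j); split=> [i|].
    rewrite -[X in X - _]/(k *: u i) -scalerDr -scalerBr.
    by apply: fs_posZ => //; exact: ltW.
  by rewrite /v4 !linearZ /= !scaleoE !mulrDr.
- move=> u _ [a [b [h ->]]]; apply/ler_addgt0Pr => eps eps0.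
  (* As [r] exceeds the norm of every entry of [u], the elements [r e - a_i] and [- b_j] meet the
     hypotheses of [riesz_ineq]; the units contribute [r * c] to its conclusion. *)
  pose r := N u + eps / (c + 1).
  have c1 : 0 < c + 1 by rewrite ltr_wpDl.
  have ec : 0 < eps / (c + 1) by exact: divr_gt0.
  have rp i : pos ((r *: e - a i.1) + - b i.2).
    have ui : ornorm (u i) < r.
      rewrite /r /N (bigD1 i)//= -addrA ltrDl ltr_wpDl// sumr_ge0// => j _; exact: ornorm_ge0.
    have [_ ru] := ornorm_lt ui.
    by rewrite -addrA -opprD -(subrK (u i) (r *: e)) -addrA; exact: fs_posD.
  have := H x1 x2 y1 y2 x1p x2p y1p y2p xy _ _ _ _
    (rp (true, true)) (rp (true, false)) (rp (false, true)) (rp (false, false)).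
  rewrite /= !linearD !linearN !linearZ /= !scaleoE.
  have rc : r * c <= p u + eps.
    rewrite /r mulrDl /p mulrC lerD2l mulrAC ler_pdivrMr// ler_wpM2l ?(ltW eps0)//.
    by rewrite lerDl.
  have : r * c = r * x1 e + r * x2 e by rewrite /c dualD mulrDr.
  rewrite /v4; lra.
have [z zE gz] := family_functional g.
have zp i v : pos v -> 0 <= z i v.
  move=> vp; rewrite zE; apply: gS; exists (fun=> 0), (fun=> 0).
  split=> [j|]; last by rewrite /v4 !linear0 !addr0.
  rewrite addr0 subr0 /single.
  by case: eqP => // _; exact: fs_pos0.
have E (a b : bool -> V) : z (true, true) (a true + b true) + z (true, false) (a true + b false) +
    (z (false, true) (a false + b true) + z (false, false) (a false + b false)) = v4 a b.
  transitivity (g (fun i => a i.1 + b i.2)).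
    rewrite gz (eq_bigr (fun i => z (i.1, i.2) (a i.1 + b i.2))); last by case.
    rewrite -(pair_bigA _ (fun j k => z (j, k) (a j + b k))) /= big_bool /=.
    by rewrite !big_bool.
  apply/eqP; rewrite eq_le; apply/andP; split; last first.
    by apply: gS; exists a, b; split=> // i; rewrite subrr; exact: fs_pos0.
  rewrite -lerN2 -linearN; apply: gS; exists (fun j => - a j), (fun j => - b j).
  split=> [i|]; last by rewrite /v4 !linearN /=; lra.
  by rewrite -[X in X - _]/(- (a i.1 + b i.2)) opprD subrr; exact: fs_pos0.
pose d i : fs_dual V := mk_bdual (positive_bounded (zp i)).
have dp i : dual_pos (d i) by move=> v; exact: zp.
exists (d (true, true)), (d (true, false)), (d (false, true)), (d (false, false)).
split; first by split; exact: dp.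
split; apply/val_inj/funext => v.
- have := E (single true v) (fun=> 0).
  by rewrite /v4 /single /= !(linear0, addr0, add0r) => /esym.
- have := E (single false v) (fun=> 0).
  by rewrite /v4 /single /= !(linear0, addr0, add0r) => /esym.
- have := E (fun=> 0) (single true v).
  by rewrite /v4 /single /= !(linear0, addr0, add0r) => /esym.
- have := E (fun=> 0) (single false v).
  by rewrite /v4 /single /= !(linear0, addr0, add0r) => /esym.
Qed.

(** A quantitative [dual_decomposition], needed for boundedness in [bidual_extend]. The constraint
    [f u <= g (u + w)] for positive [u] and [w] gives [0 <= g] and [f <= g]; the 3 counts one
    [dnorm f] for [g e] and two for [g e - f e]. *)
Lemma dual_decomposition_norm (f : fs_dual V) : exists g : fs_dual V,
  [/\ dual_pos g, dual_pos (g - f) & g e + (g - f : fs_dual V) e <= 3 * dnorm f].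
Proof.
have d0 : 0 <= dnorm f.
  have := dnorm_bound f (v := 0) ltr01; rewrite addr0 subr0 scale1r mul1r.
  by move=> /(_ (fs_pos_unit V) (fs_pos_unit V)); exact: le_trans.
pose S (x : V) (a : R) := exists u w : V, [/\ pos u, pos w, x = u + w & a = f u].
have [||||g gp gS] := @mazur_orlicz R V _ S (ornorm_sublinearM V d0).
- by exists 0, 0; split; rewrite ?addr0 ?linear0//; exact: fs_pos0.
- move=> _ _ _ _ [u [w [up wp -> ->]]] [u' [w' [up' wp' -> ->]]].
  exists (u + u'), (w + w'); split; [exact: fs_posD|exact: fs_posD|by rewrite addrACA|].
  by rewrite linearD.
- move=> k _ _ k0 [u [w [up wp -> ->]]]; exists (k *: u), (k *: w).
  by split; rewrite ?scalerDr ?linearZ//; apply: fs_posZ => //; exact: ltW.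
- move=> _ _ [u [w [up wp -> ->]]]; apply/ler_addgt0Pr => eps eps0.
  have d1 : 0 < dnorm f + 1 by rewrite ltr_wpDl.
  have ed : 0 < eps / (dnorm f + 1) by exact: divr_gt0.
  pose r := ornorm (u + w) + eps / (dnorm f + 1).
  have r0 : 0 < r by rewrite ltr_wpDl// ornorm_ge0.
  have rlt : ornorm (u + w) < r by rewrite ltrDl.
  have [_ rn] := ornorm_lt rlt.
  have := dnorm_bound f (v := u) r0.
  have up1 : pos (r *: e + u) by apply: fs_posD => //; exact/fs_pos_unitZ/ltW.
  have up2 : pos (r *: e - u).
    by have := fs_posD _ _ rn wp; rewrite opprD addrA subrK.
  move=> /(_ up1 up2) /(le_trans (ler_norm _)) /le_trans; apply.
  rewrite /r mulrDl [dnorm f * _]mulrC lerD2l mulrAC ler_pdivrMr// ler_wpM2l ?(ltW eps0)//.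
  by rewrite lerDl.
have [h hE] := dominated_dual gp; exists h; split.
- move=> v vp; rewrite hE; have := gS v (f 0); rewrite linear0; apply.
  by exists 0, v; rewrite add0r linear0; split=> //; exact: fs_pos0.
- move=> v vp; rewrite dualB subr_ge0 hE; apply: gS.
  by exists v, 0; rewrite addr0; split=> //; exact: fs_pos0.
rewrite dualB hE; have : g e <= dnorm f.
  by apply: le_trans (gp e) _; rewrite ler_piMr//; exact: ornorm_unit.
have := dnorm_bound f (v := e) ltr01; rewrite scale1r subrr mul1r.
move=> /(_ (fs_posD _ _ (fs_pos_unit V) (fs_pos_unit V)) (fs_pos0 V)).
by rewrite ler_norml => /andP[? ?]; lra.
Qed.

(** The value at [f] is computed from the decomposition [P f - (P f - f)], and additivity makes it
    independent of the decomposition. Elements of V** can thus be prescribed on positive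
    functionals. *)
Lemma bidual_extend (h : fs_dual V -> R) (C : R) :
  (forall f g, dual_pos f -> dual_pos g -> h (f + g) = h f + h g) ->
  (forall (a : R) f, 0 < a -> dual_pos f -> h (a *: f) = a * h f) ->
  (forall f, dual_pos f -> `|h f| <= C * f e) ->
  exists F : bidual V, forall f, dual_pos f -> F f = h f.
Proof.
move=> hD hZ hC; have /choice[P PP] := dual_decomposition_norm.
pose F f : R^o := h (P f) - h (P f - f).
have FE f a b : dual_pos a -> dual_pos b -> f = a - b -> F f = h a - h b.
  move=> ap bp fE; have [p1 p2 _] := PP f; rewrite /F.
  have E : P f + b = (P f - f) + a by rewrite fE opprB addrA subrK.
  have := hD _ _ p1 bp; have := hD _ _ p2 ap; rewrite -E => -> ?; lra.
have h0 : h 0 = 0.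
  by have := hD 0 0 (fun _ _ => lexx _) (fun _ _ => lexx _); rewrite addr0; lra.
have hZ0 (a : R) f : 0 <= a -> dual_pos f -> h (a *: f) = a * h f.
  rewrite le_eqVlt => /orP[/eqP <-|]; last exact: hZ.
  by rewrite scale0r h0 mul0r.
have hL (a : R) f g : 0 <= a -> dual_pos f -> dual_pos g -> h (a *: f + g) = a * h f + h g.
  by move=> a0 fp gp; rewrite hD ?hZ0//; exact: (dual_posZ a0 fp).
have Fl : linear F.
  move=> k f g; have [p1 p2 _] := PP f; have [q1 q2 _] := PP g.
  have [k0|k0] := lerP 0 k.
    rewrite (FE _ (k *: P f + P g) (k *: (P f - f) + (P g - g))).
    - by rewrite !hL// scaleoE /F; lra.
    - exact: (dual_posD (dual_posZ k0 p1) q1).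
    - exact: (dual_posD (dual_posZ k0 p2) q2).
    - by rewrite opprD addrACA -scalerBr !opprB ![_ + (_ - P _)]addrC !subrK.
  have {}k0 : 0 <= - k by rewrite oppr_ge0 ltW.
  rewrite (FE _ (- k *: (P f - f) + P g) (- k *: P f + (P g - g))).
  - by rewrite !hL// scaleoE /F; lra.
  - exact: (dual_posD (dual_posZ k0 p2) q1).
  - exact: (dual_posD (dual_posZ k0 p1) q2).
  - rewrite opprD addrACA -scalerBr opprB [P g + _]addrC subrK.
    by rewrite addrAC subrr sub0r scaleNr scalerN opprK.
have FB : is_bounded_functional (@dnorm R V (@ornorm R V)) F.
  split=> //; exists (`|C| * 3) => f; have [p1 p2 p3] := PP f.
  have e0 : 0 <= P f e by apply: p1; exact: fs_pos_unit.
  have e1 : 0 <= (P f - f : fs_dual V) e by apply: p2; exact: fs_pos_unit.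
  apply: le_trans (ler_normB _ _) _; rewrite -mulrA; apply: le_trans (ler_wpM2l _ p3) => //.
  rewrite mulrDr; apply: lerD; (apply: le_trans (hC _ _) _ => //; by rewrite ler_wpM2r// ler_norm).
exists (mk_bdual FB) => f fp; rewrite [LHS](FE f f 0) ?subr0//; first by rewrite h0 subr0.
Qed.

Lemma bidual_ext (F G : bidual V) : (forall f, dual_pos f -> F f = G f) -> F = G.
Proof.
move=> h; apply/eqP; rewrite -subr_eq0; apply/eqP/fs_posN.
have E f : dual_pos f -> (F - G : bidual V) f = 0.
  by move=> fp; rewrite -[LHS]/(F f - G f) h// subrr.
by split=> f fp; rewrite -?[X in 0 <= X]/(- (F - G : bidual V) f) E ?oppr0.
Qed.

(** Monotone completeness of V**: the pointwise infimum is additive on positive functionals because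
    one lower member of [A] serves both summands. For the family of majorants, which need not be
    directed, [kant] takes over. *)
Lemma bidual_directed_inf (A : set (bidual V)) (B : bidual V) : A !=set0 ->
  (forall F G, A F -> A G -> exists2 H, A H & forall f, dual_pos f -> H f <= F f /\ H f <= G f) ->
  (forall F f, A F -> dual_pos f -> B f <= F f) ->
  exists M : bidual V, forall f, dual_pos f ->
    (forall F, A F -> M f <= F f) /\ forall a, (forall F, A F -> a <= F f) -> a <= M f.
Proof.
move=> [F0 AF0] Ad AB; pose h f : R := inf [set F f | F in A].
have hlb f F : dual_pos f -> A F -> h f <= F f.
  move=> fp AF; apply: ge_inf; last by exists F.
  by exists (B f) => _ [G AG <-]; exact: AB.
have hge f a : (forall F, A F -> a <= F f) -> a <= h f.
  move=> H; apply: lb_le_inf; first by exists (F0 f); exists F0.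
  by move=> _ [F AF <-]; exact: H.
have [C [C0 CP]] : exists C : R, 0 <= C /\ forall f, dual_pos f -> `|B f| <= C * f e /\ `|F0 f| <= C * f e.
  have bd (G : bidual V) : exists C : R, 0 <= C /\ forall f, dual_pos f -> `|G f| <= C * f e.
    have [r r0 [rp rn]] := fs_abs_unit G; exists r; split; first exact: ltW.
    move=> f fp; have : 0 <= r * f e + G f := rp f fp; have : 0 <= r * f e - G f := rn f fp.
    by rewrite ler_norml => ? ?; apply/andP; split; lra.
  have [C1 [C10 h1]] := bd B; have [C2 [C20 h2]] := bd F0; exists (C1 + C2).
  split; first exact: addr_ge0.
  move=> f fp; have fe : 0 <= f e by apply: fp; exact: fs_pos_unit.
  have := h1 f fp; have := h2 f fp; rewrite mulrDl.
  have := mulr_ge0 C10 fe; have := mulr_ge0 C20 fe.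
  by move=> *; split; lra.
have [||| M ME] := @bidual_extend h C.
- move=> f g fp gp; have fgp := dual_posD fp gp.
  apply/eqP; rewrite eq_le; apply/andP; split; last first.
    by apply: (hge) => F AF; rewrite linearD; apply: lerD; exact: hlb.
  rewrite -lerBlDr; apply: (hge) => F AF; rewrite lerBlDr -lerBlDl.
  apply: (hge) => G AG; rewrite lerBlDl.
  have [H AH HFG] := Ad F G AF AG; apply: le_trans (hlb _ _ fgp AH) _.
  by rewrite linearD; apply: lerD; [exact: (HFG f fp).1|exact: (HFG g gp).2].
- have le (a : R) f : 0 < a -> dual_pos f -> h (a *: f) <= a * h f.
    move=> a0 fp; rewrite -ler_pdivrMl//; apply: (hge) => F AF; rewrite ler_pdivrMl//.
    by rewrite -[leRHS]/(a *: F f : R^o) -linearZ; apply: hlb => //; exact: dual_posZ (ltW a0) fp.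
  move=> a f a0 fp; apply/eqP; rewrite eq_le le//=.
  have afp := dual_posZ (ltW a0) fp.
  have a'0 : 0 < a^-1 by rewrite invr_gt0.
  have := le a^-1 (a *: f) a'0 afp.
  by rewrite scalerA mulVf ?gt_eqF// scale1r ler_pdivlMl.
- move=> f fp; have [/= h1 h2] := CP f fp.
  have := hlb f F0 fp AF0; have : B f <= h f by apply: hge => F AF; exact: AB.
  by move: h1 h2; rewrite !ler_norml => /andP[? ?] /andP[? ?] ? ?; apply/andP; split; lra.
exists M => f fp; rewrite ME//; split=> [F|]; [exact: hlb|exact: hge].
Qed.

End Dual.

(** * Kantorovich extension of maps into the bidual *)

Section OperatorHahnBanach.
Variables (R : realType) (W : lmodType R) (V : funSysType R).

Definition op_sublinear (P : W -> bidual V) :=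
  forall f, dual_pos f -> sublinear (fun w => P w f : R).

(** The Zorn argument of the scalar case, with the lower bound of a chain supplied by
    [bidual_directed_inf]. *)
Lemma op_minimal (P : W -> bidual V) : op_sublinear P -> exists Q, [/\ op_sublinear Q,
  forall f w, dual_pos f -> Q w f <= P w f &
  forall Q', op_sublinear Q' -> (forall f w, dual_pos f -> Q' w f <= Q w f) -> Q' = Q].
Proof.
move=> sP; pose T := {Q : W -> bidual V | `[< op_sublinear Q /\
   forall f w, dual_pos f -> Q w f <= P w f >]}.
pose le (q q' : T) := `[< forall f w, dual_pos f -> val q' w f <= val q w f >].
have Tsub (q : T) : op_sublinear (val q) by have /asboolP[] := valP q.
have Tle (q : T) f w : dual_pos f -> val q w f <= P w f.
  by have /asboolP[_] := valP q; apply.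
have Tge (q : T) f w : dual_pos f -> - P (- w) f <= val q w f.
  move=> fp; apply: le_trans (sublinear_ge _ (Tsub q f fp)).
  by rewrite lerN2; exact: Tle.
have [|||A Atot|q qmax] := @Zorn T le.
- by move=> q; apply/asboolP.
- move=> q r s /asboolP qr /asboolP rs; apply/asboolP => f w fp.
  exact: le_trans (rs f w fp) (qr f w fp).
- move=> q r /asboolP qr /asboolP rq; apply/val_inj/funext => w; apply: bidual_ext => f fp.
  by apply/eqP; rewrite eq_le qr ?rq.
- have [[q0 Aq0]|A0] := pselect (exists q, A q); last first.
    have pT : `[< op_sublinear P /\ forall f w, dual_pos f -> P w f <= P w f >].
      by apply/asboolP.
    by exists (exist _ P pT) => s As; exfalso; apply: A0; exists s.
  have /choice[m mP] : forall w, exists M : bidual V, forall f, dual_pos f ->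
      (forall q, A q -> M f <= val q w f) /\ forall a, (forall q, A q -> a <= val q w f) -> a <= M f.
    move=> w; have [|||M MP] := @bidual_directed_inf R V [set val q w | q in A] (- P (- w)).
    + by exists (val q0 w), q0.
    + move=> _ _ [q Aq <-] [r Ar <-].
      have [/asboolP qr|/asboolP rq] := Atot _ _ Aq Ar.
        by exists (val r w); [exists r|move=> f fp; split=> //; exact: qr].
      by exists (val q w); [exists q|move=> f fp; split=> //; exact: rq].
    + by move=> _ f [q Aq <-] fp; exact: Tge.
    exists M => f fp; have [h1 h2] := MP f fp; split=> [q Aq|a ha]; first by apply: h1; exists q.
    by apply: h2 => _ [q Aq <-]; exact: ha.
  have mlb f w q : dual_pos f -> A q -> m w f <= val q w f.
    by move=> fp Aq; exact: (mP w f fp).1.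
  have mge f w a : dual_pos f -> (forall q, A q -> a <= val q w f) -> a <= m w f.
    by move=> fp; exact: (mP w f fp).2.
  have sm : op_sublinear m.
    move=> f fp; split=> [v w|a v a0].
      rewrite -lerBlDr; apply: (mge) => // q Aq.
      rewrite lerBlDr -lerBlDl; apply: (mge) => // r Ar; rewrite lerBlDl.
      have [/asboolP qr|/asboolP rq] := Atot _ _ Aq Ar.
        apply: le_trans (mlb _ _ r fp Ar) _; apply: le_trans ((Tsub r f fp).1 _ _) _.
        by rewrite lerD2r; exact: qr.
      apply: le_trans (mlb _ _ q fp Aq) _; apply: le_trans ((Tsub q f fp).1 _ _) _.
      by rewrite lerD2l; exact: rq.
    rewrite -ler_pdivrMl//; apply: (mge) => // q Aq; rewrite ler_pdivrMl//.
    by apply: le_trans (mlb _ _ _ fp Aq) _; apply: (Tsub q f fp).2.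
  have mT : `[< op_sublinear m /\ forall f w, dual_pos f -> m w f <= P w f >].
    by apply/asboolP; split=> // f w fp; exact: le_trans (mlb _ _ _ fp Aq0) (Tle q0 f w fp).
  by exists (exist _ m mT) => s As; apply/asboolP => f w fp; exact: mlb.
exists (val q); split=> //; first by move=> f w; exact: Tle.
move=> q' sq' q'q.
have q'T : `[< op_sublinear q' /\ forall f w, dual_pos f -> q' w f <= P w f >].
  by apply/asboolP; split=> // f w fp; exact: le_trans (q'q f w fp) (Tle q f w fp).
by have /(congr1 val) := qmax (exist _ q' q'T) (asboolT q'q).
Qed.

(** The scalar proof only takes infima of monotone families, and these exist in V** for every V; the
    Riesz property enters only later, in the construction of the sublinear bound. *)
Lemma op_hahn_banach (P : W -> bidual V) : op_sublinear P ->
  exists g : {linear W -> bidual V}, forall f w, dual_pos f -> (g w : bidual V) f <= P w f.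
Proof.
move=> /op_minimal[q [sq qp qmin]].
have qZ f (a : R) w : dual_pos f -> 0 <= a -> q (a *: w) f = a * q w f.
  by move=> fp a0; exact: (sublinearZ w (sq f fp) a0).
have q0 f : dual_pos f -> q 0 f = 0 by move=> fp; exact: (sublinear0 (sq f fp)).
have qD y x : q (x + y) = q x + q y.
  apply: bidual_ext => f fp; apply/eqP; rewrite eq_le; apply/andP; split.
    exact: (sq f fp).1.
  have /choice[m mP] : forall x, exists M : bidual V, forall f, dual_pos f ->
      (forall t : R, 0 <= t -> M f <= q (x + t *: y) f - t * q y f) /\
      forall a, (forall t : R, 0 <= t -> a <= q (x + t *: y) f - t * q y f) -> a <= M f.
    move=> {f fp} {}x.
    have [|||M MP] := @bidual_directed_inf R V
        [set q (x + t *: y) - t *: q y | t in [set t : R | 0 <= t]] (- q (- x)).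
    + by exists (q (x + 0 *: y) - 0 *: q y), 0 => /=.
    (* Subadditivity makes [q (x + t y) - t q y] decrease in [t], so these elements form a directed
       family. *)
    + have mono (t s : R) : 0 <= t -> t <= s -> forall f, dual_pos f ->
          (q (x + s *: y) - s *: q y : bidual V) f <= (q (x + t *: y) - t *: q y : bidual V) f.
        move=> t0 ts f fp.
        change (q (x + s *: y) f - s * q y f <= q (x + t *: y) f - t * q y f).
        have -> : x + s *: y = (x + t *: y) + (s - t) *: y.
          by rewrite -addrA -scalerDl [t + _]addrC subrK.
        have := (sq f fp).1 (x + t *: y) ((s - t) *: y).
        by rewrite qZ ?subr_ge0// mulrBl; lra.
      move=> _ _ [t t0 <-] [s s0 <-]; have [ts|/ltW st] := lerP t s.
        exists (q (x + s *: y) - s *: q y); first by exists s.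
        by move=> f fp; split=> //; exact: mono.
      exists (q (x + t *: y) - t *: q y); first by exists t.
      by move=> f fp; split=> //; exact: mono.
    + move=> _ f [t t0 <-] fp.
      change (- q (- x) f <= q (x + t *: y) f - t * q y f).
      have := (sq f fp).1 (- x) (x + t *: y); rewrite addKr qZ//; lra.
    exists M => f fp; have [h1 h2] := MP f fp; split=> [t t0|a ha].
      by apply: (h1 (q (x + t *: y) - t *: q y)); exists t.
    by apply: h2 => _ [t t0 <-]; exact: ha.
  have mlb g z t : dual_pos g -> 0 <= t -> m z g <= q (z + t *: y) g - t * q y g.
    by move=> gp t0; exact: (mP z g gp).1.
  have mge g z a : dual_pos g -> (forall t, 0 <= t -> a <= q (z + t *: y) g - t * q y g) -> a <= m z g.
    by move=> gp; exact: (mP z g gp).2.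
  have sm : op_sublinear m.
    move=> g gp; split=> [v w|a v a0].
      rewrite -lerBlDr; apply: (mge) => // t t0.
      rewrite lerBlDr -lerBlDl; apply: (mge) => // s s0; rewrite lerBlDl.
      have := mlb g (v + w) (t + s) gp (addr_ge0 t0 s0).
      have := (sq g gp).1 (v + t *: y) (w + s *: y).
      by rewrite addrACA -scalerDl mulrDl; lra.
    rewrite -ler_pdivrMl//; apply: (mge) => // t t0; rewrite ler_pdivrMl//.
    have := mlb g (a *: v) (a * t) gp (mulr_ge0 (ltW a0) t0).
    by rewrite -scalerA -scalerDr (qZ _ _ _ gp (ltW a0)) mulrBr mulrA.
  have mq : m = q.
    apply: qmin => // g z gp; have := mlb g z 0 gp (lexx _).
    by rewrite scale0r addr0 mul0r subr0.
  have := mlb f x 1 fp ler01; rewrite mq scale1r mul1r.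
  change (q x f <= q (x + y) f - q y f -> q x f + q y f <= q (x + y) f).
  lra.
have qN x : q (- x) = - q x.
  by apply/eqP; rewrite -addr_eq0 -qD addNr; apply/eqP/bidual_ext => f fp; rewrite q0.
have ql : linear q.
  move=> a v w; rewrite qD; congr (_ + _); apply: bidual_ext => f fp.
  change (q (a *: v) f = a * q v f).
  have [a0|/ltW a0] := lerP 0 a; first exact: qZ.
  have -> : a *: v = - (- a *: v) by rewrite scaleNr opprK.
  rewrite qN; change (- q (- a *: v) f = a * q v f).
  by rewrite qZ ?oppr_ge0// mulNr opprK.
exists (mk_linear ql).
exact: qp.
Qed.

End OperatorHahnBanach.

Section Kantorovich.
Variables (R : realType) (V W1 W2 : funSysType R) (i : {linear W1 -> W2}).
Variable f : {linear W1 -> bidual V}.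
Hypothesis V_riesz : riesz_ineq V.
Hypothesis i_incl : fs_inclusion i.
Hypothesis f_up : unital_positive f.

(* kant w x a: the element x of V*+ splits into x_k >= 0 and there are u_k >= w
   with a = sum of f(u_k)(x_k). The infimum over a is the value at x of the
   infimum of the f(u), u >= w, in the lattice V**. *)
Inductive kant (w : W2) : fs_dual V -> R -> Prop :=
| kant1 x u : dual_pos x -> fs_pos W2 (i u - w) -> kant w x ((f u : bidual V) x)
| kantD x y a b : kant w x a -> kant w y b -> kant w (x + y) (a + b).

Lemma kant_pos w x a : kant w x a -> dual_pos x.
Proof. by elim=> // {a}x' y a b _ xp _ yp; exact: dual_posD. Qed.

(** The point where the Riesz property is used: a splitting of [x + y] is refined along [x] and [y],
    and each piece keeps its majorant. It makes the infimum over [kant] additive in the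
    functional. *)
Lemma kant_split w x y c : dual_pos x -> dual_pos y -> kant w (x + y) c ->
  exists a b, [/\ kant w x a, kant w y b & c = a + b].
Proof.
move=> xp yp; move E : (x + y) => z kz; elim: kz x y xp yp E => {z c}.
  move=> z u zp uw x y xp yp E; exists ((f u : bidual V) x), ((f u : bidual V) y).
  by split; [exact: kant1|exact: kant1|rewrite -E linearD].
move=> z z' a b kz IH kz' IH' x y xp yp E.
have [z11 [z12 [z21 [z22 [[p11 p12 p21 p22] [E1 E2 E3 E4]]]]]] :=
  riesz_refine V_riesz xp yp (kant_pos kz) (kant_pos kz') E.
have [a1 [a2 [k1 k2 aE]]] := IH z11 z21 p11 p21 (esym E3).
have [b1 [b2 [k1' k2' bE]]] := IH' z12 z22 p12 p22 (esym E4).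
exists (a1 + b1), (a2 + b2); rewrite E1 E2; split; [exact: kantD|exact: kantD|].
by rewrite aE bE addrACA.
Qed.

(** The witnesses for [w] and [w'] may split [x] differently; [kant_split] refines one along the
    other, and on the common pieces the majorants add. *)
Lemma kant_sum w w' x a b : kant w x a -> kant w' x b -> kant (w + w') x (a + b).
Proof.
move=> kw; elim: kw b => {x a}.
  move=> x u xp uw b kw'; elim: kw' xp => {x b}.
    move=> x u' xp uw' _.
    have -> : (f u : bidual V) x + (f u' : bidual V) x = (f (u + u') : bidual V) x by rewrite linearD.
    by apply: kant1 => //; rewrite linearD opprD addrACA; exact: fs_posD.
  move=> x y a b kx IHx ky IHy _; rewrite linearD addrACA.
  by apply: kantD; [apply/IHx/(kant_pos kx)|apply/IHy/(kant_pos ky)].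
move=> x y a b kx IHx ky IHy c kc.
have [c1 [c2 [k1 k2 ->]]] := kant_split (kant_pos kx) (kant_pos ky) kc.
by rewrite addrACA; apply: kantD; [exact: IHx|exact: IHy].
Qed.

Lemma kant_scalew w x a (k : R) : 0 < k -> kant w x a -> kant (k *: w) x (k * a).
Proof.
move=> k0; elim=> {x a} [x u xp uw|x y a b _ IHx _ IHy]; last first.
  by rewrite mulrDr; exact: kantD.
have -> : k * (f u : bidual V) x = (f (k *: u) : bidual V) x by rewrite linearZ.
by apply: kant1 => //; rewrite linearZ -scalerBr; apply: fs_posZ => //; exact: ltW.
Qed.

Lemma kant_scalex w x a (k : R) : 0 < k -> kant w x a -> kant w (k *: x) (k * a).
Proof.
move=> k0; elim=> {x a} [x u xp uw|x y a b _ IHx _ IHy]; last first.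
  by rewrite mulrDr scalerDr; exact: kantD.
have -> : k * (f u : bidual V) x = (f u : bidual V) (k *: x) by rewrite linearZ.
by apply: kant1 => //; apply: dual_posZ => //; exact: ltW.
Qed.

Lemma kant_lb w x a (r : R) : fs_pos W2 (r *: fs_unit W2 + w) -> kant w x a ->
  - (r * x (fs_unit V)) <= a.
Proof.
have [f1 fp] := f_up; have [i1 ip] := i_incl.
move=> rw; elim=> {x a} [x u xp uw|x y a b _ IHx _ IHy]; last first.
  by rewrite dualD mulrDr opprD; exact: lerD.
have : fs_pos W1 (r *: fs_unit W1 + u).
  apply/ip; rewrite linearD linearZ /= i1.
  by have := fs_posD _ _ rw uw; rewrite -addrA [w + _]addrC subrK.
move=> /fp /(_ x xp); rewrite linearD linearZ /= f1.
change (0 <= r * x (fs_unit V) + (f u : bidual V) x -> - (r * x (fs_unit V)) <= (f u : bidual V) x).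
lra.
Qed.

Lemma kant_inf : exists P : W2 -> bidual V, forall w x, dual_pos x ->
  (forall a, kant w x a -> P w x <= a) /\
  forall c, (forall a, kant w x a -> c <= a) -> c <= P w x.
Proof.
have [f1 fp] := f_up; have [i1 ip] := i_incl.
pose h w x := inf [set a | kant w x a].
have /choice[r rP] : forall w : W2, exists r : R, [/\ 0 < r,
    fs_pos W2 (r *: fs_unit W2 + w) & fs_pos W2 (r *: fs_unit W2 - w)].
  by move=> w; have [r r0 [rp rn]] := fs_abs_unit w; exists r.
have single w x : dual_pos x -> kant w x (r w * x (fs_unit V)).
  move=> xp; have -> : r w * x (fs_unit V) = (f (r w *: fs_unit W1) : bidual V) x by rewrite linearZ /= f1.
  by apply: kant1 => //; rewrite linearZ /= i1; have [] := rP w.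
have hlb w x a : kant w x a -> h w x <= a.
  move=> k; apply: ge_inf => //; exists (- (r w * x (fs_unit V))) => b.
  by apply: kant_lb; have [] := rP w.
have hge w x c : dual_pos x -> (forall a, kant w x a -> c <= a) -> c <= h w x.
  by move=> xp H; apply: lb_le_inf => //; exists (r w * x (fs_unit V)); exact: single.
suff /choice[P PP] : forall w, exists F : bidual V, forall x, dual_pos x -> F x = h w x.
  exists P => w x xp; rewrite PP//; split=> [a|c]; first exact: hlb.
  exact: hge.
move=> w; apply: (@bidual_extend R V (h w) (r w)).
- move=> x y xp yp; have xyp := dual_posD xp yp.
  apply/eqP; rewrite eq_le; apply/andP; split.
    rewrite -lerBlDr; apply: (hge) => // a ka; rewrite lerBlDr -lerBlDl.
    by apply: (hge) => // b kb; rewrite lerBlDl; apply: hlb; exact: kantD.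
  apply: (hge) => // c /(kant_split xp yp)[a [b [ka kb ->]]].
  by apply: lerD; exact: hlb.
- have le (k : R) x : 0 < k -> dual_pos x -> h w (k *: x) <= k * h w x.
    move=> k0 xp; rewrite -ler_pdivrMl//; apply: (hge) => // a ka; rewrite ler_pdivrMl//.
    by apply: hlb; exact: kant_scalex.
  move=> k x k0 xp; apply/eqP; rewrite eq_le le//=.
  have k'0 : 0 < k^-1 by rewrite invr_gt0.
  have := le k^-1 (k *: x) k'0 (dual_posZ (ltW k0) xp).
  by rewrite scalerA mulVf ?gt_eqF// scale1r ler_pdivlMl.
- move=> x xp; rewrite ler_norml hlb ?andbT; last exact: single.
  by apply: (hge) => // a; apply: kant_lb; have [] := rP w.
Qed.

(** With [P w] the infimum of the [f u] over [u >= w], any linear [g <= P] works: [P (i u) <= f u]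
    for both [u] and [- u] gives the extension, and [P (- w) <= f 0] for positive [w] gives
    positivity. *)
Lemma kantorovich : exists2 g : {linear W2 -> bidual V}, unital_positive g & forall w, g (i w) = f w.
Proof.
have [f1 fp] := f_up; have [i1 ip] := i_incl; have [P PP] := kant_inf.
have Plb w x a : kant w x a -> P w x <= a by move=> k; exact: (PP w x (kant_pos k)).1.
have Pge w x c : dual_pos x -> (forall a, kant w x a -> c <= a) -> c <= P w x.
  by move=> xp; exact: (PP w x xp).2.
have sP : op_sublinear P.
  move=> x xp; split=> [w w'|k w k0].
    rewrite -lerBlDr; apply: (Pge) => // a ka; rewrite lerBlDr -lerBlDl.
    by apply: (Pge) => // b kb; rewrite lerBlDl; apply: Plb; exact: kant_sum.
  rewrite -ler_pdivrMl//; apply: (Pge) => // a ka; rewrite ler_pdivrMl//.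
  by apply: Plb; exact: kant_scalew.
have [g gP] := op_hahn_banach sP.
have gi u x : dual_pos x -> (g (i u) : bidual V) x <= (f u : bidual V) x.
  move=> xp; apply: le_trans (gP _ _ xp) _; apply: Plb; apply: kant1 => //.
  by rewrite subrr; exact: fs_pos0.
have gE w : g (i w) = f w.
  apply: bidual_ext => x xp; apply/eqP; rewrite eq_le gi//=.
  have := gi (- w) x xp; rewrite !linearN.
  by change (- (g (i w) : bidual V) x <= - (f w : bidual V) x -> (f w : bidual V) x <= (g (i w) : bidual V) x); rewrite lerN2.
exists g => //; split; first by rewrite /unital_map -i1 gE.
move=> w wp x xp; have := gP x (- w) xp; rewrite linearN.
have : P (- w) x <= (f 0 : bidual V) x.
  by apply: Plb; apply: kant1 => //; rewrite linear0 sub0r opprK.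
rewrite linear0.
change (P (- w) x <= 0 -> - (g w : bidual V) x <= P (- w) x -> 0 <= (g w : bidual V) x).
lra.
Qed.

End Kantorovich.

Lemma riesz_injective (R : realType) (V : funSysType R) : riesz_ineq V -> injective_fs (bidual V).
Proof. by move=> V_riesz W1 W2 i ii f fup; exact: kantorovich. Qed.

(** * The Riesz representation theorem *)

(** If [P A] fails, the sets [C] such that [P] holds for the part of [A] outside [C] form a proper
    filter containing [A], and the local hypothesis at a cluster point is contradictory. This stands
    in for the choice of finite subcovers. *)
Lemma compact_induction (E : topologicalType) (A : set E) (P : set E -> Prop) :
  compact A -> P set0 -> (forall B C, P B -> P C -> P (B `|` C)) ->
  (forall B C, B `<=` C -> P C -> P B) ->
  (forall x, A x -> exists2 N, nbhs x N & P N) -> P A.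
Proof.
move=> cA P0 PU Ps Ploc; apply: contrapT => nPA.
pose F : set_system E := [set C | P (A `\` C)].
have FF : ProperFilter F.
  split; first by rewrite /F /= setD0.
  split=> [|C D FC FD|C D CD FC]; rewrite /F /=.
  - by rewrite setDT.
  - by rewrite setDIr; exact: PU.
  - by apply: Ps FC; exact: setDS.
have FA : F A by rewrite /F /= setDv.
have [x [Ax xF]] := cA F FF FA; have [N xN PN] := Ploc x Ax.
have [|y [ny Ny]] := xF (~` N) N _ xN; last exact: ny.
by rewrite /F /= setDE setCK; apply: Ps PN => y [].
Qed.

(** The functions live on all of [E] because the measures are Borel measures on [E], but separation
    and, in [lattice_state], monotonicity refer to [K]. Constants and [fl_sep] give [L] enough
    functions for Urysohn's lemma. *)
Record function_lattice (R : realType) (E : topologicalType) (K : set E)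
  (L : (E -> R^o) -> Prop) := FunctionLattice {
  fl_compact : compact K ;
  fl_closed : closed K ;
  fl_cont : forall f, L f -> continuous f ;
  fl_cst : forall c : R, L (cst c) ;
  fl_add : forall f g, L f -> L g -> L (fun x => f x + g x) ;
  fl_scale : forall (a : R) f, L f -> L (fun x => a * f x) ;
  fl_max : forall f g, L f -> L g -> L (fun x => Num.max (f x) (g x)) ;
  fl_sep : forall x y, K x -> K y -> x <> y -> exists2 f, L f & f x <> f y }.

Record lattice_state (R : realType) (E : topologicalType) (K : set E)
  (L : (E -> R^o) -> Prop) (m : (E -> R^o) -> R) := LatticeState {
  ls_add : forall f g, L f -> L g -> m (fun x => f x + g x) = m f + m g ;
  ls_scale : forall (a : R) f, L f -> m (fun x => a * f x) = a * m f ;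
  ls_mono : forall f g, L f -> L g -> (forall x, K x -> f x <= g x) -> m f <= m g ;
  ls_one : m (cst 1) = 1 }.

Section FunctionLattice.
Variables (R : realType) (E : topologicalType) (K : set E) (L : (E -> R^o) -> Prop).
Hypothesis KL : function_lattice K L.

Lemma fl_min f g : L f -> L g -> L (fun x => Num.min (f x) (g x)).
Proof.
move=> Lf Lg; have := fl_scale KL (-1) (fl_max KL (fl_scale KL (-1) Lf) (fl_scale KL (-1) Lg)).
congr L; apply/funext => x.
by rewrite /= !mulN1r -oppr_min opprK.
Qed.

Lemma fl_sub f g : L f -> L g -> L (fun x => f x - g x).
Proof.
move=> Lf Lg; have := fl_add KL Lf (fl_scale KL (-1) Lg).
by congr L; apply/funext => x; rewrite mulN1r.
Qed.

Lemma fl_sum (I : Type) (s : seq I) (f : I -> E -> R^o) : (forall i, L (f i)) ->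
  L (fun x => \sum_(i <- s) f i x).
Proof.
move=> h; elim: s => [|i s IH].
  by rewrite (_ : (fun x => _) = cst 0); [exact: (fl_cst KL)|apply/funext => x; rewrite big_nil].
rewrite (_ : (fun x => _) = (fun x => f i x + \sum_(j <- s) f j x)).
  exact: (fl_add KL).
by apply/funext => x; rewrite big_cons.
Qed.

Lemma fl_clamp f : L f -> L (fun x => Num.max 0 (Num.min 1 (f x))).
Proof. by move=> Lf; apply: (fl_max KL) => //; [exact: (fl_cst KL)|apply: fl_min => //; exact: (fl_cst KL)]. Qed.

Lemma open_gt_fun (f : E -> R^o) (c : R) : continuous f -> open [set x | c < f x].
Proof.
by move=> cf; apply: (@open_comp _ _ f [set y : R | c < y]) => [x _|]; [exact: cf|exact: open_gt].
Qed.

Lemma open_lt_fun (f : E -> R^o) (c : R) : continuous f -> open [set x | f x < c].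
Proof.
by move=> cf; apply: (@open_comp _ _ f [set y : R | y < c]) => [x _|]; [exact: cf|exact: open_lt].
Qed.

Lemma closed_ge_fun (f : E -> R^o) (c : R) : continuous f -> closed [set x | c <= f x].
Proof.
by move=> cf; apply: (@preimage_closed _ _ f [set y : R | c <= y]) => [x _|]; [exact: cf|exact: closed_ge].
Qed.

Lemma point_urysohn y (U : set E) : K y -> open U -> U y -> exists2 g, L g &
  [/\ forall x, 0 <= g x <= 1, g y = 1 & forall x, K x -> ~ U x -> g x = 0].
Proof.
move=> Ky oU Uy.
have cKU : compact (K `&` ~` U).
  by apply: compact_closedI; [exact: fl_compact KL|exact: open_closedC].
have [||||g [Lg gy g1 g0]] := @compact_induction E (K `&` ~` U)
  (fun B => exists g, [/\ L g, g y = 1, forall x, g x <= 1 & forall x, K x -> B x -> g x <= 0]) cKU.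
- by exists (cst 1); split=> //; exact: (fl_cst KL).
- move=> B C [g [Lg gy g1 gB]] [h [Lh hy h1 hC]]; exists (fun x => Num.min (g x) (h x)).
  split=> [||x|x Kx]; first exact: fl_min.
  + by rewrite gy hy minxx.
  + by rewrite ge_min g1.
  + by move=> [/(gB x Kx) ?|/(hC x Kx) ?]; rewrite ge_min; apply/orP; [left|right].
- move=> B C BC [g [Lg gy g1 gC]]; exists g; split=> // x Kx Bx; exact/gC/BC.
- move=> z [Kz nUz]; have zy : z <> y by move=> zy; apply: nUz; rewrite zy.
  have [f Lf fzy] := fl_sep KL Kz Ky zy.
  have d0 : f z - f y != 0 by rewrite subr_eq0; apply/eqP.
  pose l x := 1 - 2 / (f z - f y) * (f x - f y).
  have Ll : L l.
    apply: fl_sub; first exact: (fl_cst KL).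
    by apply: (fl_scale KL) => //; apply: fl_sub => //; exact: (fl_cst KL).
  have lz : l z = - 1 by rewrite /l -mulrA mulVf// mulr1; lra.
  have ly : l y = 1 by rewrite /l subrr mulr0 subr0.
  exists [set x | l x < 0].
    by apply: open_nbhs_nbhs; split; [apply/open_lt_fun/(fl_cont KL)|rewrite /= lz; lra].
  exists (fun x => Num.min 1 (l x)); split=> [||x|x Kx lx].
  + by apply: fl_min => //; exact: (fl_cst KL).
  + by rewrite ly minxx.
  + by rewrite ge_min lexx.
  + by rewrite ge_min; apply/orP; right; exact: ltW.
exists (fun x => Num.max 0 (Num.min 1 (g x))); first exact: fl_clamp.
split=> [x||x Kx nUx].
- by rewrite le_max lexx ge_max ler01 ge_min lexx.
- by rewrite gy minxx max_r.
- by rewrite min_r// max_l// g0.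
Qed.

Lemma compact_urysohn (C D : set E) : compact C -> C `<=` K -> closed D ->
  C `&` D = set0 -> exists2 g, L g &
  [/\ forall x, 0 <= g x <= 1, forall x, C x -> g x = 1 & forall x, K x -> D x -> g x = 0].
Proof.
move=> cC CK cD CD0.
have [||||g [Lg g01 gC gD]] := @compact_induction E C
  (fun B => exists g, [/\ L g, forall x, 0 <= g x, forall x, B x -> 1 <= g x & forall x, K x -> D x -> g x <= 0]) cC.
- by exists (cst 0); split=> //; exact: (fl_cst KL).
- move=> A B [g [Lg g0 gA gD]] [h [Lh h0 hB hD]]; exists (fun x => Num.max (g x) (h x)).
  split=> [|x|x|x Kx Dx]; first exact: (fl_max KL).
  + by rewrite le_max g0.
  + by move=> [/gA ?|/hB ?]; rewrite le_max; apply/orP; [left|right].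
  + by rewrite ge_max gD ?hD.
- by move=> A B AB [g [Lg g0 gB gD]]; exists g; split=> // x /AB; exact: gB.
- move=> x Cx; have oD : open (~` D) by exact: closed_openC.
  have nDx : (~` D) x by move=> Dx; rewrite -[False]/(set0 x) -CD0.
  have [g Lg [g01 gx gD]] := point_urysohn (CK _ Cx) oD nDx.
  exists [set z | 2^-1 < g z].
    by apply: open_nbhs_nbhs; split; [apply/open_gt_fun/(fl_cont KL)|rewrite /= gx; lra].
  exists (fun z => 2 * g z); split=> [|z|z /= gz|z Kz Dz]; first exact: (fl_scale KL).
  + by rewrite mulr_ge0//; have /andP[] := g01 z.
  + lra.
  + by rewrite gD ?mulr0//; apply.
exists (fun x => Num.max 0 (Num.min 1 (g x))); first exact: fl_clamp.
split=> [x|x Cx|x Kx Dx].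
- by rewrite le_max lexx ge_max ler01 ge_min lexx.
- by rewrite min_l ?gC// max_r.
- by rewrite min_r ?max_l ?gD// (le_trans (gD _ Kx Dx)).
Qed.

Section State.
Variable m : (E -> R^o) -> R.
Hypothesis mL : lattice_state K L m.

Lemma ls_cst (c : R) : m (cst c) = c.
Proof.
have -> : cst c = (fun x : E => c * cst 1 x) :> (E -> R^o).
  by apply/funext => x; rewrite /= mulr1.
by rewrite (ls_scale mL) ?(ls_one mL) ?mulr1//; exact: (fl_cst KL).
Qed.

Lemma ls_sum (I : Type) (s : seq I) (f : I -> E -> R^o) : (forall i, L (f i)) ->
  m (fun x => \sum_(i <- s) f i x) = \sum_(i <- s) m (f i).
Proof.
move=> h; elim: s => [|i s IH].
  by rewrite big_nil -[RHS](ls_cst 0); congr m; apply/funext => x; rewrite big_nil.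
rewrite big_cons -IH -(ls_add mL)//; last exact: fl_sum.
by congr m; apply/funext => x; rewrite big_cons.
Qed.

(** On [K], [f] is at most the indicator of [U], and negative values are allowed. In place of
    compact support in [U], the compact sets of [K] where [f >= eps] are used. *)
Definition below (U : set E) (f : E -> R^o) :=
  L f /\ forall x, K x -> f x <= 1 /\ (~ U x -> f x <= 0).

Lemma below0 U : below U (cst 0).
Proof. by split=> [|x _ /=]; [exact: (fl_cst KL)|]. Qed.

Definition open_mass (U : set E) : R := sup [set m f | f in below U].

Lemma open_mass_ub U f : below U f -> m f <= open_mass U.
Proof.
move=> fU; apply: ub_le_sup; last by exists f.
exists 1 => _ [g [Lg gU] <-]; rewrite -(ls_cst 1); apply: (ls_mono mL) => //; first exact: (fl_cst KL).
by move=> x Kx; have [] := gU x Kx.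
Qed.

Lemma open_mass_le U c : (forall f, below U f -> m f <= c) -> open_mass U <= c.
Proof.
move=> h; apply: ge_sup => [|_ [f fU <-]]; last exact: h.
by exists (m (cst 0)), (cst 0) => //; exact: below0.
Qed.

Lemma open_mass_ge0 U : 0 <= open_mass U.
Proof. by rewrite -(ls_cst 0); apply: open_mass_ub; exact: below0. Qed.

Lemma open_mass_mono U W : U `<=` W -> open_mass U <= open_mass W.
Proof.
move=> UW; apply: open_mass_le => f [Lf fU]; apply: open_mass_ub; split=> // x Kx.
by have [h1 h2] := fU x Kx; split=> // nWx; apply: h2 => /UW.
Qed.

Lemma open_massT : open_mass setT = 1.
Proof.
apply/eqP; rewrite eq_le; apply/andP; split.
  apply: open_mass_le => f [Lf fU]; rewrite -(ls_cst 1); apply: (ls_mono mL) => //; first exact: (fl_cst KL).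
  by move=> x Kx; have [] := fU x Kx.
rewrite -{1}(ls_cst 1); apply: open_mass_ub; split; first exact: (fl_cst KL).
by move=> x _; split=> // nT; exfalso; exact: nT.
Qed.

Lemma open_mass_offK U : U `&` K = set0 -> open_mass U = 0.
Proof.
move=> UK; apply/eqP; rewrite eq_le open_mass_ge0 andbT; apply: open_mass_le => f [Lf fU].
rewrite -(ls_cst 0); apply: (ls_mono mL) => //; first exact: (fl_cst KL).
move=> x Kx; have [_] := fU x Kx; apply=> Ux.
by rewrite -[False]/(set0 x) -UK.
Qed.

Lemma open_mass_pos U f : below U f -> below U (fun x => Num.max 0 (f x)).
Proof.
move=> [Lf fU]; split; first by apply: (fl_max KL) => //; exact: (fl_cst KL).
by move=> x Kx; have [h1 h2] := fU x Kx; rewrite !ge_max h1 ler01 lexx.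
Qed.

(** The compact set of [K] where [f >= eps] is covered by finitely many [U n], with functions [h n]
    below [U n] reaching [1 - eps] on it. As [f <= 1], the sum of the [h n] plus [eps] dominates [f]
    on [K]. *)
Lemma open_mass_bigcup (U : nat -> set E) (eps : R) f : (forall n, open (U n)) ->
  0 < eps -> below (\bigcup_n U n) f -> exists N, m f <= \sum_(n < N) open_mass (U n) + eps.
Proof.
move=> oU eps0 [Lf fU].
have cC : compact (K `&` [set x | eps <= f x]).
  by apply: compact_closedI; [exact: fl_compact KL|apply/closed_ge_fun/(fl_cont KL)].
have [||||N [h [hL hU hC]]] := @compact_induction E (K `&` [set x | eps <= f x])
  (fun B => exists N, exists h : nat -> E -> R^o, [/\ forall n, below (U n) (h n),
    forall n x, 0 <= h n x & forall x, K x -> B x -> exists2 n, (n < N)%N & 1 - eps <= h n x]) cC.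
- by exists 0%N, (fun _ => cst 0); split=> // n; exact: below0.
- move=> B C [N [h [hU h0 hB]]] [N' [h' [h'U h'0 h'C]]].
  exists (maxn N N'), (fun n x => Num.max (h n x) (h' n x)); split=> [n|n x|x Kx].
  + have [Lh hn] := hU n; have [Lh' h'n] := h'U n; split; first exact: (fl_max KL).
    move=> x Kx; have [h1 h2] := hn x Kx; have [h3 h4] := h'n x Kx.
    by rewrite !ge_max h1 h3; split=> // nU; rewrite h2 ?h4.
  + by rewrite le_max h0.
  + move=> [/(hB x Kx)[n nN hn]|/(h'C x Kx)[n nN hn]]; exists n.
    * exact: leq_trans nN (leq_maxl _ _).
    * by rewrite le_max hn.
    * exact: leq_trans nN (leq_maxr _ _).
    * by rewrite le_max hn orbT.
- by move=> B C BC [N [h [hU h0 hC]]]; exists N, h; split=> // x Kx /BC; exact: hC.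
- move=> x [Kx fx]; have [n _ Unx] : (\bigcup_n U n) x.
    apply: contrapT => nU; have [_ /(_ nU) fx0] := fU x Kx.
    by move: fx; rewrite /= => ?; lra.
  have [g Lg [g01 gx gU]] := point_urysohn Kx (oU n) Unx.
  exists [set z | 1 - eps < g z].
    by apply: open_nbhs_nbhs; split; [apply/open_gt_fun/(fl_cont KL)|rewrite /= gx; lra].
  exists n.+1, (fun k => if k == n then g else cst 0); split=> [k|k z|z Kz /ltW gz].
  + case: eqP => [->|_]; last exact: below0.
    by split=> // z Kz; split=> [|/(gU z Kz) ->//]; have /andP[] := g01 z.
  + by case: ifP => //; have /andP[] := g01 z.
  + by exists n; rewrite ?eqxx.
exists N.
have Lh n : L (h n) by have [] := hL n.
apply: (@le_trans _ _ (m (fun x => \sum_(n < N) h n x + cst eps x))).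
  apply: (ls_mono mL) => //.
    by apply: (fl_add KL) => //; [exact: fl_sum|exact: (fl_cst KL)].
  move=> x Kx /=; have [fe|fe] := lerP eps (f x); last first.
    by apply: le_trans (ltW fe) _; rewrite lerDr sumr_ge0.
  have [n nN hn] := hC x Kx (conj Kx fe).
  have [f1 _] := fU x Kx; apply: le_trans f1 _.
  rewrite (bigD1 (Ordinal nN))//= -addrA addrCA [X in X + _](_ : _ = \sum_(i < N | i != Ordinal nN) h i x)//.
  have : 0 <= \sum_(i < N | i != Ordinal nN) h i x by rewrite sumr_ge0.
  lra.
rewrite (ls_add mL); [|exact: fl_sum|exact: (fl_cst KL)].
rewrite ls_cst ls_sum// lerD2r; apply: ler_sum => n _; exact: open_mass_ub.
Qed.

Lemma open_mass_le1 U : open_mass U <= 1.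
Proof. by rewrite -open_massT; exact: open_mass_mono. Qed.

(** The source of Caratheodory measurability of open sets. For a nearly optimal [f] below the
    intersection of [W] and [U], the closed set where [f >= d] is removed from [W]; what remains
    contains the part of [W] outside [U], and functions below it hardly overlap with [f]. *)
Lemma open_mass_split (U W : set E) (eps : R) : open U -> open W -> 0 < eps ->
  exists2 W', open W' & W `&` ~` U `<=` W' /\
    open_mass (W `&` U) + open_mass W' <= open_mass W + eps.
Proof.
move=> oU oW eps0; pose d := eps / 2.
have d0 : 0 < d by exact: divr_gt0.
have [f fWU fd] : exists2 f, below (W `&` U) f & open_mass (W `&` U) - d < m f.
  apply: contrapT => H; suff : open_mass (W `&` U) <= open_mass (W `&` U) - d by lra.
  by apply: open_mass_le => f fb; rewrite leNgt; apply/negP => h; apply: H; exists f.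
pose f' x : R^o := Num.max 0 (f x).
have [Lf' f'WU] : below (W `&` U) f' := open_mass_pos fWU.
have ff' : m f <= m f'.
  apply: (ls_mono mL) => //; first by case: fWU.
  by move=> x _; rewrite /f' le_max lexx orbT.
exists (W `&` ~` (K `&` [set x | d <= f' x])).
  apply: openI => //; apply: closed_openC; apply: closedI; first exact: fl_closed KL.
  by apply/closed_ge_fun/(fl_cont KL).
split=> [x [Wx nUx]|].
  split=> // -[Kx] /=; have [_ h] := f'WU x Kx.
  have : f' x <= 0 by apply: h => -[].
  lra.
suff : open_mass (W `&` ~` (K `&` [set x | d <= f' x])) <= open_mass W + d - m f'.
  by rewrite /d in fd *; lra.
apply: open_mass_le => g [Lg gW]; rewrite lerBrDl.
have d1 : 0 < 1 + d by rewrite addr_gt0.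
(* On [K], [g <= 0] where [f' >= d], and [f' + g <= 1 + d] elsewhere; division by [1 + d] puts the
   sum below [W]. *)
have : m (fun x => (1 + d)^-1 * (f' x + g x)) <= open_mass W.
  apply: open_mass_ub; split; first by apply: (fl_scale KL); exact: (fl_add KL).
  move=> x Kx; have [f1 f2] := f'WU x Kx; have [g1 g2] := gW x Kx; split.
    rewrite ler_pdivrMl// mulr1; have [df|df] := lerP d (f' x).
      have : g x <= 0 by apply: g2 => -[_]; apply.
      lra.
    lra.
  move=> nWx; rewrite pmulr_rle0 ?invr_gt0//.
  have : f' x <= 0 by apply: f2 => -[].
  have : g x <= 0 by apply: g2 => -[].
  lra.
rewrite (ls_scale mL); last exact: (fl_add KL).
rewrite (ls_add mL)// ler_pdivrMl// mulrDl mul1r => /le_trans; apply.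
by rewrite lerD2l -[leRHS]mulr1 ler_wpM2l ?(ltW d0)// open_mass_le1.
Qed.

End State.

End FunctionLattice.

Section Borel.
Variables (R : realType) (E : preTopologicalLmodType R).
Implicit Types (K U C : set E) (f : E -> R^o).

Lemma measurable_open U : open U -> measurable (U : set (borel E)).
Proof. by move=> oU; exact: sub_sigma_algebra. Qed.

Lemma measurable_closed C : closed C -> measurable (C : set (borel E)).
Proof.
move=> cC; rewrite -(setCK C); apply: measurableC; apply: measurable_open.
exact: closed_openC.
Qed.

Lemma within_continuous_measurable K f : closed K -> {within K, continuous f} ->
  measurable_fun (K : set (borel E)) (f : borel E -> R).
Proof.
move=> cK cf; apply: (measurability _ (RGenOpens.measurableE R)).
move=> _ [_ [a [b ->] <-]].
have oab : open [set x : R^o | x \in `]a, b[] by exact: interval_open.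
have /continuousP/(_ _ oab) := cf.
case/open_subspaceP => V oV VK.
rewrite (_ : K `&` _ = V `&` K); last by rewrite VK setIC.
by apply: measurableI; [exact: measurable_open|exact: measurable_closed].
Qed.

End Borel.

Section OuterMass.
Variables (R : realType) (E : topologicalType) (K : set E) (L : (E -> R^o) -> Prop).
Hypothesis KL : function_lattice K L.
Variable m : (E -> R^o) -> R.
Hypothesis mL : lattice_state K L m.
Local Notation mass := (open_mass K L m).

Definition outer_mass (A : set E) : R :=
  inf [set mass U | U in [set U | open U /\ A `<=` U]].

Lemma outer_mass_lb A U : open U -> A `<=` U -> outer_mass A <= mass U.
Proof.
move=> oU AU; apply: ge_inf; last by exists U.
by exists 0 => _ [W _ <-]; exact: (open_mass_ge0 KL mL).
Qed.

Lemma outer_mass_ge A c : (forall U, open U -> A `<=` U -> c <= mass U) ->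
  c <= outer_mass A.
Proof.
move=> h; apply: lb_le_inf; last by move=> _ [U [oU AU] <-]; exact: h.
by exists (mass setT), setT => //; split=> //; exact: openT.
Qed.

Lemma outer_massE U : open U -> outer_mass U = mass U.
Proof.
move=> oU; apply/eqP; rewrite eq_le outer_mass_lb//=; apply: outer_mass_ge => W oW.
exact: (open_mass_mono KL mL).
Qed.

Lemma outer_mass_ge0 A : 0 <= outer_mass A.
Proof. by apply: outer_mass_ge => *; exact: (open_mass_ge0 KL mL). Qed.

Lemma outer_mass0 : outer_mass set0 = 0.
Proof.
rewrite outer_massE; last exact: open0.
by apply: (open_mass_offK KL mL); rewrite set0I.
Qed.

Lemma outer_mass_mono A B : A `<=` B -> outer_mass A <= outer_mass B.
Proof.
move=> AB; apply: outer_mass_ge => U oU BU; apply: outer_mass_lb => //.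
exact: subset_trans BU.
Qed.

Lemma outer_mass_approx A eps : 0 < eps ->
  exists2 U, open U & A `<=` U /\ mass U <= outer_mass A + eps.
Proof.
move=> eps0; apply: contrapT => H.
suff : outer_mass A + eps <= outer_mass A by lra.
apply: outer_mass_ge => U oU AU; rewrite leNgt; apply/negP => h; apply: H.
by exists U => //; split=> //; exact: ltW.
Qed.

Lemma outer_mass_sigma_subadditive :
  sigma_subadditive (fun A => (outer_mass A)%:E).
Proof.
move=> A; apply/lee_addgt0Pr => eps eps0.
pose d := eps / 2; have d0 : 0 < d by exact: divr_gt0.
have dn n : 0 < d / (2 ^ n.+1)%:R by rewrite divr_gt0// ltr0n expn_gt0.
have /choice[U UA] : forall n, exists U, [/\ open U, A n `<=` U &
    mass U <= outer_mass (A n) + d / (2 ^ n.+1)%:R].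
  by move=> n; have [U oU [AU h]] := outer_mass_approx (A n) (dn n); exists U.
have oU : open (\bigcup_n U n) by apply: bigcup_open => n _; have [] := UA n.
apply: (@le_trans _ _ (mass (\bigcup_n U n))%:E).
  rewrite lee_fin; apply: outer_mass_lb => // x [n _ Anx]; exists n => //.
  by have [_ + _] := UA n; apply.
have key f : below K L (\bigcup_n U n) f ->
    ((m f)%:E <= (\sum_(0 <= n <oo) (outer_mass (A n))%:E) + eps%:E)%E.
  move=> fU; have [|N mf] := open_mass_bigcup KL mL _ d0 fU; first by move=> n; have [] := UA n.
  apply: (@le_trans _ _ ((\sum_(0 <= n <oo) ((outer_mass (A n))%:E + (d / (2 ^ n.+1)%:R)%:E)) + d%:E)%E).
    apply: (@le_trans _ _ ((\sum_(0 <= n < N) ((outer_mass (A n))%:E + (d / (2 ^ n.+1)%:R)%:E)) + d%:E)%E).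
      rewrite big_mkord; under eq_bigr do rewrite -EFinD.
      rewrite sumEFin -EFinD lee_fin; apply: le_trans mf _; rewrite lerD2r.
      by apply: ler_sum => n _; have [_ _] := UA n.
    rewrite leeD2r//; apply: nneseries_lim_ge => n _ _.
    by rewrite -EFinD lee_fin addr_ge0 ?outer_mass_ge0// ltW.
  rewrite [eps in leRHS](_ : eps = d + d); last by rewrite /d; lra.
  rewrite EFinD addeA leeD2r//; apply: epsilon_trick; last exact: ltW.
  by move=> n; rewrite lee_fin outer_mass_ge0.
have S0 : (0 <= \sum_(0 <= n <oo) (outer_mass (A n))%:E)%E.
  by apply: nneseries_ge0 => n _ _; rewrite lee_fin outer_mass_ge0.
case: (\sum_(0 <= n <oo) (outer_mass (A n))%:E)%E S0 key => [s| |] //= _ key.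
  rewrite -EFinD lee_fin; apply: (open_mass_le KL) => f /key.
  by rewrite -EFinD lee_fin.
by rewrite addye// leey.
Qed.

Lemma outer_mass_split (U A : set E) : open U ->
  outer_mass (A `&` U) + outer_mass (A `&` ~` U) <= outer_mass A.
Proof.
move=> oU; apply: outer_mass_ge => W oW AW; apply/ler_addgt0Pr => eps eps0.
have [W' oW' [WW' h]] := open_mass_split KL mL oU oW eps0.
apply: le_trans h; apply: lerD; apply: outer_mass_lb => //; first exact: openI.
  exact: setSI.
by move=> x [Ax nUx]; apply: WW'; split=> //; exact: AW.
Qed.

End OuterMass.

Section RieszMeasure.
Variables (R : realType) (E : preTopologicalLmodType R) (K : set E) (L : (E -> R^o) -> Prop).
Hypothesis KL : function_lattice K L.
Variable m : (E -> R^o) -> R.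
Hypothesis mL : lattice_state K L m.
Local Notation mass := (open_mass K L m).
Local Notation out := (outer_mass K L m).

Lemma riesz_probability : exists mu : probability (borel E) R,
  forall A : set (borel E), mu A = (out A)%:E.
Proof.
pose lam (A : set (pointed_at0 E)) : \bar R := (out A)%:E.
have lam0 : lam set0 = 0%E by rewrite /lam (outer_mass0 KL mL).
have lam_ge0 A : (0 <= lam A)%E by rewrite lee_fin (outer_mass_ge0 KL mL).
have lam_mono : {homo lam : A B / A `<=` B >-> (A <= B)%E}.
  by move=> A B AB; rewrite lee_fin; exact: (outer_mass_mono KL mL).
pose om : {outer_measure set (pointed_at0 E) -> \bar R} := HB.pack lam
  (isOuterMeasure.Build R (pointed_at0 E) lam lam0 lam_ge0 lam_mono
    (outer_mass_sigma_subadditive KL mL)).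
have cara (A : set (borel E)) : measurable A -> om.-caratheodory A.
  have -> : om.-caratheodory = (@measurable _ (caratheodory_type om)) by [].
  apply: smallest_sub; first exact: sigma_algebra_measurable.
  move=> U oU; apply: le_caratheodory_measurable => X.
  by rewrite -EFinD lee_fin (outer_mass_split KL mL).
have sa : semi_sigma_additive (lam : set (borel E) -> \bar R).
  move=> A mA tA mUA.
  apply: (@caratheodory_measure_sigma_additive _ _ om A) => // [i|]; exact: cara.
pose mu : {measure set (borel E) -> \bar R} := HB.pack (lam : set (borel E) -> \bar R)
  (isMeasure.Build _ (borel E) R (lam : set (borel E) -> \bar R) lam0 lam_ge0 sa).
have muT : mu setT = 1%E.
  by rewrite /= /lam (outer_massE KL mL) ?(open_massT KL mL)//; exact: openT.
pose P : probability (borel E) R := HB.pack (lam : set (borel E) -> \bar R)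
  (Measure_isProbability.Build _ (borel E) R mu muT) mu.
by exists P.
Qed.

End RieszMeasure.

Section RadonIntegral.
Variables (R : realType) (E : preTopologicalLmodType R) (K : set E).
Hypotheses (cK : compact K) (clK : closed K).
Variable mu : probability (borel E) R.
Hypothesis muK : mu K = 1%E.
Implicit Types (f g : E -> R^o).

Lemma within_continuous_integrable f : {within K, continuous f} ->
  mu.-integrable (K : set (borel E)) (EFin \o f).
Proof.
move=> cf; apply: measurable_bounded_integrable.
- exact: measurable_closed.
- by rewrite ltey_eq fin_num_measure//; exact: measurable_closed.
- exact: within_continuous_measurable.
have : compact (f @` K) by exact: continuous_compact.
move=> /compact_bounded[M [Mr HM]]; exists M; split=> // x Mx y Ky.
by apply: (HM _ Mx); exists y.
Qed.

Lemma Rintegral_EFin f : {within K, continuous f} ->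
  (\int[mu]_(x in K) f x)%:E = (\int[mu]_(x in K) (f x)%:E)%E.
Proof.
move=> /within_continuous_integrable fi; rewrite /Rintegral fineK//.
by apply: integrable_fin_num; first exact: measurable_closed.
Qed.

Lemma Rint_add f g : {within K, continuous f} -> {within K, continuous g} ->
  \int[mu]_(x in K) (f x + g x) = \int[mu]_(x in K) f x + \int[mu]_(x in K) g x.
Proof.
move=> cf cg; apply: RintegralD; first exact: measurable_closed.
  exact: within_continuous_integrable.
exact: within_continuous_integrable.
Qed.

Lemma Rint_scale (a : R) f : {within K, continuous f} ->
  \int[mu]_(x in K) (a * f x) = a * \int[mu]_(x in K) f x.
Proof.
move=> cf; apply: RintegralZl; first exact: measurable_closed.
exact: within_continuous_integrable.
Qed.

Lemma Rint_cst (a : R) : \int[mu]_(x in K) a = a.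
Proof. rewrite Rintegral_cst; last exact: measurable_closed.
by rewrite (_ : fine _ = 1) ?mulr1//; exact: (congr1 fine muK). Qed.

Lemma Rint_mono f g : {within K, continuous f} -> {within K, continuous g} ->
  (forall x, K x -> f x <= g x) -> \int[mu]_(x in K) f x <= \int[mu]_(x in K) g x.
Proof.
move=> cf cg fg; apply: le_Rintegral => //; first exact: measurable_closed.
  exact: within_continuous_integrable.
exact: within_continuous_integrable.
Qed.


Lemma measureIK (A : set (borel E)) : measurable A -> mu (A `&` K) = mu A.
Proof.
move=> mA; have mK : measurable (K : set (borel E)) by exact: measurable_closed.
have muC : mu (~` (K : set (borel E))) = 0%E.
  by rewrite probability_setC// [X in (_ - X)%E]muK subee.
have AK : (mu (A `\` (K : set (borel E))) <= mu (~` (K : set (borel E))))%E.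
  apply: le_measure; rewrite ?inE; [exact: measurableD|exact: measurableC|by move=> x []].
have AK0 : mu (A `\` (K : set (borel E))) = 0%E.
  by apply/eqP; rewrite eq_le measure_ge0 andbT -muC.
by rewrite [RHS](measureDI mu mA mK) -[LHS]add0e; congr (_ + _)%E; exact: esym AK0.
Qed.

Lemma Rint_ge_measure (A : set (borel E)) f : measurable A -> {within K, continuous f} ->
  (forall x, K x -> 0 <= f x) -> (forall x, K x -> A x -> 1 <= f x) ->
  (mu A <= (\int[mu]_(x in K) f x)%:E)%E.
Proof.
move=> mA cf f0 fA; have mK : measurable (K : set (borel E)) by exact: measurable_closed.
rewrite Rintegral_EFin// -(measureIK mA) -integral_indic//.
apply: ge0_le_integral => //.
- exact/measurable_EFinP/measurable_indic.
- by apply/measurable_EFinP; exact: (within_continuous_measurable clK cf).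
- move=> x Kx; rewrite lee_fin indicE; have [Ax|_] := boolP (x \in A); last exact: f0.
  by apply: fA => //; rewrite inE in Ax.
Qed.

Lemma Rint_le_measure (A : set (borel E)) f : measurable A -> {within K, continuous f} ->
  (forall x, K x -> 0 <= f x <= 1) -> (forall x, K x -> ~ A x -> f x <= 0) ->
  ((\int[mu]_(x in K) f x)%:E <= mu A)%E.
Proof.
move=> mA cf f01 fA; have mK : measurable (K : set (borel E)) by exact: measurable_closed.
rewrite Rintegral_EFin// -(measureIK mA) -integral_indic//.
apply: ge0_le_integral => //.
- by move=> x Kx; rewrite lee_fin; have /andP[] := f01 x Kx.
- by apply/measurable_EFinP; exact: (within_continuous_measurable clK cf).
- exact/measurable_EFinP/measurable_indic.
- move=> x Kx; rewrite lee_fin indicE; have [Ax|nA] := boolP (x \in A).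
    by have /andP[] := f01 x Kx.
  by apply: fA => //; move: nA; rewrite notin_setE.
Qed.

End RadonIntegral.

Section RieszMarkov.
Variables (R : realType) (E : preTopologicalLmodType R) (K : set E) (L : (E -> R^o) -> Prop).
Hypothesis KL : function_lattice K L.
Variable m : (E -> R^o) -> R.
Hypothesis mL : lattice_state K L m.
Local Notation mass := (open_mass K L m).
Local Notation out := (outer_mass K L m).
Let cK := fl_compact KL.
Let clK := fl_closed KL.

Lemma fl_within f : L f -> {within K, continuous f}.
Proof. by move=> Lf; have cf := fl_cont KL Lf; exact: continuous_subspaceT. Qed.

Section Measure.
Variable mu : probability (borel E) R.
Hypothesis muE : forall A : set (borel E), mu A = (out A)%:E.

Lemma riesz_measureK : mu K = 1%E.
Proof.
have mK : measurable (K : set (borel E)) by exact: measurable_closed.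
have muC : mu (~` (K : set (borel E))) = 0%E.
  rewrite muE (outer_massE KL mL) ?(open_mass_offK KL mL)//; first by rewrite setICl.
  exact: closed_openC.
by move: (probability_setC mu (measurableC mK)); rewrite setCK muC sube0.
Qed.

(** Outer regularity turned inside out: an open [U] around the complement of [A] leaves the compact
    part of [K] outside [U] inside [A]. *)
Lemma riesz_measure_radon : radon_probability K mu.
Proof.
split; first exact: riesz_measureK.
move=> A mA; apply/eqP; rewrite eq_le; apply/andP; split; last first.
  apply: ge_ereal_sup => _ [C [_ CA] <-]; have -> : mu C = (out C)%:E := muE C.
  by rewrite muE lee_fin (outer_mass_mono KL mL).
apply/lee_addgt0Pr => eps eps0.
have [U oU [AU hU]] := outer_mass_approx K L m (~` A) eps0.
have mU : measurable (U : set (borel E)) by exact: measurable_open.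
have cC : compact (K `&` ~` U).
  by apply: compact_closedI => //; exact: open_closedC.
apply: (@le_trans _ _ (mu (K `&` ~` U) + eps%:E)%E); last first.
  apply: leeD => //; apply: ereal_sup_ubound; exists (K `&` ~` U) => //; split=> //.
  by move=> x [_ nUx]; apply: contrapT => nAx; apply/nUx/AU.
have -> : mu (K `&` ~` U) = mu (~` (U : set (borel E))).
  by rewrite setIC; exact: (measureIK clK riesz_measureK (measurableC mU)).
have := probability_setC mu mU; have := probability_setC mu mA.
rewrite !muE -!EFinB => -[h1] -[->]; rewrite -EFinD lee_fin.
by move: hU; rewrite h1 (outer_massE KL mL oU); lra.
Qed.

(* Cut F into the slices min(F, k+1) - min(F, k). The k-th slice of F has value at
   most the mass of [F > k] under m, and the k-th slice of F + 1 has at least this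
   integral. *)
Lemma riesz_slices F (N : nat) : L F -> (forall x, K x -> 0 <= F x <= N%:R) ->
  m F <= \int[mu]_(x in K) F x + 1.
Proof.
move=> LF F0N.
pose sl (G : E -> R^o) (k : nat) (x : E) : R^o := Num.min (G x) k.+1%:R - Num.min (G x) k%:R.
have Lsl G k : L G -> L (sl G k).
  by move=> LG; apply: (fl_sub KL); apply: (fl_min KL) => //; exact: (fl_cst KL).
have slE G x : \sum_(k < N) sl G k x = Num.min (G x) N%:R - Num.min (G x) 0.
  by rewrite -(big_mkord xpredT (fun k => sl G k x)) (telescope_sumr (fun k => Num.min (G x) k%:R)).
have kk (k : nat) : k.+1%:R = k%:R + 1 :> R by rewrite -addn1 natrD.
pose F1 x : R^o := F x + cst 1 x.
have LF1 : L F1 by apply: (fl_add KL) => //; exact: (fl_cst KL).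
have oF (k : nat) : open [set x | k%:R < F x] by exact/open_gt_fun/(fl_cont KL).
have step k : m (sl F k) <= \int[mu]_(x in K) sl F1 k x.
  rewrite -lee_fin; apply: (@le_trans _ _ (mu [set x | k%:R < F x])); last first.
    apply: (Rint_ge_measure cK clK riesz_measureK).
    - exact: measurable_open (oF k).
    - exact/fl_within/Lsl.
    - move=> x _; rewrite /sl kk; case: (leP (F1 x) k%:R); case: (leP (F1 x) (k%:R + 1)); lra.
    - move=> x _ /= kF; rewrite /sl kk /F1 /=.
      case: (leP (F x + 1) k%:R); case: (leP (F x + 1) (k%:R + 1)); lra.
  rewrite muE lee_fin (outer_massE KL mL)//; apply: (open_mass_ub KL mL).
  split=> [|x Kx]; first exact: Lsl.
  rewrite /sl kk /=; split; last move/negP; rewrite -?leNgt;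
    case: (leP (F x) k%:R); case: (leP (F x) (k%:R + 1)); lra.
apply: (@le_trans _ _ (m (fun x => \sum_(k < N) sl F k x))).
  apply: (ls_mono mL) => //; first by apply: (fl_sum KL) => k; exact: Lsl.
  move=> x Kx; rewrite slE; have /andP[F0 FN] := F0N x Kx.
  by rewrite min_l// min_r// subr0.
rewrite (ls_sum KL mL); last by move=> k; exact: Lsl.
apply: (@le_trans _ _ (\sum_(k < N) \int[mu]_(x in K) sl F1 k x)); first exact: ler_sum.
have -> : \sum_(k < N) \int[mu]_(x in K) sl F1 k x = \int[mu]_(x in K) (\sum_(k < N) sl F1 k x).
  elim: (index_enum _) => [|k s IH].
    rewrite big_nil (_ : (fun x => _) = (fun=> 0)) ?(Rint_cst clK riesz_measureK)//.
    by apply/funext => x; rewrite big_nil.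
  rewrite big_cons IH -(Rint_add cK clK mu); first last.
  - by apply: fl_within; apply: (fl_sum KL) => j; exact: Lsl.
  - exact/fl_within/Lsl.
  by congr Rintegral; apply/funext => x; rewrite big_cons.
rewrite -[X in _ <= _ + X](Rint_cst clK riesz_measureK 1) -(Rint_add cK clK mu); first last.
- by apply: fl_within; exact: (fl_cst KL).
- exact: fl_within.
apply: (Rint_mono cK clK mu).
- by apply: fl_within; apply: (fl_sum KL) => j; exact: Lsl.
- exact: fl_within.
move=> x Kx; rewrite slE; have /andP[F0 FN] := F0N x Kx.
have F10 : 0 <= F1 x by rewrite addr_ge0.
by rewrite (min_r F10) subr0 ge_min lexx.
Qed.

Lemma riesz_integral f : L f -> \int[mu]_(x in K) f x = m f.
Proof.
have le g : L g -> m g <= \int[mu]_(x in K) g x.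
  move=> Lg; rewrite leNgt; apply/negP => h.
  have cgK : compact (g @` K) by apply: continuous_compact => //; exact: fl_within.
  have [M0 [_ HM]] := compact_bounded cgK.
  pose M := `|M0| + 1.
  have gM x : K x -> `|g x| <= M.
    move=> Kx; apply: (HM M); last by exists x.
    by rewrite /M (le_lt_trans (ler_norm _))// ltrDl.
  have M0' : 0 < M by rewrite /M ltr_wpDl.
  pose d := m g - \int[mu]_(x in K) g x; have d0 : 0 < d by rewrite subr_gt0.
  (* The error 1 of [riesz_slices] does not depend on the scale, so multiplication by [2 / d] turns
     the gap [d] into 2, which exceeds it. The shift by [M] makes the function nonnegative on
     [K]. *)
  pose a := 2 / d; have a0 : 0 < a by exact: divr_gt0.
  pose F x : R^o := a * (g x + cst M x).
  have LgM : L (fun x => g x + cst M x) by apply: (fl_add KL) => //; exact: (fl_cst KL).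
  have LF : L F by exact: (fl_scale KL).
  have [N FN] : exists N : nat, forall x, K x -> 0 <= F x <= N%:R.
    exists (Num.bound (a * (M + M))) => x /gM; rewrite ler_norml => /andP[g1 g2].
    rewrite mulr_ge0 /=; [|exact: ltW|by rewrite -lerBlDr sub0r].
    apply: le_trans (ltW (archi_boundP _)); first by rewrite ler_pM2l// lerD2r.
    by rewrite mulr_ge0 ?addr_ge0// ltW.
  have := riesz_slices LF FN.
  rewrite (Rint_scale cK clK mu) ?(ls_scale mL)//; last exact: fl_within.
  rewrite (ls_add mL)//; last exact: (fl_cst KL).
  rewrite (Rint_add cK clK mu) ?(Rint_cst clK riesz_measureK) ?(ls_cst KL mL)//.
  - have : a * d = 2 by rewrite mulfVK// gt_eqF.
    by rewrite /d mulrBr !mulrDr; lra.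
  - exact: fl_within.
  - by apply: fl_within; exact: (fl_cst KL).
move=> Lf; apply/eqP; rewrite eq_le le// andbT.
have LN : L (fun x => -1 * f x) by exact: (fl_scale KL).
have := le _ LN; rewrite (Rint_scale cK clK mu) ?(ls_scale mL)//; last exact: fl_within.
lra.
Qed.

End Measure.

Lemma riesz_markov : exists2 mu : probability (borel E) R, radon_probability K mu &
  forall f, L f -> \int[mu]_(x in K) f x = m f.
Proof.
have [mu muE] := riesz_probability KL mL.
by exists mu; [exact: riesz_measure_radon|exact: riesz_integral].
Qed.

End RieszMarkov.

Section RadonUnique.
Variables (R : realType) (E : preTopologicalLmodType R) (K : set E) (L : (E -> R^o) -> Prop).
Hypotheses (KL : function_lattice K L) (hE : hausdorff_space E).

(** For a compact [C] in [K], its complement is exhausted under [nu], up to [eps], by a compact [D].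
    A function [g] of [L] that is 1 on [C] and 0 on [D] within [K] has the same integral for both
    measures, at least [mu C] and at most [nu C + eps]. *)
Lemma radon_le (mu nu : probability (borel E) R) :
  radon_probability K mu -> radon_probability K nu ->
  (forall f, L f -> \int[mu]_(x in K) f x = \int[nu]_(x in K) f x) ->
  forall A : set (borel E), measurable A -> (mu A <= nu A)%E.
Proof.
move=> [muK rmu] [nuK rnu] munu A mA.
have cK := fl_compact KL; have clK := fl_closed KL.
rewrite rmu//; apply: ge_ereal_sup => _ [C0 [cC0 C0A] <-].
have mC0 : measurable (C0 : set (borel E)) by apply: measurable_closed; exact: compact_closed.
have -> : mu C0 = mu ((C0 : set (borel E)) `&` K) by rewrite (measureIK clK muK).
pose C := C0 `&` K; have cC : compact C by exact: compact_closedI.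
have clC : closed C by exact: compact_closed.
have mC : measurable (C : set (borel E)) by exact: measurable_closed.
apply: (@le_trans _ _ (nu C)); last first.
  by apply: le_measure; rewrite ?inE// => x [/C0A].
apply/lee_addgt0Pr => eps eps0.
have mCC : measurable (~` (C : set (borel E))) by exact: measurableC.
have fC : nu (~` (C : set (borel E))) \is a fin_num by exact: fin_num_measure.
have sf : ereal_sup [set nu D | D in [set D : set E | compact D /\ D `<=` ~` C]]
    \is a fin_num by rewrite -(rnu _ mCC).
have [_ [D [cD DC] <-] hD] := ub_ereal_sup_adherent eps0 sf.
rewrite -(rnu _ mCC) in hD.
have clD : closed D by exact: compact_closed.
have mD : measurable (D : set (borel E)) by exact: measurable_closed.
have CD : C `&` D = set0 by rewrite setIC; exact/disjoints_subset.
have [g Lg [g01 gC gD]] := compact_urysohn KL cC (@subIsetr _ C0 K) clD CD.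
apply: (@le_trans _ _ (\int[mu]_(x in K) g x)%:E).
  apply: (Rint_ge_measure cK clK muK) => //.
  - exact: fl_within KL _ Lg.
  - by move=> x _; have /andP[] := g01 x.
  - by move=> x _ /gC ->.
rewrite munu//; apply: (@le_trans _ _ (nu (~` (D : set (borel E))))).
  apply: (Rint_le_measure cK clK nuK) => //.
  - exact: measurableC.
  - exact: fl_within KL _ Lg.
  - by move=> x Kx /contrapT Dx; rewrite gD.
move: hD; rewrite !probability_setC//.
have /fineK <- := fin_num_measure nu (C : set (borel E)) mC.
have /fineK <- : nu D \is a fin_num := fin_num_measure nu (D : set (borel E)) mD.
move: (fine (nu C)) (fine (nu D)) => a b.
change ((1 - a - eps)%:E < b%:E -> (1 - b)%:E <= (a + eps)%:E)%E.
rewrite lte_fin lee_fin; lra.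
Qed.

Lemma radon_unique (mu nu : probability (borel E) R) :
  radon_probability K mu -> radon_probability K nu ->
  (forall f, L f -> \int[mu]_(x in K) f x = \int[nu]_(x in K) f x) ->
  same_measure mu nu.
Proof.
move=> rmu rnu munu A mA; apply/eqP; rewrite eq_le !radon_le//.
by move=> f Lf; rewrite munu.
Qed.

End RadonUnique.

(** * The Choquet order on states *)


Section StateExtensions.
Variables (R : realType) (V : funSysType R).
Local Notation L := (lattice_system V).
Local Notation e := (fs_unit V).
Implicit Types (x : stateT V) (n : stateT L) (F G : L) (s : seq V).

Definition sup_of s F := forall x, lev x F = pmax s (stfun x).

Lemma sup_ofP s : s != [::] -> exists F, sup_of s F.
Proof.
move=> s0; exists (@mk_lat R V s [:: 0] s0 isT) => x.
by rewrite -[LHS]/(lat_fun _ _ x) /lat_fun pmax1 linear0 subr0.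
Qed.

Lemma stfun_mono n F G : (forall x, lev x F <= lev x G) -> stfun n F <= stfun n G.
Proof.
move=> FG; have [_ np _] := stateTP n; rewrite -subr_ge0 -linearB; apply: np => x.
by rewrite linearB subr_ge0 FG.
Qed.

Lemma sup_of_sub F : exists s t P Q,
  [/\ s != [::], t != [::], sup_of s P, sup_of t Q & F = P - Q].
Proof.
have /asboolP[s [t [s0 t0 FE]]] := valP F.
have [P sP] := sup_ofP s0; have [Q tQ] := sup_ofP t0.
exists s, t, P, Q; split=> //; apply: lev_inj => x.
by rewrite linearB /= sP tQ -[LHS]/(val F x) FE.
Qed.

(* The Choquet order: comparison on the suprema of finite families of V, the
   convex elements of the lattice. *)
Definition choq n n' := forall s F, s != [::] -> sup_of s F -> stfun n F <= stfun n' F.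

Definition extends n x := forall v, stfun n (lat_incl v) = stfun x v.

Definition maximal_state n := forall n', choq n n' -> n' = n.

Definition unique_maximal := forall x, exists n,
  [/\ maximal_state n, extends n x &
      forall n', maximal_state n' -> extends n' x -> n' = n].

Lemma choq_refl n : choq n n.
Proof. by move=> s F _ _. Qed.

Lemma choq_trans n1 n2 n3 : choq n1 n2 -> choq n2 n3 -> choq n1 n3.
Proof. by move=> h k s F s0 sF; exact: le_trans (h s F s0 sF) (k s F s0 sF). Qed.

Lemma choq_anti n n' : choq n n' -> choq n' n -> n = n'.
Proof.
move=> h k; apply/val_inj/funext => F.
have [s [t [P [Q [s0 t0 sP tQ ->]]]]] := sup_of_sub F.
change (stfun n (P - Q) = stfun n' (P - Q)); rewrite !linearB.
by congr (_ - _); apply/eqP; rewrite eq_le (h _ _ _ sP, h _ _ _ tQ)// (k _ _ _ sP, k _ _ _ tQ).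
Qed.

Lemma sup_of_incl v : sup_of [:: v] (lat_incl v).
Proof. by move=> x; rewrite lev_incl pmax1. Qed.

Lemma choq_extends n n' x : choq n n' -> extends n x -> extends n' x.
Proof.
move=> nn' nx v; apply/eqP; rewrite eq_le -!nx (nn' [:: v])//; last exact: sup_of_incl.
rewrite andbT -lerN2 -!linearN; apply: (nn' [:: - v]) => //.
exact: sup_of_incl.
Qed.

Section Decomposition.
Variables (n : stateT L) (x : stateT V) (k : nat).
Hypothesis nx : extends n x.
Local Notation X := ('I_k.+1 -> V).

Let fam (h : X) : seq V := [seq h i | i <- enum 'I_k.+1].

Let fam_neq0 h : fam h != [::].
Proof. by rewrite -size_eq0 size_map size_enum_ord. Qed.

Let el h : L := projT1 (cid (sup_ofP (fam_neq0 h))).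

Let elP h y : lev y (el h) = pmax (fam h) (stfun y).
Proof. exact: (projT2 (cid (sup_ofP (fam_neq0 h)))). Qed.

Let el_ge h y i : stfun y (h i) <= lev y (el h).
Proof. by rewrite elP; apply: pmax_ge; rewrite map_f// mem_enum. Qed.

Let el_le h y c : (forall i, stfun y (h i) <= c) -> lev y (el h) <= c.
Proof. by move=> hc; rewrite elP; apply: pmax_le => // _ /mapP[i _ ->]. Qed.

(* The sublinear functional h |-> n (sup of h) on families h dominates a linear
   functional, exact at a; its coordinates are the z_i. *)
Lemma state_decomposition (a : X) F : sup_of (fam a) F ->
  exists z : 'I_k.+1 -> fs_dual V,
    [/\ forall i, dual_pos (z i), forall v, \sum_i z i v = stfun x v &
        stfun n F <= \sum_i z i (a i)].
Proof.
move=> aF; have {aF}-> : F = el a by apply: lev_inj => y; rewrite aF elP.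
pose p (h : X) : R := stfun n (el h).
have sp : sublinear p.
  split=> [h h'|c h c0].
    rewrite /p -linearD; apply: stfun_mono => y; apply: el_le => i.
    by rewrite [X in X <= _]linearD [leRHS]linearD; apply: lerD; exact: el_ge.
  rewrite /p -[leRHS]/(c *: (stfun n (el h) : R^o)) -linearZ.
  apply: stfun_mono => y; apply: el_le => i.
  by rewrite [X in X <= _]linearZ [leRHS]linearZ /= ler_wpM2l ?(ltW c0).
pose S (h : X) (t : R) := exists2 c : R, 0 <= c & h = c *: a /\ t = c * p a.
have [||||f fp fS] := @mazur_orlicz R X p S sp.
- by exists 0; rewrite ?scale0r ?mul0r.
- move=> _ _ _ _ [c c0 [-> ->]] [d d0 [-> ->]]; exists (c + d); first exact: addr_ge0.
  by rewrite scalerDl mulrDl.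
- move=> d _ _ d0 [c c0 [-> ->]]; exists (d * c); first by rewrite mulr_ge0 ?(ltW d0).
  by rewrite scalerA mulrA.
- by move=> _ _ [c c0 [-> ->]]; rewrite sublinearZ.
have [zl zE fE] := family_functional f.
have zpos i v : fs_pos V v -> 0 <= zl i v.
  move=> vp; rewrite -oppr_le0 -linearN zE; apply: le_trans (fp _) _.
  rewrite /p -(linear0 (stfun n)); apply: stfun_mono => y; rewrite linear0.
  apply: el_le => j; rewrite /single; case: eqP => _; last by rewrite linear0.
  by rewrite linearN oppr_le0; have [_ yp _] := stateTP y; exact: yp.
(* The supremum of a constant family is its element, so [f] is at most [x] there; with [- v] this
   becomes equality, and the coordinates sum to [x]. *)
have fle v : f (fun=> v) <= stfun x v.
  apply: le_trans (fp _) _; rewrite -nx; apply: stfun_mono => y.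
  by apply: el_le => i; rewrite lev_incl.
exists (fun i => mk_bdual (positive_bounded (zpos i))); split=> [i v vp|v|].
- exact: zpos vp.
- change (\sum_i zl i v = stfun x v); rewrite -(fE (fun=> v)).
  apply/eqP; rewrite eq_le fle/= -lerN2 -!linearN.
  by rewrite (_ : - (fun=> v) = (fun=> - v) :> X)// fle.
- change (stfun n (el a) <= \sum_i zl i (a i)); rewrite -fE.
  by apply: fS; exists 1; rewrite ?scale1r ?mul1r.
Qed.

End Decomposition.

(** Zorn's lemma: an upper bound of a chain is a cluster point of its tails in the compact state
    space of [L], since evaluations are continuous and the inequalities pass to cluster points. *)
Lemma maximal_above n0 : exists2 n, choq n0 n & maximal_state n.
Proof.
pose T := {n : stateT L | `[< choq n0 n >]}.
have TP (t : T) : choq n0 (val t) by have /asboolP := valP t.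
pose le (t t' : T) := `[< choq (val t) (val t') >].
have [|||A Atot|t tmax] := @Zorn T le.
- by move=> t; apply/asboolP; exact: choq_refl.
- by move=> r s t /asboolP h /asboolP k; apply/asboolP; exact: choq_trans k.
- by move=> s t /asboolP h /asboolP k; apply/val_inj; exact: choq_anti.
- have [[t0 At0]|A0] := pselect (exists t, A t); last first.
    have n0T : `[< choq n0 n0 >] by apply/asboolP; exact: choq_refl.
    by exists (exist _ n0 n0T) => t At; exfalso; apply: A0; exists t.
  pose up (t : T) : set (stateT L) := [set n | exists2 t' : T, A t' & choq (val t) (val t') /\ n = val t'].
  pose B : set_system (stateT L) := [set U | exists2 t, A t & up t `<=` U].
  have BF : ProperFilter B.
    split.
      by move=> [t At /(_ (val t))]; apply; exists t => //; split=> //; exact: choq_refl.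
    split=> [|U W [t At tU] [t' At' tW]|U W UW [t At tU]].
    - by exists t0.
    - have [/asboolP tt'|/asboolP t't] := Atot _ _ At At'.
        exists t' => // n [r Ar [t'r ->]]; split; [apply: tU|apply: tW].
          by exists r => //; split=> //; exact: choq_trans t'r.
        by exists r.
      exists t => // n [r Ar [tr ->]]; split; [apply: tU|apply: tW]; first by exists r.
      by exists r => //; split=> //; exact: choq_trans tr.
    - by exists t => //; exact: subset_trans UW.
  have [n [_ nB]] := @stateT_compact R L B BF filterT.
  have nub t : A t -> choq (val t) n.
    move=> At s F s0 sF.
    have clF : closed [set n : stateT L | stfun (val t) F <= stfun n F].
      by apply: (@closed_ge_fun _ _ (fun n : stateT L => stfun n F : R^o)); exact: stateT_eval_continuous.
    apply: clF => U Un; apply: nB => //; exists t => // n' [r Ar [tr ->]].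
    exact: tr s0 sF.
  have nT : `[< choq n0 n >] by apply/asboolP; exact: choq_trans (TP t0) (nub _ At0).
  by exists (exist _ n nT) => t At; apply/asboolP; exact: nub.
exists (val t) => // n' tn'.
have n'T : `[< choq n0 n' >] by apply/asboolP; exact: choq_trans (TP t) tn'.
by have /(congr1 val) := tmax (exist _ n' n'T) (asboolT tn').
Qed.

Definition state_dual x : fs_dual V :=
  mk_bdual (positive_bounded (let: And3 _ h _ := stateTP x in h)).

(** The point is [great]: for [F] the supremum of the [a i] and [n] extending [x], the chain is [n F
    <= sum of z_i (a_i) <= sum of (g F) (z_i) = (g F) x]. As an element of V**, [g F] can be
    evaluated at each piece [z_i] of [x] separately. *)
Lemma injective_unique_maximal : injective_fs (bidual V) -> unique_maximal.
Proof.
move=> inj x.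
have [g [gu gp] gi] := inj V L (@lat_incl R V) (@lat_incl_inclusion R V)
  (@bidual_incl R V) (@incl_unital_positive R V).
have xpos : dual_pos (state_dual x) by have [_ h _] := stateTP x.
have nxP : is_state (fun F : L => (g F : bidual V) (state_dual x)).
  split=> [c F G|F /gp|]; first by rewrite linearP.
  - exact.
  - by rewrite gu; have [_ _ h] := stateTP x.
pose nx := mk_state nxP.
have nxx : extends nx x by move=> v; rewrite /nx /= -[LHS]/((g (lat_incl v) : bidual V) _) gi.
have great n : extends n x -> choq n nx.
  move=> ne s F s0 sF; case: s s0 sF => // w s _ sF.
  pose a (i : 'I_(size s).+1) := nth 0 (w :: s) i.
  have sE : [seq a i | i <- enum 'I_(size s).+1] = w :: s.
    apply: (@eq_from_nth _ 0); first by rewrite size_map size_enum_ord.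
    move=> i; rewrite size_map size_enum_ord => ik.
    by rewrite (nth_map ord0) ?size_enum_ord// /a nth_enum_ord.
  have aF : sup_of [seq a i | i <- enum 'I_(size s).+1] F by rewrite sE.
  have [z [zp zx]] := state_decomposition ne aF => /le_trans; apply.
  have xz : state_dual x = \sum_i z i.
    by apply/val_inj/funext => v; rewrite -[LHS]/(stfun x v) -zx; exact/esym/dual_sumE.
  change (\sum_i z i (a i) <= (g F : bidual V) (state_dual x)).
  rewrite xz linear_sum; apply: ler_sum => i _.
  have -> : z i (a i) = (g (lat_incl (a i)) : bidual V) (z i) by rewrite gi.
  have : fs_pos L (F - lat_incl (a i)).
    move=> y; rewrite linearB /= lev_incl sF subr_ge0; apply: pmax_ge.
    exact: mem_nth.
  by move=> /gp /(_ _ (zp i)); rewrite linearB -[X in 0 <= X]/((g F : bidual V) (z i) - (g (lat_incl (a i)) : bidual V) (z i)) subr_ge0.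
have max n : extends n x -> maximal_state n -> n = nx.
  by move=> ne nm; rewrite (nm nx)//; exact: great.
exists nx; split=> // [n' h|n' n'm n'x]; last exact: max.
by apply: choq_anti => //; apply: great; exact: choq_extends h nxx.
Qed.

Lemma positive_unit_eq0 (z : fs_dual V) : dual_pos z -> z e = 0 -> forall v, z v = 0.
Proof.
move=> zp z0 v; have [r r0 [rp rn]] := fs_abs_unit v.
have := zp _ rp; have := zp _ rn; rewrite linearB linearD linearZ /= z0 scaler0.
by move=> ? ?; apply/eqP; rewrite eq_le; apply/andP; split; lra.
Qed.

Lemma positive_extension (z : fs_dual V) : dual_pos z ->
  exists2 f : {linear L -> R^o}, forall F, fs_pos L F -> 0 <= f F &
    forall v, f (lat_incl v) = z v.
Proof.
move=> zp; have := zp _ (@fs_pos_unit R V); rewrite le_eqVlt => /orP[/eqP z0|ze].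
  exists (\0 : {linear L -> R^o}) => // v.
  by rewrite positive_unit_eq0.
have zs : is_state (fun v => (z e)^-1 * z v : R^o).
  split=> [c v w|v vp|]; first by rewrite linearP /= mulrDr !scaleoE mulrCA.
    by rewrite mulr_ge0 ?invr_ge0 ?(ltW ze) ?zp.
  by rewrite mulVf ?gt_eqF.
have [f [_ fp _] fE] := state_extension (@lat_incl_inclusion R V) zs.
exists (z e \*: f : {linear L -> R^o}) => [F Fp|v] /=.
  by rewrite mulr_ge0 ?(ltW ze) ?fp.
by rewrite fE scaleoE mulrA mulfV ?mul1r ?gt_eqF.
Qed.

(** Positive extensions of [z1] and [z2] to [L] are added. The resulting state remembers the
    splitting of [x], because [F] dominates both [a1] and [a2]. *)
Lemma split_state (z1 z2 : fs_dual V) x (a1 a2 : V) F : dual_pos z1 -> dual_pos z2 ->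
  (forall v, z1 v + z2 v = stfun x v) -> sup_of [:: a1; a2] F ->
  exists2 n, extends n x & z1 a1 + z2 a2 <= stfun n F.
Proof.
move=> z1p z2p zx aF.
have [f1 f1p f1E] := positive_extension z1p; have [f2 f2p f2E] := positive_extension z2p.
have nP : is_state (fun G => f1 G + f2 G : R^o).
  split=> [c G H|G Gp|]; first by rewrite !linearP /= scalerDr addrACA.
    by rewrite addr_ge0 ?f1p ?f2p.
  have -> : fs_unit L = lat_incl e by [].
  by rewrite f1E f2E zx; have [_ _ h] := stateTP x.
exists (mk_state nP) => [v|]; first by rewrite -zx -f1E -f2E.
change (z1 a1 + z2 a2 <= f1 F + f2 F); rewrite -f1E -f2E.
apply: lerD; rewrite -subr_ge0 -linearB; [apply: f1p|apply: f2p] => y;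
  by rewrite linearB /= lev_incl aF subr_ge0 pmax_ge// !inE eqxx ?orbT.
Qed.

(** For [F = max (- a1) (- a2)] and [G = max (- b1) (- b2)] the four hypotheses say [F + G <= 0].
    The states obtained from the two splittings lie below the same maximal [N], so the expression
    divided by [c] is at least [- N (F + G)]. *)
Lemma unique_maximal_riesz : unique_maximal -> riesz_ineq V.
Proof.
move=> um x1 x2 y1 y2 x1p x2p y1p y2p xy a1 a2 b1 b2 p11 p12 p21 p22.
have xye v : x1 v + x2 v = y1 v + y2 v.
  by have /(congr1 (fun f : fs_dual V => f v)) := xy.
have [c0|c0] := eqVneq (x1 e + x2 e) 0.
  have x1e := x1p _ (@fs_pos_unit R V); have x2e := x2p _ (@fs_pos_unit R V).
  have y1e := y1p _ (@fs_pos_unit R V); have y2e := y2p _ (@fs_pos_unit R V).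
  have ye := xye e.
  have [x1z x2z] : x1 e = 0 /\ x2 e = 0 by split; lra.
  have [y1z y2z] : y1 e = 0 /\ y2 e = 0 by split; lra.
  by rewrite (positive_unit_eq0 x1p)// (positive_unit_eq0 x2p)// (positive_unit_eq0 y1p)// (positive_unit_eq0 y2p)// !addr0.
pose c := x1 e + x2 e.
have {}c0 : 0 < c by rewrite lt_neqAle eq_sym c0 addr_ge0 ?x1p ?x2p//; exact: fs_pos_unit.
have ci0 : 0 <= c^-1 by rewrite invr_ge0 ltW.
have xP : is_state (fun v => c^-1 * (x1 v + x2 v) : R^o).
  split=> [d v w|v vp|]; last by rewrite mulVf// gt_eqF.
    by rewrite !linearP /= addrACA -scalerDr mulrDr !scaleoE mulrCA.
  by rewrite mulr_ge0 ?addr_ge0 ?x1p ?x2p.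
pose x := mk_state xP.
have sp (z : fs_dual V) : dual_pos z -> dual_pos (c^-1 *: z).
  by move=> zp v vp; exact: mulr_ge0 (zp v vp).
have [F FE] := sup_ofP (isT : [:: - a1; - a2] != [::]).
have [G GE] := sup_ofP (isT : [:: - b1; - b2] != [::]).
have [n1 n1x n1F] : exists2 n, extends n x & c^-1 * x1 (- a1) + c^-1 * x2 (- a2) <= stfun n F.
  by apply: (split_state (sp _ x1p) (sp _ x2p)) => // v; rewrite -[RHS]/(c^-1 * _) mulrDr.
have [n2 n2x n2G] : exists2 n, extends n x & c^-1 * y1 (- b1) + c^-1 * y2 (- b2) <= stfun n G.
  by apply: (split_state (sp _ y1p) (sp _ y2p)) => // v; rewrite -[RHS]/(c^-1 * _) xye mulrDr.
have [N1 nN1 N1m] := maximal_above n1; have [N2 nN2 N2m] := maximal_above n2.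
have [N [_ _ Nu]] := um x.
have N1E := Nu _ N1m (choq_extends nN1 n1x); have N2E := Nu _ N2m (choq_extends nN2 n2x).
have h1 := nN1 [:: - a1; - a2] F isT FE; have h2 := nN2 [:: - b1; - b2] G isT GE.
have FG : stfun N (F + G) <= 0.
  rewrite -(linear0 (stfun N)); apply: stfun_mono => y; rewrite linear0 linearD /= FE GE.
  have [_ yp _] := stateTP y.
  have [u uS ->] := pmax_mem (stfun y) (isT : [:: - a1; - a2] != [::]).
  have [w wS ->] := pmax_mem (stfun y) (isT : [:: - b1; - b2] != [::]).
  rewrite -linearD -oppr_ge0 -linearN opprD; apply: yp.
  move: uS wS; rewrite !inE => /orP[/eqP ->|/eqP ->] /orP[/eqP ->|/eqP ->];
    by rewrite !opprK.
move: FG; rewrite linearD; rewrite N1E in h1; rewrite N2E in h2 => FG.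
have : c^-1 * (x1 a1 + x2 a2 + y1 b1 + y2 b2) >= 0.
  by move: n1F n2G; rewrite !linearN !mulrDr; lra.
by rewrite pmulr_rge0// invr_gt0.
Qed.

End StateExtensions.

(** * Continuous convex functions on the state space *)

Section ConvexFunctions.
Variables (R : realType) (E : lmodType R) (K : set E).
Implicit Types f : E -> R^o.

Lemma convex_functionP f : convex_function K f <->
  forall (t : R) x y, 0 <= t <= 1 -> K x -> K y ->
    f (t *: x + (1 - t) *: y) <= t * f x + (1 - t) * f y.
Proof.
split=> [h t x y /andP[t0 t1] Kx Ky|h t x y].
  by apply: (h (Itv01 t0 t1) x y); rewrite inE.
by rewrite !inE => Kx Ky; apply: h; rewrite //= ge0 le1.
Qed.

End ConvexFunctions.

Section FiniteMinimax.
Variables (R : realType) (T : Type) (n : nat) (D : set T) (q : T -> 'I_n.+1 -> R).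
Hypothesis q_convex : forall (t : R) x y, 0 <= t <= 1 -> D x -> D y ->
  exists2 z, D z & forall i, q z i <= t * q x i + (1 - t) * q y i.

(** Ky Fan's convexity-like form: [D] has no linear structure, and mixing is only required of the
    tuples [q x]. The sublinear bound is the maximum of the coordinates, and the linear functionals
    below it are the convex weights. *)
Lemma finite_minimax (d : R) : D !=set0 -> 0 <= d -> (forall x, D x -> exists i, d <= q x i) ->
  exists l : 'I_n.+1 -> R, [/\ forall i, 0 <= l i, \sum_i l i = 1 &
    forall x, D x -> d <= \sum_i l i * q x i].
Proof.
move=> [x0 Dx0] d0 qd; pose X := 'I_n.+1 -> R^o.
pose p (h : X) : R := \big[Num.max/h ord0]_i h i.
have pge (h : X) i : h i <= p h by exact: le_bigmax.
have ple (h : X) c : (forall i, h i <= c) -> p h <= c by move=> hc; apply: bigmax_le.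
have sp : sublinear p.
  split=> [h h'|c h c0]; apply: ple => i; first exact: lerD.
  by rewrite -[leLHS]/(c * h i) ler_pM2l.
pose S (h : X) (a : R) := exists c x, [/\ 0 <= c, D x, a = c * d & forall i, c * q x i <= h i].
have [||||f fp fS] := @mazur_orlicz R X p S sp.
- by exists 0, x0; split=> // [|i]; rewrite mul0r.
- move=> h h' _ _ [c [x [c0 Dx -> hx]]] [c' [x' [c'0 Dx' -> hx']]].
  have [cc0|cc0] := eqVneq (c + c') 0.
    have [cz c'z] : c = 0 /\ c' = 0 by split; lra.
    exists 0, x0; split=> // [|i]; first by rewrite cz c'z !mul0r addr0.
    have := hx i; have := hx' i; rewrite cz c'z !mul0r.
    by rewrite -[_ <= (h + h') i]/(0 <= h i + h' i); lra.
  have {}cc0 : 0 < c + c' by rewrite lt_neqAle eq_sym cc0 addr_ge0.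
  have t01 : 0 <= c / (c + c') <= 1.
    by rewrite divr_ge0 ?(ltW cc0)//= ler_pdivrMr// mul1r lerDl.
  have [z Dz qz] := q_convex t01 Dx Dx'.
  exists (c + c'), z; split=> // [||i]; [exact: ltW|by rewrite mulrDl|].
  apply: (@le_trans _ _ (c * q x i + c' * q x' i)); last exact: lerD.
  rewrite -ler_pdivlMl//; apply: le_trans (qz i) _.
  by rewrite le_eqVlt; apply/orP; left; apply/eqP; field; rewrite gt_eqF.
- move=> a h _ a0 [c [x [c0 Dx -> hx]]]; exists (a * c), x; split=> // [||i].
  + by rewrite mulr_ge0 ?(ltW a0).
  + by rewrite mulrA.
  + by rewrite -mulrA -[leRHS]/(a * h i) ler_pM2l.
- move=> h _ [c [x [c0 Dx -> hx]]]; have [i qi] := qd x Dx.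
  by apply: le_trans (pge h i); apply: le_trans (hx i); rewrite ler_wpM2l.
have [l lE fE] := coordinate_functional f.
have fl h : f h = \sum_i l i * h i by rewrite fE; apply: eq_bigr => i _; rewrite mulrC.
exists l; split=> [i||x Dx].
- rewrite -oppr_le0 lE -linearN; apply: le_trans (fp _) _; apply: ple => j.
  by rewrite -[leLHS]/(- single i 1 j) /single; case: ifP; rewrite ?oppr0 ?lerN10.
- have f1 : f (fun=> 1) <= 1 by apply: le_trans (fp _) _; exact: ple.
  have fN1 : f (fun=> -1) <= -1 by apply: le_trans (fp _) _; exact: ple.
  have : f (fun=> -1) = - f (fun=> 1) by rewrite -linearN.
  have : f (fun=> 1) = \sum_i l i by rewrite fE; apply: eq_bigr => i _; rewrite mul1r.
  lra.
- by rewrite -fl; apply: fS; exists 1, x; split=> // [|i]; rewrite mul1r.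
Qed.

End FiniteMinimax.

Section ConvexMinorants.
Variables (R : realType) (V : funSysType R).
Local Notation E := (functions_on V).
Local Notation K := (@state_space R V).
Local Notation e := (fs_unit V).
Implicit Types (f : E -> R^o) (x y : E).

Lemma state_convex (t : R) x y : 0 <= t <= 1 -> K x -> K y ->
  K (t *: x + (1 - t) *: y).
Proof.
move=> /andP[t0 t1] [xl xp x1] [yl yp y1].
have E1 v : (t *: x + (1 - t) *: y) v = t * x v + (1 - t) * y v by [].
split=> [c v w|v vp|]; rewrite !E1.
- rewrite xl yl !mulrDr !scaleoE addrACA; congr (_ + _); rewrite mulrDr; congr (_ + _); ring.
- by apply: addr_ge0; apply: mulr_ge0; rewrite ?subr_ge0 ?xp ?yp.
- by rewrite x1 y1; ring.
Qed.

Lemma within_nbhs f (x : E) (A : set R) : {within K, continuous f} -> K x ->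
  nbhs (f x : R^o) A -> nbhs x [set z | K z -> A (f z)].
Proof.
move=> cf Kx fA; have := cf x A fA; rewrite /nbhs /= -nbhs_subspace_in//.
Qed.

Lemma within_lt f x (c : R) : {within K, continuous f} -> K x -> f x < c ->
  nbhs x [set z | K z -> f z < c].
Proof. by move=> cf Kx fc; exact: (within_nbhs cf Kx (lt_nbhsl fc)). Qed.

Lemma within_gt f x (c : R) : {within K, continuous f} -> K x -> c < f x ->
  nbhs x [set z | K z -> c < f z].
Proof. by move=> cf Kx fc; exact: (within_nbhs cf Kx (lt_nbhsr fc)). Qed.

Lemma eval_within (v : V) : {within K, continuous (fun x : E => x v : R^o)}.
Proof. by have cv := @value_continuous R V v; exact: continuous_subspaceT. Qed.

(* [q v x > 0] separates (x, f x) from (y, f y - eps). By compactness finitely many v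
   serve all x, and the minimax lemma merges them into one. *)
Lemma affine_minorant f y (eps : R) : {within K, continuous f} ->
  convex_function K f -> K y -> 0 < eps ->
  exists2 a : V, forall x, K x -> x a <= f x & f y - eps <= y a.
Proof.
move=> cf /convex_functionP fconv Ky eps0; pose c := f y - eps.
pose q (v : V) x := f x - c - (x v - y v).
have qc v : {within K, continuous (q v : E -> R^o)}.
  have cv := @eval_within v.
  by apply: cont_sub; apply: cont_sub => //; exact: cst_continuous.
have [||||s [d d0 sP]] := @compact_induction E K (fun B : set E =>
  exists s : seq V, exists2 d, 0 < d & forall x, K x -> B x -> exists2 v, v \in s & d <= q v x)
  (@state_space_compact R V).
- by exists [::], 1.
- move=> B C [s [d d0 sB]] [s' [d' d'0 s'C]]; exists (s ++ s'), (Num.min d d').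
    by rewrite lt_min d0.
  move=> x Kx [/(sB x Kx)[v vs h]|/(s'C x Kx)[v vs h]]; exists v;
    by rewrite ?mem_cat ?vs ?orbT// ge_min h ?orbT.
- by move=> B C BC [s [d d0 sC]]; exists s, d => // x Kx /BC; exact: sC.
- move=> x Kx; have [v qv] : exists v, 0 < q v x.
    have [->|xy] := pselect (x = y).
      by exists 0; rewrite /q subrr subr0 subr_gt0 /c ltrBlDr ltrDl.
    have [v xv] : exists v, x v <> y v.
      by apply: contrapT => H; apply: xy; apply/funext => v; apply: contrapT => h; apply: H; exists v.
    have dv : x v - y v != 0 by rewrite subr_eq0; apply/eqP.
    have [[xl _ _] [yl _ _]] := (Kx, Ky).
    (* The multiple of [v] for which [q] takes the value 1 at [x]. *)
    pose r := (f x - c - 1) / (x v - y v).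
    have xr : x (r *: v) = r * x v.
      have := xl r v 0; have := xl 1 0 0; rewrite !scale1r !addr0 => x0 ->.
      by rewrite scaleoE; lra.
    have yr : y (r *: v) = r * y v.
      have := yl r v 0; have := yl 1 0 0; rewrite !scale1r !addr0 => y0 ->.
      by rewrite scaleoE; lra.
    by exists (r *: v); rewrite /q xr yr -mulrBr /r mulfVK//; lra.
  exists [set z | K z -> q v x / 2 < q v z].
    by apply: (within_gt (qc v)) => //; lra.
  exists [:: v], (q v x / 2); first exact: divr_gt0.
  by move=> z Kz /(_ Kz) /ltW; exists v; rewrite ?mem_head.
have [k sk] : exists k, size s = k.+1.
  by have [v + _] := sP y Ky Ky; case: (s) => // w s' _; exists (size s').
have [||||l [l0 l1 lq]] := @finite_minimax R E k K (fun x i => q s`_i x) _ d.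
- move=> t x z t01 Kx Kz; exists (t *: x + (1 - t) *: z); first exact: state_convex.
  move=> i; have := fconv t x z t01 Kx Kz; rewrite /q.
  change ((t *: x + (1 - t) *: z) s`_i) with (t * x s`_i + (1 - t) * z s`_i).
  move: (f _) (x _) (z _) => ? ? ?; nra.
- by exists y.
- exact: ltW.
- move=> x Kx; have [v vs dv] := sP x Kx Kx.
  have vk : (index v s < k.+1)%N by rewrite -sk index_mem.
  by exists (Ordinal vk); rewrite /= nth_index.
pose v := \sum_(i < k.+1) l i *: s`_i.
have [yl _ y1] := Ky.
have lin (x : E) : K x -> {f : {linear V -> R^o} | x = f :> (V -> R^o)}.
  by move=> [xl _ _]; exists (mk_linear xl).
(* The multiple of the unit moves the value at [y] to [c = f y - eps]; the difference between [f]
   and this element is then [q v], which is at least [d] on [K]. *)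
exists (v + (c - y v) *: e) => [x Kx|]; last first.
  have [g gE] := lin y Ky; rewrite gE linearD linearZ /= -gE y1 scaleoE mulr1.
  by rewrite addrCA subrr addr0.
have [g gE] := lin x Kx; rewrite gE linearD linearZ /= -gE.
have [_ _ ->] := Kx; rewrite scaleoE mulr1.
have [h hE] := lin y Ky.
have xv : x v = \sum_i l i * x s`_i by rewrite gE linear_sum; apply: eq_bigr => i _; rewrite linearZ.
have yv : y v = \sum_i l i * y s`_i by rewrite hE linear_sum; apply: eq_bigr => i _; rewrite linearZ.
have := lq x Kx; rewrite (_ : \sum_i _ = f x - c - (x v - y v)); first lra.
under eq_bigr do rewrite /q mulrBr mulrBr.
rewrite sumrB sumrB -!mulr_suml l1 !mul1r xv yv -sumrB; congr (_ - _).
by apply: eq_bigr => i _; rewrite mulrBr.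
Qed.

Lemma convex_approx f (eps : R) : {within K, continuous f} ->
  convex_function K f -> 0 < eps -> exists2 s : seq V, s != [::] &
    forall x, K x -> pmax s x <= f x /\ f x - eps <= pmax s x.
Proof.
(* One third for the minorant at [y], and one each for the variation of the minorant and of [f] near
   [y]. *)
move=> cf fconv eps0; pose d := eps / 3; have d0 : 0 < d by exact: divr_gt0.
have [||||s [sf sP]] := @compact_induction E K (fun B : set E => exists s : seq V,
  (forall w, w \in s -> forall x, K x -> x w <= f x) /\
  forall x, K x -> B x -> exists2 v, v \in s & f x - eps <= x v) (@state_space_compact R V).
- by exists [::].
- move=> B C [s [sf sB]] [s' [s'f s'C]]; exists (s ++ s'); split=> [w|x Kx].
    by rewrite mem_cat => /orP[/sf|/s'f].
  by move=> [/(sB x Kx)[v vs h]|/(s'C x Kx)[v vs h]]; exists v; rewrite ?mem_cat ?vs ?orbT.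
- by move=> B C BC [s [sf sC]]; exists s; split=> // x Kx /BC; exact: sC.
- move=> y Ky; have [a af ya] := affine_minorant cf fconv Ky d0.
  have ca := @eval_within a.
  exists ([set z | K z -> y a - d < z a] `&` [set z | K z -> f z < f y + d]).
    apply: filterI; last by apply: within_lt => //; lra.
    by apply: (within_gt ca) => //; lra.
  exists [:: a]; split=> [w|x Kx [/(_ Kx) h1 /(_ Kx) h2]].
    by rewrite inE => /eqP ->.
  by exists a; rewrite ?mem_head//; rewrite /d in ya h1 h2; lra.
(* There are no states when V is the zero space; any nonempty family then serves. *)
have [[y Ky]|K0] := pselect (K !=set0); last first.
  by exists [:: 0] => // x Kx; exfalso; apply: K0; exists x.
have s0 : s != [::] by have [v + _] := sP y Ky Ky; case: (s).
exists s => // x Kx; split; first by apply: pmax_le => // w ws; exact: sf.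
have [v vs h] := sP x Kx Kx; apply: le_trans h _; exact: pmax_ge.
Qed.

Lemma pmax_continuous (s : seq V) : continuous (fun x : E => pmax s x : R^o).
Proof.
rewrite /pmax; move: (head 0 s) => w; elim: s => [|v s IH] /=.
  exact: value_continuous.
by apply: cont_max => //; exact: value_continuous.
Qed.

Lemma pmax_convex (s : seq V) : s != [::] -> convex_function K (fun x : E => pmax s x : R^o).
Proof.
move=> s0; apply/convex_functionP => t x y /andP[t0 t1] _ _.
apply: pmax_le => // w ws.
change (t * x w + (1 - t) * y w <= t * pmax s x + (1 - t) * pmax s y).
by apply: lerD; apply: ler_wpM2l; rewrite ?subr_ge0//; exact: pmax_ge.
Qed.

End ConvexMinorants.

(** * Radon measures as states of the lattice *)

Section MeasuresAndStates.
Variables (R : realType) (V : funSysType R).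
Local Notation E := (functions_on V).
Local Notation K := (@state_space R V).
Local Notation L := (lattice_system V).
Implicit Types (f : E -> R^o) (mu nu : probability (borel E) R) (n : stateT L) (F G : L).

Lemma functions_hausdorff : hausdorff_space E.
Proof.
move=> p q pq; apply/funext => v.
have hc := @value_continuous R V v.
apply: (@Rhausdorff R) => A B pA qB.
by have [x [xA xB]] := pq _ _ (hc p A pA) (hc q B qB); exists (x v).
Qed.

(** Elements of [L] are functions on the subtype [stateT V], while measures integrate functions on
    [E]. A representative is determined on [K] only, see [lat_reprK]. *)
Definition lat_repr f F := continuous f /\ forall x : stateT V, f (stfun x) = lev x F.

Lemma lat_reprK f g F x : lat_repr f F -> lat_repr g F -> K x -> f x = g x.
Proof. by move=> [_ fF] [_ gF] Kx; rewrite -[x]/(stfun (mk_state Kx)) fF gF. Qed.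

Lemma lat_repr_exists F : exists f, lat_repr f F.
Proof.
have [s [t [P [Q [s0 t0 sP tQ ->]]]]] := sup_of_sub F.
exists (fun x => pmax s x - pmax t x); split=> [|x]; last by rewrite linearB /= sP tQ.
by apply: cont_sub; exact: pmax_continuous.
Qed.

Lemma lat_reprP a F G f g : lat_repr f F -> lat_repr g G ->
  lat_repr (fun x => a * f x + g x) (a *: F + G).
Proof.
move=> [cf fF] [cg gG]; split=> [|x]; last by rewrite linearP /= fF gG.
by apply: cont_add => //; exact: cont_scale.
Qed.

Lemma sup_of_repr (s : seq V) F : sup_of s F -> lat_repr (fun x : E => pmax s x) F.
Proof. by move=> sF; split=> [|x]; [exact: pmax_continuous|rewrite sF]. Qed.

Lemma incl_repr (v : V) : lat_repr (fun x : E => x v) (lat_incl v).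
Proof. by split=> [|x]; [exact: value_continuous|rewrite lev_incl]. Qed.

Lemma unit_repr (c : R) : lat_repr (cst c) (c *: fs_unit L).
Proof.
split=> [|x]; first exact: cst_continuous.
by rewrite linearZ /= lev_unit scaleoE mulr1.
Qed.

Definition lat_functions f := exists F, lat_repr f F.

Lemma state_function_lattice : function_lattice K lat_functions.
Proof.
split.
- exact: state_space_compact.
- exact: state_space_closed.
- by move=> f [F []].
- by move=> c; exists (c *: fs_unit L); exact: unit_repr.
- move=> f g [F fF] [G gG]; exists (1 *: F + G).
  have := lat_reprP 1 fF gG; congr lat_repr.
  by apply/funext => x; rewrite mul1r.
- move=> a f [F fF]; exists (a *: F + 0 *: fs_unit L).
  have := lat_reprP a fF (unit_repr 0); congr lat_repr.
  by apply/funext => x; rewrite addr0.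
- move=> f g [F [cf fF]] [G [cg gG]]; have [H HE] := lat_max F G; exists H.
  by split=> [|x]; [exact: cont_max|rewrite HE fF gG].
- move=> x y Kx Ky xy.
  have [v xv] : exists v, x v <> y v.
    by apply: contrapT => H; apply: xy; apply/funext => v; apply: contrapT => h; apply: H; exists v.
  by exists (fun x : E => x v) => //; exists (lat_incl v); exact: incl_repr.
Qed.
Let KL := state_function_lattice.
Let cK := fl_compact KL.
Let clK := fl_closed KL.

Lemma repr_within f F : lat_repr f F -> {within K, continuous f}.
Proof. by move=> fF; apply: (fl_within KL); exists F. Qed.

Definition integrates mu n := radon_probability K mu /\
  forall f F, lat_repr f F -> \int[mu]_(x in K) f x = stfun n F.

Lemma state_integrates n : exists mu, integrates mu n.
Proof.
pose m f : R := if pselect (lat_functions f) is left h then stfun n (projT1 (cid h)) else 0.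
have mE f F : lat_repr f F -> m f = stfun n F.
  move=> fF; rewrite /m; case: pselect => [h|]; last by case; exists F.
  case: (cid h) => G fG /=; congr (stfun n _); apply: lev_inj => x.
  by have [_ <-] := fG; have [_ <-] := fF.
have mL : lattice_state K lat_functions m.
  split.
  - move=> f g [F fF] [G gG]; rewrite (mE _ _ fF) (mE _ _ gG).
    rewrite (mE _ (1 *: F + G)); first by rewrite linearD scale1r.
    have := lat_reprP 1 fF gG; congr lat_repr.
    by apply/funext => x; rewrite mul1r.
  - move=> a f [F fF]; rewrite (mE _ _ fF).
    rewrite (mE _ (a *: F + 0 *: fs_unit L)); first by rewrite scale0r addr0 linearZ.
    have := lat_reprP a fF (unit_repr 0); congr lat_repr.
    by apply/funext => x; rewrite addr0.
  - move=> f g [F fF] [G gG] fg; rewrite (mE _ _ fF) (mE _ _ gG).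
    apply: stfun_mono => x; have [_ <-] := fF; have [_ <-] := gG.
    by apply: fg; exact: stateTP.
  - by rewrite (mE _ _ (unit_repr 1)) scale1r; have [_ _] := stateTP n.
have [mu rmu muE] := riesz_markov KL mL.
exists mu; split=> // f F fF; rewrite muE ?(mE _ _ fF)//.
by exists F.
Qed.

Lemma integrates_state mu : radon_probability K mu -> exists n, integrates mu n.
Proof.
move=> rmu; have muK := rmu.1; pose ex F := projT1 (cid (lat_repr_exists F)).
have exP F : lat_repr (ex F) F := projT2 (cid (lat_repr_exists F)).
pose N F : R^o := \int[mu]_(x in K) ex F x.
have NE f F : lat_repr f F -> \int[mu]_(x in K) f x = N F.
  by move=> fF; apply: eq_Rintegral => x; rewrite inE => Kx; exact: (lat_reprK fF (exP F) Kx).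
have NP : is_state N.
  split=> [a F G|F Fp|].
  - rewrite -(NE _ _ (lat_reprP a (exP F) (exP G))) (Rint_add cK clK mu).
    + by rewrite (Rint_scale cK clK mu)//; exact: repr_within (exP F).
    + apply: (fl_within KL); apply: (fl_scale KL); by exists F.
    + exact: repr_within (exP G).
  - rewrite -[X in X <= _](Rint_cst clK muK 0); apply: (Rint_mono cK clK mu).
    + exact: repr_within (unit_repr 0).
    + exact: repr_within (exP F).
    + move=> x Kx; have [_ h] := exP F; have := Fp (mk_state Kx).
      by rewrite -h.
  - rewrite -(NE (cst 1)) ?(Rint_cst clK muK)//.
    by rewrite -[fs_unit L]scale1r; exact: unit_repr.
by exists (mk_state NP).
Qed.

Lemma integrates_measure mu nu n : integrates mu n -> integrates nu n -> same_measure mu nu.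
Proof.
move=> [rmu muE] [rnu nuE]; apply: (radon_unique KL functions_hausdorff) => //.
by move=> f [F fF]; rewrite (muE _ F)// (nuE _ F).
Qed.

Lemma same_measure_integrates mu nu n n' : same_measure mu nu ->
  integrates mu n -> integrates nu n' -> n = n'.
Proof.
move=> munu [_ muE] [_ nuE]; apply/val_inj/funext => F.
have [f fF] := lat_repr_exists F; change (stfun n F = stfun n' F).
rewrite -(muE f F)// -(nuE f F)//; congr fine.
by apply: eq_measure_integral => A mA _; exact: munu.
Qed.

Lemma le_ereal_Rint mu nu f : {within K, continuous f} ->
  ((\int[mu]_(x in K) (f x)%:E <= \int[nu]_(x in K) (f x)%:E)%E <->
   \int[mu]_(x in K) f x <= \int[nu]_(x in K) f x).
Proof.
by move=> cf; rewrite -(Rintegral_EFin cK clK mu cf) -(Rintegral_EFin cK clK nu cf) lee_fin.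
Qed.

(** [choquet_le] tests all continuous convex functions; by [convex_approx] each is a uniform limit
    on [K] of maxima of finite families in V, which are what [choq] tests. *)
Lemma choquet_choq mu nu n n' : integrates mu n -> integrates nu n' ->
  choquet_le K mu nu <-> choq n n'.
Proof.
move=> [[muK _] muE] [[nuK _] nuE]; split=> [h s F s0 sF|h f cf fconv].
  have sF' := sup_of_repr sF; rewrite -(muE _ _ sF') -(nuE _ _ sF').
  by apply/le_ereal_Rint; [exact: repr_within sF'|apply: h; [exact: repr_within sF'|exact: pmax_convex]].
apply/le_ereal_Rint => //; apply/ler_addgt0Pr => eps eps0.
have [s s0 sf] := convex_approx cf fconv eps0; have [F sF] := sup_ofP s0.
have sF' := sup_of_repr sF; have cs := repr_within sF'.
have cc := repr_within (unit_repr eps).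
apply: (@le_trans _ _ (\int[mu]_(x in K) (pmax s x + cst eps x))).
  apply: (Rint_mono cK clK mu) => //.
    apply: (fl_within KL); apply: (fl_add KL); first by exists F.
    exact: (fl_cst KL).
  by move=> x Kx; have [_ h2] := sf x Kx; rewrite /= -lerBlDr.
rewrite (Rint_add cK clK mu cs cc) (Rint_cst clK muK) lerD2r.
rewrite (muE _ _ sF'); apply: le_trans (h _ _ s0 sF) _; rewrite -(nuE _ _ sF').
by apply: (Rint_mono cK clK nu) => // x /sf[].
Qed.

Lemma jensen mu n (x : stateT V) f : integrates mu n -> extends n x ->
  {within K, continuous f} -> convex_function K f -> f (stfun x) <= \int[mu]_(y in K) f y.
Proof.
move=> [_ muE] nx cf fconv; apply/ler_addgt0Pr => eps eps0.
have [a af xa] := affine_minorant cf fconv (stateTP x) eps0.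
rewrite -lerBlDr; apply: le_trans xa _; rewrite -[leLHS]nx -(muE _ _ (incl_repr a)).
by apply: (Rint_mono cK clK mu) => //; exact: repr_within (incl_repr a).
Qed.

(** A continuous affine [f] need not come from V, which may be incomplete; but [f] and [- f] are
    both convex, so [jensen] applies to each. *)
Lemma represents_extends mu n (x : stateT V) : integrates mu n ->
  represents K mu (stfun x : E) <-> extends n x.
Proof.
move=> mun; have [[muK _] muE] := mun; split=> [h v|h f cf faff].
  have vR := incl_repr v; rewrite -(muE _ _ vR); apply/EFin_inj.
  rewrite (Rintegral_EFin cK clK mu (repr_within vR)); apply: h; first exact: repr_within vR.
  by [].
rewrite -(Rintegral_EFin cK clK mu cf); congr (_%:E); apply/eqP; rewrite eq_le.
have fconv : convex_function K f.
  by apply/convex_functionP => t y z t01 Ky Kz; rewrite faff.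
have gconv : convex_function K (fun y => -1 * f y : R^o).
  apply/convex_functionP => t y z t01 Ky Kz; rewrite faff// !scaleoE.
  by rewrite le_eqVlt; apply/orP; left; apply/eqP; ring.
have cg : {within K, continuous (fun y => -1 * f y : R^o)}.
  by apply: cont_scale.
have := jensen mun h cg gconv; rewrite (Rint_scale cK clK mu (-1) cf).
have := jensen mun h cf fconv.
by move=> h1 h2; apply/andP; split; lra.
Qed.

Lemma boundary_maximal mu n : integrates mu n ->
  boundary_measure K mu <-> maximal_state n.
Proof.
move=> mun; split=> [[_ h] n' nn'|h].
  have [nu nun'] := state_integrates n'.
  apply: (same_measure_integrates _ nun' mun); apply: h; first by case: nun'.
  exact/(choquet_choq mun nun').
split=> [|nu rnu munu]; first by case: mun.
have [n' nun'] := integrates_state rnu.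
have n'n := h n' ((choquet_choq mun nun').1 munu).
by rewrite n'n in nun'; exact: integrates_measure nun' mun.
Qed.

Lemma choquet_simplexP : choquet_simplex K <-> unique_maximal V.
Proof.
split=> [h x|h x Kx].
  have [mu [mub mux muu]] := h (stfun x) (stateTP x).
  have [n mun] := integrates_state mub.1.
  exists n; split=> [||n' n'm n'x]; [exact/(boundary_maximal mun)|exact/(represents_extends x mun)|].
  have [nu nun'] := state_integrates n'.
  apply: (same_measure_integrates _ nun' mun); apply: muu.
    exact/(boundary_maximal nun').
  exact/(represents_extends x nun').
have [n [nm nx nu]] := h (mk_state Kx); have [mu mun] := state_integrates n.
exists mu; split=> [||nu' nub nux]; first exact/(boundary_maximal mun).
  exact/(represents_extends (mk_state Kx) mun).
have [n' nun'] := integrates_state nub.1.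
have n'n := nu n' ((boundary_maximal nun').1 nub)
  ((represents_extends (mk_state Kx) nun').1 nux).
by rewrite n'n in nun'; exact: integrates_measure nun' mun.
Qed.

End MeasuresAndStates.

Theorem theorem4p4 (R : realType) (V : funSysType R) :
  [<->
   nuclear V;
   forall E : funSysType R, fin_dim E -> min_cone V E = max_cone V E;
   exists (L : directedSet) (n : L -> nat)
          (phi : forall l, {linear V -> linfty R (n l)})
          (psi : forall l, {linear linfty R (n l) -> V}),
     [/\ forall l, unital_positive (phi l),
         forall l, unital_positive (psi l) &
         forall v, (fun l => ornorm (psi l (phi l v) - v)) @ net_filter L
                     --> (0 : R)];
   exists (L : directedSet) (n : L -> nat)
          (phi : forall l, {linear bidual V -> linfty R (n l)})
          (psi : forall l, {linear linfty R (n l) -> bidual V}),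
     [/\ forall l, unital_positive (phi l) /\
                   continuous (phi l : weak_star V -> 'rV[R]_(n l)),
         forall l, unital_positive (psi l) /\
                   continuous (psi l : 'rV[R]_(n l) -> weak_star V) &
         forall F : bidual V,
           ((fun l => psi l (phi l F)) : L -> weak_star V) @ net_filter L
             --> (F : weak_star V)];
   injective_fs (bidual V);
   forall (K : compactHausdorffType) (j : {linear bidual V -> cfun R K}),
     fs_inclusion j ->
     exists2 Phi : {linear cfun R K -> bidual V},
       unital_positive Phi & forall v, Phi (j (bidual_incl v)) = bidual_incl v;
   forall (W1 W2 : funSysType R) (i : {linear V -> W1}), fs_inclusion i ->
     order_embedding (max_cone V W2) (max_cone W1 W2) (tens_map i idfun);
   forall (W E : funSysType R) (i : {linear V -> W}), fs_inclusion i ->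
     fin_dim E ->
     order_embedding (max_cone V E) (max_cone W E) (tens_map i idfun);
   forall (W1 W2 : funSysType R) (i : {linear W1 -> W2}), fs_inclusion i ->
     order_embedding (max_cone V W1) (max_cone V W2) (tens_map idfun i);
   choquet_simplex (state_space V)].
Proof.
have nuc := @approx_nuclear R V.
have rinj := @riesz_injective R V.
have wapp := @weak_approx_approx R V.
have injA : injective_fs (bidual V) -> approx_id V.
  by move=> /injective_cfun_retract/cfun_retract_weak.
have nucR : nuclear V -> riesz_ineq V by move=> h; exact: min_max_riesz.
tfae.
- by move=> h E _; exact: h.
- by move=> h; apply/approx_net/injA/rinj/min_max_riesz/h/sq_fin_dim.
- move=> /net_approx/nuc/nucR/rinj/injective_bidual_approx.
  exact: bidual_approx_net.
- by move=> /point_weak_weak/wapp/nuc/nucR.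
- exact: injective_cfun_retract.
- move=> /cfun_retract_weak/wapp/nuc h W1 W2 i ii.
  exact: max_embedding (h W2) ii (idfun_inclusion W2).
- by move=> h W E i ii _; exact: h.
(* The hypothesis is tested on the inclusion of V in the nuclear [lattice_system V], tensored with
   the square: it gives min = max for V and the square, hence the Riesz inequality and nuclearity of
   V. *)
- move=> h W1 W2 i ii; apply: max_embedding ii; last exact: idfun_inclusion.
  apply/nuc/injA/rinj/min_max_riesz.
  apply: (embedding_min_max (@lat_incl_inclusion R V)).
    exact/approx_nuclear/lattice_system_approx.
  by apply: h; [exact: lat_incl_inclusion|exact: sq_fin_dim].
(* The test inclusion is the square in R^4. *)
- move=> h; have /embedding_riesz/rinj/injective_unique_maximal := h _ _ _ (sq_row_inclusion R).
  by move/choquet_simplexP.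
- by move=> /choquet_simplexP/unique_maximal_riesz/rinj/injA/nuc.
Qed.
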